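(* Let $F$ be a finite group. Let $\eta$ be the real root of $X^3+X^2+X-2$ and let $\alpha_0=\frac{\log 2}{\log 2-\log\eta}$. For any $\alpha_0\le\alpha<\beta\le 1$ there exist uncountably many groups $\Gamma_\omega=F\wr_X G_\omega$, $\omega\in\{0,1,2\}^{\mathbb N}$, with pairwise non comparable growth functions (such a collection of groups is called an antichain) satisfying $\underline{\alpha}(\Gamma_\omega)=\alpha$ and $\overline{\alpha}(\Gamma_\omega)=\beta$. Moreover, if $\beta<\beta'\le 1$, such an antichain can be chosen so that $b_\omega(r)\le C e^{r^{\beta'}}$ for a constant $C$ depending only on $\beta,\beta'$ and not on $\omega$.
   Context: Let $T$ be the infinite rooted binary tree, with vertices the finite words over $\{0,1\}$ and boundary $\partial T=\{0,1\}^{\mathbb N}$. The group $Aut(T)$ acts on the right, and $g\in Aut(T)$ is written $g=(g_0,g_1)\tau$ with $g_0,g_1\in Aut(T)$, $\tau\in S_2$ (permutations of $\{0,1\}$), meaning $(ty)\cdot g=\tau(t)\,(y\cdot g_t)$ for $t\in\{0,1\}$; this identifies $Aut(T)$ with $(Aut(T)\times Aut(T))\rtimes S_2$. Let $\varepsilon$ be the nontrivial element of $S_2$. For $\omega=\omega_0\omega_1\omega_2\dots\in\{0,1,2\}^{\mathbb N}$ let $\sigma\omega=\omega_1\omega_2\dots$ be the shift. The group $G_\omega=\langle a,b_\omega,c_\omega,d_\omega\rangle\le Aut(T)$ is generated by $a=(1,1)\varepsilon$ and the recursively defined $b_\omega=(u^b(\omega_0),b_{\sigma\omega})$, $c_\omega=(u^c(\omega_0),c_{\sigma\omega})$,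 $d_\omega=(u^d(\omega_0),d_{\sigma\omega})$, where $u^b(0)=u^b(1)=a$, $u^b(2)=id$; $u^c(0)=u^c(2)=a$, $u^c(1)=id$; $u^d(1)=u^d(2)=a$, $u^d(0)=id$. Let $\rho=1^\infty\in\partial T$ (fixed by $b_\omega,c_\omega,d_\omega$) and $X=\rho G_\omega$ its orbit. For a finite group $F$, $\Gamma_\omega=F\wr_X G_\omega=(\Sigma_X F)\rtimes G_\omega$, where $\Sigma_X F$ is the group of finitely supported functions $\varphi:X\to F$, $G_\omega$ acts by $(g.\varphi)(x)=\varphi(xg)$, and elements $\varphi g$ multiply by $(\varphi_1g_1)(\varphi_2g_2)=(\varphi_1(g_1.\varphi_2))(g_1g_2)$. For $f\in F$ let $\varphi_f\in\Sigma_XF$ be the function with value $f$ at $\rho$ and $id_F$ elsewhere. The generating set of $\Gamma_\omega$ is $S_\omega=\{a\}\sqcup\{\varphi_f v\mid v\in\{id,b_\omega,c_\omega,d_\omega\},f\in F\}$, and $b_\omega(r)$ is the number of elements of $\Gamma_\omega$ of word length at most $r$ with respect to $S_\omega$. The exponents are $\underline{\alpha}(\Gamma_\omega)=\liminf_{r\to\infty}\frac{\log\log b_\omega(r)}{\log r}$ and $\overline{\alpha}(\Gamma_\omega)=\limsup_{r\to\infty}\frac{\log\log b_\omega(r)}{\log r}$. For growth functions, $f\precsim g$ means that there is a constant $C$ with $f(r)\le g(Cr)$ for all $r$; $f$ and $g$ are comparable if $f\precsim g$ or $g\precsim f$, and non comparable otherwise. *)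

(* Defs.v *)
From HB Require Import structures.
From mathcomp Require Import all_boot all_order all_algebra fingroup perm finmap.
From mathcomp Require Import boolp classical_sets functions cardinality.
From mathcomp Require Import reals ereal topology normedtype sequences exp.

Set Implicit Arguments.
Unset Strict Implicit.
Unset Printing Implicit Defensive.

Import Order.TTheory GRing.Theory Num.Theory.

Local Open Scope classical_set_scope.
Local Open Scope group_scope.

Definition subgroup_gen (gT : groupType) (S : set gT) : set gT :=
  smallest (fun H : set gT => group_closed (mem H)) S.

Definition subgroup_type (gT : groupType) (S : set gT) :=
  set_type (subgroup_gen S).

HB.instance Definition _ (gT : groupType) (S : set gT) :=
  SubChoice.on (@subgroup_type gT S).

Lemma subgroup_gen_closed (gT : groupType) (S : set gT) :
  group_closed [pred g | g \in subgroup_gen S].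
Proof.
split=> [|g h].
  by rewrite -topredE /=; apply/mem_set => H [[+ _] _]; rewrite inE.
rewrite -!topredE /= => /set_mem gS /set_mem hS; apply/mem_set => H [Hc HS].
have gH : g \in mem H by apply: mem_set; exact: gS.
have hH : h \in mem H by apply: mem_set; exact: hS.
exact: set_mem (snd Hc g h gH hH).
Qed.

HB.instance Definition _ (gT : groupType) (S : set gT) :=
  SubChoice_isSubGroup.Build gT _ (@subgroup_type gT S)
    (@subgroup_gen_closed gT S).

Lemma mem_subgroup_gen (gT : groupType) (S : set gT) g : S g -> g \in subgroup_gen S.
Proof. by move=> Sg; rewrite inE => H [_]; apply. Qed.

Definition word_ball (gT : groupType) (S : set gT) (r : nat) : set gT :=
  [set g | exists s : seq gT,
    [/\ (size s <= r)%N,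
        forall x, x \in s -> S x \/ S x^-1 &
        g = \prod_(x <- s) x]].

Lemma finite_word_ball (gT : groupType) (S : set gT) r :
  finite_set S -> finite_set (word_ball S r).
Proof.
move=> fS; pose T := S `|` [set x^-1 | x in S].
have fT : finite_set T by rewrite finite_setU; split=> //; exact: finite_image.
elim: r => [|r IH].
  apply: (@sub_finite_set _ _ [set 1]); last exact: finite_set1.
  by move=> g [[|x s] [//= _ _ ->]]; rewrite big_nil.
apply: (@sub_finite_set _ _
  ([set 1] `|` [set x * y | x in T & y in word_ball S r])); last first.
  rewrite finite_setU; split; first exact: finite_set1.
  exact: finite_image2.
move=> g [[|x s] [szs Ss ->]]; first by left; rewrite big_nil.
right; rewrite big_cons; exists x.
  have [Sx|Sx] := Ss x (mem_head _ _); first by left.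
  by right; exists x^-1; rewrite ?invgK.
exists (\prod_(y <- s) y) => //; exists s; split=> // y ys.
by apply: Ss; rewrite inE ys orbT.
Qed.

Definition growth (gT : groupType) (S : set gT) (r : nat) : nat :=
  #|` fset_set (word_ball S r)|.

(* As growth functions are nondecreasing, a natural constant is no restriction. *)
Definition growth_le (f g : nat -> nat) : Prop :=
  exists C : nat, forall r : nat, (f r <= g (C * r))%N.

Definition growth_comparable (f g : nat -> nat) : Prop :=
  growth_le f g \/ growth_le g f.

Section Exponents.
Variable R : realType.
Local Open Scope ring_scope.

Definition loglog_ratio (b : nat -> nat) (r : nat) : \bar R :=
  (ln (ln (b r)%:R) / ln r%:R)%:E.

Definition lower_exponent (b : nat -> nat) : \bar R :=
  limn_einf (loglog_ratio b).

Definition upper_exponent (b : nat -> nat) : \bar R :=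
  limn_esup (loglog_ratio b).

End Exponents.

(* The vertices are the words over [bool], the letters 0 and 1 being [false]
   and [true].  An automorphism is a bijection of the vertices that preserves
   the levels and the ancestor relation. *)
Record treeAut := TreeAut {
  aut_fun :> seq bool -> seq bool;
  aut_inv : seq bool -> seq bool;
  aut_funK : cancel aut_fun aut_inv;
  aut_invK : cancel aut_inv aut_fun;
  aut_size : forall u, size (aut_fun u) = size u;
  aut_prefix : forall u v, prefix u v -> prefix (aut_fun u) (aut_fun v) }.

HB.instance Definition _ := gen_eqMixin treeAut.
HB.instance Definition _ := gen_choiceMixin treeAut.

Lemma treeAut_eq (g h : treeAut) : g =1 h -> g = h.
Proof.
case: g h => [f fi fK fiK fs fp] [k ki kK kiK ks kp] /= /funext fk; subst k.
have e : fi = ki by apply: funext => u; rewrite -{1}(kiK u) fK.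
subst ki; congr TreeAut; exact: Prop_irrelevance.
Qed.

Lemma aut_inv_size (g : treeAut) u : size (aut_inv g u) = size u.
Proof. by rewrite -[in RHS](aut_invK g u) aut_size. Qed.

Lemma prefix_eq (u v : seq bool) : prefix u v -> size u = size v -> u = v.
Proof. by rewrite prefixE => /eqP + s; rewrite s take_size. Qed.

Lemma aut_inv_prefix (g : treeAut) u v :
  prefix u v -> prefix (aut_inv g u) (aut_inv g v).
Proof.
move=> uv; have suv := size_prefix uv.
have -> : aut_inv g u = take (size u) (aut_inv g v); last exact: prefix_take.
apply: (can_inj (aut_funK g)); rewrite aut_invK.
set w := take _ _.
have sw : size (g w) = size u.
  by rewrite aut_size size_takel // aut_inv_size.
have : prefix (g w) v.
  rewrite -[X in prefix _ X](aut_invK g v); apply: aut_prefix; exact: prefix_take.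
by move: uv; rewrite !prefixE sw => /eqP -> /eqP.
Qed.

Definition aut_one : treeAut :=
  @TreeAut id id (fun _ => erefl) (fun _ => erefl) (fun _ => erefl)
    (fun _ _ uv => uv).

Definition aut_invg (g : treeAut) : treeAut :=
  TreeAut (aut_invK g) (aut_funK g) (aut_inv_size g) (@aut_inv_prefix g).

Section Mul.
Variables g h : treeAut.

Fact aut_mul_size u : size ((h \o g) u) = size u.
Proof. by rewrite /= !aut_size. Qed.

Fact aut_mul_prefix u v : prefix u v -> prefix ((h \o g) u) ((h \o g) v).
Proof. by move=> uv; do 2!apply: aut_prefix. Qed.

(* Automorphisms act on the right: [g * h] is [g] followed by [h]. *)
Definition aut_mul : treeAut :=
  @TreeAut (h \o g) (aut_inv g \o aut_inv h)
    (can_comp (aut_funK h) (aut_funK g)) (can_comp (aut_invK g) (aut_invK h))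
    aut_mul_size aut_mul_prefix.

End Mul.

Fact aut_mulA : associative aut_mul.
Proof. by move=> g h k; exact: treeAut_eq. Qed.
Fact aut_mul1g : left_id aut_one aut_mul.
Proof. by move=> g; exact: treeAut_eq. Qed.
Fact aut_mulg1 : right_id aut_one aut_mul.
Proof. by move=> g; exact: treeAut_eq. Qed.
Fact aut_mulVg : left_inverse aut_one aut_invg aut_mul.
Proof. by move=> g; apply: treeAut_eq => u; exact: aut_invK. Qed.
Fact aut_mulgV : right_inverse aut_one aut_invg aut_mul.
Proof. by move=> g; apply: treeAut_eq => u; exact: aut_funK. Qed.

HB.instance Definition _ := isGroup.Build treeAut
  aut_mulA aut_mul1g aut_mulg1 aut_mulVg aut_mulgV.

Section Pair.
Variables (g0 g1 : treeAut) (tau : {perm bool}).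

Definition aut_pair_fun (u : seq bool) : seq bool :=
  if u is t :: y then tau t :: (if t then g1 else g0) y else [::].

Definition aut_pair_inv (u : seq bool) : seq bool :=
  if u is s :: y then
    let t := tau^-1 s in t :: aut_inv (if t then g1 else g0) y
  else [::].

Fact aut_pair_funK : cancel aut_pair_fun aut_pair_inv.
Proof. by case=> //= t y; rewrite permK aut_funK. Qed.

Fact aut_pair_invK : cancel aut_pair_inv aut_pair_fun.
Proof. by case=> //= t y; rewrite permKV aut_invK. Qed.

Fact aut_pair_size u : size (aut_pair_fun u) = size u.
Proof. by case: u => //= t y; rewrite aut_size. Qed.

Fact aut_pair_prefix u v :
  prefix u v -> prefix (aut_pair_fun u) (aut_pair_fun v).
Proof.
case: u v => [|s x] [|t y] //= /andP[/eqP <- xy].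
by rewrite eqxx aut_prefix.
Qed.

(* (g0, g1) tau, i.e. (t y) . g = tau(t) (y . g_t) *)
Definition aut_pair : treeAut :=
  TreeAut aut_pair_funK aut_pair_invK aut_pair_size aut_pair_prefix.

End Pair.

Definition omega_seq := nat -> 'I_3.

Definition shift (w : omega_seq) : omega_seq := fun n => w n.+1.

Section Spinal.
Variable u : 'I_3 -> treeAut.

Fixpoint spinal_fun (w : omega_seq) (x : seq bool) : seq bool :=
  match x with
  | [::] => [::]
  | false :: y => false :: u (w 0) y
  | true :: y => true :: spinal_fun (shift w) y
  end.

Fixpoint spinal_inv (w : omega_seq) (x : seq bool) : seq bool :=
  match x with
  | [::] => [::]
  | false :: y => false :: aut_inv (u (w 0)) y
  | true :: y => true :: spinal_inv (shift w) y
  end.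

Fact spinal_funK w : cancel (spinal_fun w) (spinal_inv w).
Proof. by move=> x; elim: x w => [|[] x IH] w //=; rewrite ?IH ?aut_funK. Qed.

Fact spinal_invK w : cancel (spinal_inv w) (spinal_fun w).
Proof. by move=> x; elim: x w => [|[] x IH] w //=; rewrite ?IH ?aut_invK. Qed.

Fact spinal_size w x : size (spinal_fun w x) = size x.
Proof. by elim: x w => [|[] x IH] w //=; rewrite ?IH ?aut_size. Qed.

Fact spinal_prefix w x y :
  prefix x y -> prefix (spinal_fun w x) (spinal_fun w y).
Proof.
elim: x y w => [|s x IH] y w; first by move=> _; exact: prefix0s.
case: y => [|t y] //= /andP[/eqP <- xy].
by case: s => /=; rewrite ?eqxx /=; [exact: IH | exact: aut_prefix].
Qed.

Definition spinal (w : omega_seq) : treeAut :=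
  TreeAut (spinal_funK w) (spinal_invK w) (spinal_size w) (@spinal_prefix w).

(* [spinal] is the solution of the recursion g_w = (u(w_0), g_(shift w)). *)
Lemma spinalE w : spinal w = aut_pair (u (w 0)) (spinal (shift w)) 1.
Proof. by apply: treeAut_eq => -[|[] x] //=; rewrite perm1. Qed.

End Spinal.

Definition aut_a : treeAut := aut_pair 1 1 (tperm false true).

Definition u_b (i : 'I_3) : treeAut := if (i == 2 :> nat)%N then 1 else aut_a.
Definition u_c (i : 'I_3) : treeAut := if (i == 1 :> nat)%N then 1 else aut_a.
Definition u_d (i : 'I_3) : treeAut := if (i == 0 :> nat)%N then 1 else aut_a.

Definition aut_b : omega_seq -> treeAut := spinal u_b.
Definition aut_c : omega_seq -> treeAut := spinal u_c.
Definition aut_d : omega_seq -> treeAut := spinal u_d.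

Definition G_gens (w : omega_seq) : set treeAut :=
  [set aut_a; aut_b w; aut_c w; aut_d w].

Definition G_omega (w : omega_seq) : groupType := subgroup_type (G_gens w).

Record rightAction (gT : groupType) (X : Type) := RightAction {
  ract :> X -> gT -> X;
  ract1 : forall x, ract x 1 = x;
  ractM : forall x g h, ract x (g * h) = ract (ract x g) h }.

Definition boundary := nat -> bool.

(* The n-th letter of x . g is that of the image under g of any prefix of x of
   length greater than n. *)
Definition boundary_act (x : boundary) (g : treeAut) : boundary :=
  fun n => nth false (g (mkseq x n.+1)) n.

Lemma mkseq_boundary_act x (g : treeAut) n :
  mkseq (boundary_act x g) n = g (mkseq x n).
Proof.
apply: (@eq_from_nth _ false); first by rewrite aut_size !size_mkseq.
move=> i; rewrite size_mkseq => lt_in; rewrite nth_mkseq // /boundary_act.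
have pre : prefix (mkseq x i.+1) (mkseq x n).
  rewrite prefixE size_mkseq -map_take take_iota.
  by rewrite (minn_idPl lt_in).
have := aut_prefix g pre; rewrite prefixE aut_size size_mkseq => /eqP <-.
by rewrite nth_take.
Qed.

Fact boundary_act1 x : boundary_act x 1 = x.
Proof. by apply: funext => n; rewrite /boundary_act nth_mkseq. Qed.

Fact boundary_actM x g h :
  boundary_act x (g * h) = boundary_act (boundary_act x g) h.
Proof.
by apply: funext => n; rewrite /boundary_act [in RHS]mkseq_boundary_act.
Qed.

Definition rho : boundary := fun=> true.

Definition X_omega (w : omega_seq) : set boundary :=
  [set x | exists g : G_omega w, x = boundary_act rho (val g)].

Section Orbit.
Variable w : omega_seq.

Fact orbit_act_subproof (x : X_omega w) (g : G_omega w) :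
  boundary_act (val x) (val g) \in X_omega w.
Proof.
case: x => x /= /set_mem[h ->]; apply/mem_set; exists (h * g).
by rewrite -boundary_actM.
Qed.

Definition orbit_act_fun (x : X_omega w) (g : G_omega w) : X_omega w :=
  SigSub (orbit_act_subproof x g).

Fact orbit_act1 x : orbit_act_fun x 1 = x.
Proof. by apply: val_inj; exact: boundary_act1. Qed.

Fact orbit_actM x g h :
  orbit_act_fun x (g * h) = orbit_act_fun (orbit_act_fun x g) h.
Proof. by apply: val_inj; exact: boundary_actM. Qed.

Definition orbit_act : rightAction (G_omega w) (X_omega w) :=
  RightAction orbit_act1 orbit_actM.

Fact rho_in_orbit : rho \in X_omega w.
Proof. by apply/mem_set; exists 1; rewrite boundary_act1. Qed.

Definition rhoX : X_omega w := SigSub rho_in_orbit.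

End Orbit.

Section Wreath.
Variables (F gT : groupType) (X : Type).

(* The pair (phi, g) stands for the element phi g. *)
Record wreath_elt := Wreath {
  wr_fun : X -> F;
  wr_grp : gT;
  wr_finite : finite_set [set x | wr_fun x != 1] }.

HB.instance Definition _ := gen_eqMixin wreath_elt.
HB.instance Definition _ := gen_choiceMixin wreath_elt.

Lemma wreath_eq (p q : wreath_elt) :
  wr_fun p =1 wr_fun q -> wr_grp p = wr_grp q -> p = q.
Proof.
case: p q => [f g Hf] [k h Hk] /= /funext fk gh; subst k h.
by congr Wreath; exact: Prop_irrelevance.
Qed.

Variable act : rightAction gT X.

(* The group law depends on the action, hence so does the type carrying it. *)
Definition wreath of rightAction gT X : Type := wreath_elt.
Local Notation W := (wreath act).

HB.instance Definition _ := Choice.on W.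

Lemma finite_support_act (f : X -> F) (g : gT) :
  finite_set [set x | f x != 1] -> finite_set [set x | f (act x g) != 1].
Proof.
move=> ff; apply: (@sub_finite_set _ _
  ((fun x => act x g^-1) @` [set x | f x != 1])); last exact: finite_image.
by move=> x /= fx; exists (act x g) => //; rewrite -ractM mulgV ract1.
Qed.

Fact wr_one_finite : finite_set [set x : X | (1 : F) != 1].
Proof.
by rewrite (_ : [set _ | _] = set0) //; apply/seteqP; split=> x //=; rewrite eqxx.
Qed.

Definition wr_one : W :=
  {| wr_fun := fun=> 1; wr_grp := 1; wr_finite := wr_one_finite |}.

Fact wr_mul_finite (p q : W) :
  finite_set [set x | wr_fun p x * wr_fun q (act x (wr_grp p)) != 1].
Proof.
apply: (@sub_finite_set _ _ ([set x | wr_fun p x != 1] `|`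
  [set x | wr_fun q (act x (wr_grp p)) != 1])); last first.
  rewrite finite_setU; split; first exact: wr_finite.
  by apply: finite_support_act; exact: wr_finite.
move=> x /=; case: (eqVneq (wr_fun p x) 1) => [-> |]; last by left.
by rewrite mul1g; right.
Qed.

(* (phi1 g1) (phi2 g2) = (phi1 (g1 . phi2)) (g1 g2), (g . phi)(x) = phi(x g) *)
Definition wr_mul (p q : W) : W :=
  {| wr_fun := fun x => wr_fun p x * wr_fun q (act x (wr_grp p));
     wr_grp := wr_grp p * wr_grp q;
     wr_finite := wr_mul_finite p q |}.

Fact wr_inv_finite (p : W) :
  finite_set [set x | (wr_fun p (act x (wr_grp p)^-1))^-1 != 1].
Proof.
under eq_set => x do rewrite invg_eq1.
by apply: finite_support_act; exact: wr_finite.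
Qed.

Definition wr_inv (p : W) : W :=
  {| wr_fun := fun x => (wr_fun p (act x (wr_grp p)^-1))^-1;
     wr_grp := (wr_grp p)^-1;
     wr_finite := wr_inv_finite p |}.

Fact wr_mulA : associative wr_mul.
Proof.
by move=> p q s; apply: wreath_eq => [x|] /=; rewrite ?ractM mulgA.
Qed.

Fact wr_mul1g : left_id wr_one wr_mul.
Proof. by move=> p; apply: wreath_eq => [x|] /=; rewrite ?ract1 mul1g. Qed.

Fact wr_mulg1 : right_id wr_one wr_mul.
Proof. by move=> p; apply: wreath_eq => [x|] /=; rewrite mulg1. Qed.

Fact wr_mulVg : left_inverse wr_one wr_inv wr_mul.
Proof. by move=> p; apply: wreath_eq => [x|] /=; rewrite mulVg. Qed.

Fact wr_mulgV : right_inverse wr_one wr_inv wr_mul.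
Proof.
by move=> p; apply: wreath_eq => [x|] /=; rewrite -?ractM ?mulgV ?ract1 ?mulgV.
Qed.

HB.instance Definition _ := isGroup.Build W
  wr_mulA wr_mul1g wr_mulg1 wr_mulVg wr_mulgV.

End Wreath.

Section Gamma.
Variables (F : groupType) (w : omega_seq).

Fact mem_a : aut_a \in subgroup_gen (G_gens w).
Proof. by apply: mem_subgroup_gen; do 3!left. Qed.
Fact mem_b : aut_b w \in subgroup_gen (G_gens w).
Proof. by apply: mem_subgroup_gen; do 2!left; right. Qed.
Fact mem_c : aut_c w \in subgroup_gen (G_gens w).
Proof. by apply: mem_subgroup_gen; left; right. Qed.
Fact mem_d : aut_d w \in subgroup_gen (G_gens w).
Proof. by apply: mem_subgroup_gen; right. Qed.

Definition G_a : G_omega w := SigSub mem_a.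
Definition G_b : G_omega w := SigSub mem_b.
Definition G_c : G_omega w := SigSub mem_c.
Definition G_d : G_omega w := SigSub mem_d.

Definition Gamma : groupType := wreath F (orbit_act w).

Definition lamp_fun (f : F) (x : X_omega w) : F := if x == rhoX w then f else 1.

Fact lamp_finite (f : F) : finite_set [set x | lamp_fun f x != 1].
Proof.
apply: (@sub_finite_set _ _ [set rhoX w]); last exact: finite_set1.
by move=> x; rewrite /= /lamp_fun; case: (eqVneq x) => // _; rewrite eqxx.
Qed.

(* the element phi_f g; in particular [lamp 1 g] is g itself *)
Definition lamp (f : F) (g : G_omega w) : Gamma :=
  {| wr_fun := lamp_fun f; wr_grp := g; wr_finite := lamp_finite f |}.

Definition Gamma_gens : set Gamma :=
  [set lamp 1 G_a] `|`
  [set lamp f v | f in [set: F] & v in [set 1; G_b; G_c; G_d]].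

Definition Gamma_growth : nat -> nat := growth Gamma_gens.

End Gamma.

Lemma finite_Gamma_gens (F : finGroupType) (w : omega_seq) :
  finite_set (@Gamma_gens F w).
Proof.
rewrite finite_setU; split; first exact: finite_set1.
apply: finite_image2; first exact: finite_finset.
by rewrite !finite_setU; do !split; exact: finite_set1.
Qed.

Section Antichains.
Variable R : realType.

Definition growth_antichain (F : groupType) (Omega : set omega_seq) : Prop :=
  forall w w', Omega w -> Omega w' -> w <> w' ->
    ~ growth_comparable (Gamma_growth F w) (Gamma_growth F w').

Definition antichain_with_exponents (F : groupType) (alpha beta : R)
    (Omega : set omega_seq) : Prop :=
  [/\ ~ countable Omega,
      growth_antichain F Omega &
      forall w, Omega w ->
        lower_exponent R (Gamma_growth F w) = alpha%:E /\
        upper_exponent R (Gamma_growth F w) = beta%:E].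

End Antichains.

(* Main.v *)
Require Import Defs.
From HB Require Import structures.
From mathcomp Require Import all_boot all_order all_algebra fingroup perm finmap.
From mathcomp Require Import boolp classical_sets functions cardinality.
From mathcomp Require Import reals ereal topology normedtype sequences exp.
From mathcomp Require Import zify ring lra.

Set Implicit Arguments.
Unset Strict Implicit.
Unset Printing Implicit Defensive.

Import Order.TTheory GRing.Theory Num.Theory.
Local Open Scope group_scope.

(**
Give the letters b, c, d the integer weights V_0 = (1, 1, 1), and obtain V_{k+1}
from V_k by doubling every weight except that of the letter whose first section
is trivial at omega_k, which becomes V_k(b) + V_k(c) + V_k(d). Let S_k be the sum
of the three weights. If the three weights stay comparable, the growth at radius
S_k is exp(2^k), up to corrections that do not change log log.

Upper bound. Since the weights satisfy the triangle inequality, a word of weight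
p has first-level sections of total weight at most p plus an error proportional
to the number of a's. A word of length S_k is thus encoded by its sections at
level k and the permutations above it, with O(2^k) letters in all.

Lower bound. As F may be trivial, lamps are not available and G_omega itself has
to be large. A substitution on words yields elements, of length O(S_j), that flip
the digit j + 1 of every boundary point and no earlier one; products of those move
vertices almost uniformly. Insert at chosen times of such a random product either
1 or b. Reading the section of the tails of the product at a vertex 1^n recovers
every choice, except where the trajectory of the vertex meets an exceptional
vertex, which is rare in expectation. Markov's inequality then gives
2^(2^(r L - 1)) elements within radius 5 L 2^r S_{(L + 7) r}.

Choice of omega. A block 012 multiplies the weights asymptotically by (2/eta)^3
and a letter 2 by 2, so a greedy concatenation of them makes log S_k follow any
function with increments in [log 2, log(2/eta)]; and alpha_0 is precisely the
exponent log 2 / log(2/eta). Let the increments be log 2/alpha or log 2/beta on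
the window [2^2^i, 2^2^(i+1)) according to whether i lies in A. The windows grow so
fast that both exponents are attained when A and its complement are infinite, and
that the growth functions of A and A' are non comparable when both differences
are infinite; the sets of codes of the prefixes of binary sequences are such.
*)

(** * Spinal generators and a letter substitution *)

(* The letter [i] is the one whose first section is trivial when [w 0 = i]:
   the letters 0, 1, 2 stand for d, c, b. *)
Definition letter_u (i j : 'I_3) : treeAut :=
  if (j == i :> nat)%N then 1 else aut_a.
Definition gen (i : 'I_3) (w : omega_seq) : treeAut := spinal (letter_u i) w.
Arguments gen : simpl never.
Arguments letter_u : simpl never.

Definition digit0 : 'I_3 := @Ordinal 3 0 isT.
Definition digit1 : 'I_3 := @Ordinal 3 1 isT.
Definition digit2 : 'I_3 := @Ordinal 3 2 isT.


Definition other1 (i : 'I_3) : 'I_3 :=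
  match val i with 0 => digit1 | 1 => digit2 | _ => digit0 end.
Definition other2 (i : 'I_3) : 'I_3 :=
  match val i with 0 => digit2 | 1 => digit0 | _ => digit1 end.

Lemma digitP (i : 'I_3) : [\/ i = digit0, i = digit1 | i = digit2].
Proof.
case: i => [[|[|[|//]]]] p;
  [apply: Or31|apply: Or32|apply: Or33]; exact: val_inj.
Qed.

Definition node (k : bool) (g0 g1 : treeAut) : treeAut :=
  aut_pair g0 g1 (if k then tperm false true else 1).

Lemma node_cons k g0 g1 t y :
  node k g0 g1 (t :: y) = (k (+) t) :: (if t then g1 else g0) y.
Proof. by case: k t => -[] /=; rewrite ?perm1 ?tpermL ?tpermR. Qed.

Lemma node_mul k g0 g1 k' h0 h1 :
  node k g0 g1 * node k' h0 h1 =
  node (k (+) k') (if k then g0 * h1 else g0 * h0)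
                (if k then g1 * h0 else g1 * h1).
Proof.
apply: treeAut_eq => -[|t y] //.
change ((node k' h0 h1) ((node k g0 g1) (t :: y)) = (node (k (+) k')
  (if k then g0 * h1 else g0 * h0) (if k then g1 * h0 else g1 * h1)) (t :: y)).
by rewrite !node_cons; case: k k' t => -[] [].
Qed.

Lemma node1 : node false 1 1 = 1.
Proof. by apply: treeAut_eq => -[|t y] //; rewrite node_cons; case: t. Qed.

Lemma aut_aE : aut_a = node true 1 1. Proof. by []. Qed.

Lemma genE i w : gen i w = node false (letter_u i (w 0)) (gen i (Defs.shift w)).
Proof. exact: spinalE. Qed.

Lemma letter_uE i j : letter_u i j = if i == j then 1 else aut_a.
Proof. by rewrite /letter_u eq_sym -val_eqE. Qed.

Lemma aut_aK : aut_a * aut_a = 1.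
Proof. by rewrite aut_aE node_mul /= !mulg1 node1. Qed.

Lemma aut_aKl g : aut_a * (aut_a * g) = g.
Proof. by rewrite mulgA aut_aK mul1g. Qed.

Lemma aut_aKr g : g * aut_a * aut_a = g.
Proof. by rewrite -mulgA aut_aK mulg1. Qed.

Lemma letter_uK i j : letter_u i j * letter_u i j = 1.
Proof. by rewrite letter_uE; case: eqP => _; rewrite ?aut_aK ?mul1g. Qed.

Lemma gen_true i w y : gen i w (true :: y) = true :: gen i (Defs.shift w) y.
Proof. by []. Qed.

Lemma gen_false i w y : gen i w (false :: y) = false :: letter_u i (w 0) y.
Proof. by []. Qed.

Lemma genK i w : gen i w * gen i w = 1.
Proof.
apply: treeAut_eq => y; change (gen i w (gen i w y) = y).
elim: y w => [|[] y IH] w //; first by rewrite !gen_true IH.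
rewrite !gen_false; congr cons.
exact: (congr1 (fun g : treeAut => g y) (letter_uK i (w 0))).
Qed.

(** At every level exactly one of the three letters has first section 1 and the other two have [a],
    so the Klein four-group relations hold level by level. *)
Lemma gen_mul i j k w : i != j -> j != k -> i != k ->
  gen i w * gen j w = gen k w.
Proof.
move=> ij jk ik; apply: treeAut_eq => y.
change (gen j w (gen i w y) = gen k w y).
elim: y w => [|[] y IH] w //; first by rewrite !gen_true IH.
rewrite !gen_false; congr cons.
have e : letter_u i (w 0) * letter_u j (w 0) = letter_u k (w 0).
  rewrite !letter_uE.
  by case: (digitP i) ij ik => ->; case: (digitP j) jk => -> //; case: (digitP k) => -> //;
     case: (digitP (w 0)) => ->; rewrite /= ?aut_aK ?mulg1 ?mul1g.
exact: (congr1 (fun g : treeAut => g y) e).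
Qed.

Lemma gen_others i w : gen (other1 i) w * gen (other2 i) w = gen i w.
Proof. by apply: gen_mul; case: (digitP i) => ->. Qed.

(** Doubling [x] leaves in each section the shifted generator and one [a]. As [i] has trivial first
    section, it needs a triple: one section is the shifted [i], got as the product of the other two
    letters, and the other its conjugate by [a]. *)
Definition zeta (i : 'I_3) (s : seq 'I_3) : seq 'I_3 :=
  flatten [seq if x == i then [:: other1 i; i; other2 i] else [:: x; x] | x <- s].

Definition eval_word (w : omega_seq) (s : seq 'I_3) : treeAut :=
  \prod_(x <- s) (gen x w * aut_a).

Lemma eval_cons w x s : eval_word w (x :: s) = gen x w * aut_a * eval_word w s.
Proof. by rewrite /eval_word big_cons. Qed.

Lemma eval_nil w : eval_word w [::] = 1.
Proof. by rewrite /eval_word big_nil. Qed.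

Lemma eval_cat w s t : eval_word w (s ++ t) = eval_word w s * eval_word w t.
Proof. by rewrite /eval_word big_cat. Qed.

Lemma zeta_cat i s t : zeta i (s ++ t) = zeta i s ++ zeta i t.
Proof. by rewrite /zeta map_cat flatten_cat. Qed.

Lemma eval_zeta1 w x : eval_word w (zeta (w 0) [:: x]) =
  let h := gen x (Defs.shift w) in
  if x == w 0 then node true (aut_a * h * aut_a) h
  else node false (aut_a * h) (h * aut_a).
Proof.
rewrite /zeta /=; case: eqP => [->|/eqP ne].
  rewrite !eval_cons eval_nil mulg1 !(genE _ w) aut_aE !node_mul /= !letter_uE eqxx.
  have -> : (other1 (w 0) == w 0) = false by case: (digitP (w 0)) => ->.
  have -> : (other2 (w 0) == w 0) = false by case: (digitP (w 0)) => ->.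
  by rewrite -!aut_aE !mulg1 !mul1g !mulgA gen_others.
rewrite !eval_cons eval_nil mulg1 !(genE _ w) aut_aE !node_mul /= !letter_uE (negbTE ne) -!aut_aE.
by rewrite !mulg1.
Qed.

(* Both first-level sections of [eval_word w (zeta (w 0) s)] are [eval_word (Defs.shift w) s],
   up to multiplications by [a]. *)
Lemma eval_zeta w s : let Y := eval_word (Defs.shift w) s in
  let k := odd (count_mem (w 0) s) in
  eval_word w (zeta (w 0) s) =
    node k (aut_a * Y * (if k then 1 else aut_a)) (Y * (if k then aut_a else 1)).
Proof.
move=> Y k; rewrite {}/Y {}/k; elim/last_ind: s => [|s x IH].
  by rewrite /zeta /= !eval_nil /= !mulg1 aut_aK node1.
rewrite -cats1 zeta_cat eval_cat IH eval_zeta1 eval_cat count_cat /= addn0 oddD.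
rewrite eval_cons eval_nil mulg1 oddb.
set Y := eval_word _ s; set h := gen _ _.
by case: (x == w 0); case: (odd _) => /=;
  rewrite node_mul /= !mulg1 !mulgA ?aut_aKr.
Qed.

(** The letter c ([digit1]) is preferred because it has no exceptional vertices at a level [l] with
    [w l = digit1] ([bad_cover_c]); b is used only where c is the special letter. *)
Definition nonspecial (i : 'I_3) : 'I_3 := if i == digit1 then digit2 else digit1.

Lemma nonspecial_neq i : (nonspecial i == i) = false.
Proof. by case: (digitP i) => ->. Qed.

Fixpoint flip_word (j : nat) (w : omega_seq) : seq 'I_3 :=
  if j is j'.+1 then zeta (w 0) (flip_word j' (Defs.shift w))
  else [:: nonspecial (w 0); nonspecial (w 0)].

Lemma count_zeta i s y : count_mem y (zeta i s) =
  if y == i then count_mem i s else ((count_mem y s).*2 + count_mem i s)%N.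
Proof.
elim: s => [|x s IH]; first by case: ifP.
have -> : zeta i (x :: s) =
  (if x == i then [:: other1 i; i; other2 i] else [:: x; x]) ++ zeta i s by [].
rewrite count_cat IH {IH}.
by case: (digitP x) => ->; case: (digitP i) => ->; case: (digitP y) => -> /=; lia.
Qed.

(** Evenness makes the bit [k] of [eval_zeta] false at every level, so the lifted element fixes the
    first digit. *)
Lemma zeta_even i s : (forall y, ~~ odd (count_mem y s)) ->
  forall y, ~~ odd (count_mem y (zeta i s)).
Proof.
move=> s_even y; rewrite count_zeta.
by case: ifP => _; rewrite ?oddD ?odd_double ?(negbTE (s_even _)).
Qed.

Lemma flip_word_even j w : forall y, ~~ odd (count_mem y (flip_word j w)).
Proof.
elim: j w => [|j IH] w y; first by rewrite /=; case: eqP.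
exact: zeta_even.
Qed.

Definition flip_elt (j : nat) (w : omega_seq) : treeAut := eval_word w (flip_word j w).

Lemma flip_eltS j w : flip_elt j.+1 w =
  node false (aut_a * flip_elt j (Defs.shift w) * aut_a) (flip_elt j (Defs.shift w)).
Proof. by rewrite /flip_elt /= eval_zeta (negbTE (flip_word_even _ _ _)) mulg1. Qed.

(** The left section in [flip_eltS] is a conjugate by [a], so the induction follows a class closed
    under this conjugation rather than [flip_elt] itself. *)
Fixpoint flip_shape (j : nat) (w : omega_seq) (g : treeAut) : Prop :=
  if j is j'.+1 then exists g0 g1,
    [/\ g = node false g0 g1, flip_shape j' (Defs.shift w) g0 & flip_shape j' (Defs.shift w) g1]
  else let n := gen (nonspecial (w 0)) w in
    g = n * aut_a * (n * aut_a) \/ g = aut_a * n * (aut_a * n).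

Lemma conj_a k g0 g1 : aut_a * node k g0 g1 * aut_a = node k g1 g0.
Proof. by rewrite aut_aE !node_mul; case: k; rewrite /= !mul1g !mulg1. Qed.

Lemma flip_shape_conj j w g : flip_shape j w g -> flip_shape j w (aut_a * g * aut_a).
Proof.
case: j w g => [|j] w g /=.
  by move=> [->|->]; [right|left]; rewrite -!mulgA ?aut_aK ?aut_aKl ?mulg1.
move=> [g0 [g1 [-> h0 h1]]]; exists g1, g0; split=> //; exact: conj_a.
Qed.

Lemma flip_elt_shape j w : flip_shape j w (flip_elt j w).
Proof.
elim: j w => [|j IH] w.
  by left; rewrite /flip_elt /= !eval_cons eval_nil mulg1.
rewrite flip_eltS; exists (aut_a * flip_elt j (Defs.shift w) * aut_a), (flip_elt j (Defs.shift w)).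
by split=> //; exact: flip_shape_conj.
Qed.

Lemma flip_shapeP j w g y : flip_shape j w g -> (j.+1 < size y)%N ->
  take j.+1 (g y) = take j.+1 y /\ nth false (g y) j.+1 = ~~ nth false y j.+1.
Proof.
elim: j w g y => [|j IH] w g [|t y] //=.
  case: y => [|t' y] //= + _.
  rewrite genE letter_uE nonspecial_neq -[Defs.shift w]/(Defs.shift w) genE.
  set h := gen _ _; set u := letter_u _ _.
  rewrite aut_aE !node_mul /= !mulg1 !mul1g.
  by case=> ->; rewrite node_cons /=; case: t => /=;
    rewrite ?(tpermL, tpermR, perm1); case: t'; rewrite /= ?(tpermL, tpermR, perm1).
move=> [g0 [g1 [-> h0 h1]]]; rewrite ltnS => lt; rewrite node_cons /=.
by case: t; [have [-> ->] := IH _ _ _ h1 lt | have [-> ->] := IH _ _ _ h0 lt].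
Qed.

Lemma a_flip t y : aut_a (t :: y) = ~~ t :: y.
Proof. by rewrite aut_aE node_cons; case: t. Qed.

(** * Exceptional vertices of the flipping elements *)

Definition section_of (g : treeAut) (v : seq bool) (h : treeAut) : Prop :=
  forall y, g (v ++ y) = g v ++ h y.

Lemma aut_mulE (g h : treeAut) y : (g * h) y = h (g y). Proof. by []. Qed.

Lemma section_of1 v : section_of 1 v 1. Proof. by []. Qed.

Lemma section_ofM g h v g' h' :
  section_of g v g' -> section_of h (g v) h' -> section_of (g * h) v (g' * h').
Proof. by move=> sg sh y; rewrite !aut_mulE sg sh. Qed.

Lemma section_of_inj g v h h' : section_of g v h -> section_of g v h' -> h = h'.
Proof.
move=> s s'; apply: treeAut_eq => y; have := s y; rewrite s'.
by move/eqP; rewrite eqseq_cat // eqxx => /eqP.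
Qed.

Lemma section_of_node k g0 g1 t v h : section_of (if t then g1 else g0) v h ->
  section_of (node k g0 g1) (t :: v) h.
Proof. by move=> s y; rewrite cat_cons !node_cons s. Qed.

Lemma aut_take (g : treeAut) n y : take n (g y) = g (take n y).
Proof.
have pre : prefix (take n y) y by exact: prefix_take.
have := aut_prefix g pre; rewrite prefixE aut_size size_take_min => /eqP <-.
case: (leqP n (size y)) => // le.
by rewrite !take_oversize ?aut_size // ltnW.
Qed.

(** {1, c} is a subgroup, hence stable along products, and it does not contain b as long as [digit1]
    still occurs in the tail of [w]: a section outside it reveals a b. *)
Definition c_section (l : nat) (w : omega_seq) (g : treeAut) (v : seq bool) :=
  exists2 h, h = 1 \/ h = gen digit1 (iter l.+1 Defs.shift w) & section_of g v h.

(** The exceptional vertices lie on level [l.+1] but are recorded by their prefixes of length [p],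
    the level over which random products spread a vertex. *)
Definition bad_cover l w p g (bl : seq (seq bool)) :=
  forall v, size v = l.+1 -> take p v \notin bl -> c_section l w g v.

Lemma c_section1 l w v : c_section l w 1 v.
Proof. by exists 1; [left | exact: section_of1]. Qed.

Lemma c_sectionM l w g h v :
  c_section l w g v -> c_section l w h (g v) -> c_section l w (g * h) v.
Proof.
move=> [g' g'P sg] [h' h'P sh]; exists (g' * h'); last exact: section_ofM.
by case: g'P h'P => -> [->|->]; rewrite ?mulg1 ?mul1g ?genK; [left|right|right|left].
Qed.

Lemma bad_coverM l w p g h bl bl' : bad_cover l w p g bl ->
  bad_cover l w p h bl' -> bad_cover l w p (g * h) (bl ++ map (aut_inv g) bl').
Proof.
move=> bg bh v sv; rewrite mem_cat negb_or => /andP[nl nl'].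
apply: c_sectionM; first exact: bg.
apply: bh; first by rewrite aut_size.
apply: contra nl'; rewrite aut_take => vl.
by apply/mapP; exists (g (take p v)); rewrite ?aut_funK.
Qed.

Lemma bad_cover_a l w p : bad_cover l w p aut_a [::].
Proof.
move=> [|t v] // _ _; exists 1; first by left.
by rewrite aut_aE; apply: section_of_node; case: t.
Qed.

Lemma c_section_node l w k g0 g1 t v :
  c_section l (Defs.shift w) (if t then g1 else g0) v ->
  c_section l.+1 w (node k g0 g1) (t :: v).
Proof.
move=> [h hP s]; exists h; last exact: section_of_node.
by rewrite iterSr.
Qed.

Lemma bad_cover_node l w p k g0 g1 bl0 bl1 :
  bad_cover l (Defs.shift w) p g0 bl0 -> bad_cover l (Defs.shift w) p g1 bl1 ->
  bad_cover l.+1 w p.+1 (node k g0 g1) (map (cons false) bl0 ++ map (cons true) bl1).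
Proof.
move=> b0 b1 [|t v] //= [sv]; rewrite mem_cat negb_or => /andP[n0 other1].
apply: c_section_node; case: t n0 other1 => /= n0 other1; [apply: b1 => //|apply: b0 => //].
  by apply: contra other1 => vb; exact: map_f.
by apply: contra n0 => vb; exact: map_f.
Qed.

Lemma bad_cover0 l w p q g : bad_cover l w p g [::] -> bad_cover l w q g [::].
Proof. by move=> b v sv _; apply: b. Qed.

(** A vertex that leaves the ray 1^p does so at one of its first [p <= l] letters, so at least one
    letter remains below the section [a], whose own first-level sections are trivial. *)
Lemma bad_cover_gen l w i p : (p <= l)%N ->
  bad_cover l w p (gen i w) [:: nseq p true].
Proof.
elim: l w p => [|l IH] w p.
  by rewrite leqn0 => /eqP -> v _; rewrite take0.
move=> lp [|t v] //= [sv]; rewrite inE => ne; rewrite genE; apply: c_section_node.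
case: t ne => ne; last first.
  rewrite letter_uE; case: eqP => _; first exact: c_section1.
  exact: (@bad_cover_a _ _ 0).
case: p lp ne => [|p] lp ne; first by rewrite take0 in ne.
apply: (IH _ p) => //; rewrite inE; apply: contra ne.
by rewrite /= eqseq_cons.
Qed.

(** Only the two extensions of 1^l could be exceptional: 1^(l+1) has section c, and the other has
    the first section of c at [w l], which is trivial. *)
Lemma bad_cover_c l w p : w l = digit1 -> bad_cover l w p (gen digit1 w) [::].
Proof.
elim: l w p => [|l IH] w p wl [|t v] //= [sv] _.
  case: v sv => // _; exists (if t then gen digit1 (Defs.shift w) else 1).
    by case: t; [right|left].
  rewrite genE letter_uE wl eqxx; apply: section_of_node.
  by case: t.
rewrite genE; apply: c_section_node; case: t.
  by apply: (IH _ 0).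
rewrite letter_uE; case: eqP => _; first exact: c_section1.
exact: (@bad_cover_a _ _ 0).
Qed.

(** Each of the [2 ^ j] leaves contains its letter twice. This letter is c, without exceptional
    vertices, unless [w j = digit1]; then it is b, with one exceptional prefix per occurrence. *)
Lemma flip_shape_bad j w g l p : flip_shape j w g -> w l = digit1 -> (j <= p <= l)%N ->
  exists2 bl, bad_cover l w p g bl & (size bl <= if w j == digit1 then 2 ^ j.+1 else 0)%N.
Proof.
elim: j w g l p => [|j IH] w g l p /=.
  move=> + wl pl; rewrite /nonspecial.
  case: (w 0 == digit1) => gE.
    have ba := bad_cover_a; have bn := @bad_cover_gen l w digit2 p pl.
    case: gE => ->; eexists.
    - exact: (bad_coverM (bad_coverM bn (ba _ _ _)) (bad_coverM bn (ba _ _ _))).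
    - by rewrite !(size_cat, size_map).
    - exact: (bad_coverM (bad_coverM (ba _ _ _) bn) (bad_coverM (ba _ _ _) bn)).
    - by rewrite !(size_cat, size_map).
  have ba := bad_cover_a; have bn := @bad_cover_c l w p wl.
  case: gE => ->; eexists.
  - exact: (bad_coverM (bad_coverM bn (ba _ _ _)) (bad_coverM bn (ba _ _ _))).
  - by [].
  - exact: (bad_coverM (bad_coverM (ba _ _ _) bn) (bad_coverM (ba _ _ _) bn)).
  - by [].
move=> [g0 [g1 [-> h0 h1]]]; case: l p => [|l] [|p] //= wl; try by rewrite andbF.
rewrite !ltnS => jp.
have [bl0 b0 s0] := IH _ _ l p h0 wl jp.
have [bl1 b1 s1] := IH _ _ l p h1 wl jp.
exists (map (cons false) bl0 ++ map (cons true) bl1); first exact: bad_cover_node.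
rewrite size_cat !size_map -[Defs.shift w j]/(w j.+1) in s0 s1 *.
by case: ifP s0 s1 => _; rewrite ?expnS; lia.
Qed.

(** * Weights dual to the substitution *)

Definition vstep (i : 'I_3) (V : 'I_3 -> nat) : 'I_3 -> nat :=
  fun x => if x == i then (V digit0 + V digit1 + V digit2)%N else (2 * V x)%N.

Fixpoint vseq (V : 'I_3 -> nat) (w : omega_seq) (k : nat) : 'I_3 -> nat :=
  if k is k'.+1 then vseq (vstep (w 0) V) (Defs.shift w) k' else V.

Lemma vseqS V w k : vseq V w k.+1 = vstep (w k) (vseq V w k).
Proof. by elim: k V w => [|k IH] V w //; rewrite [LHS]IH. Qed.

(** [vstep i] is the transpose of the action of [zeta i] on letter counts, so lengths of iterated
    substitutions are read off [vseq]. *)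
Lemma sum_zeta V i s : (\sum_(x <- zeta i s) V x = \sum_(x <- s) vstep i V x)%N.
Proof.
elim: s => [|x s IH]; first by rewrite /zeta !big_nil.
have -> : zeta i (x :: s) =
  (if x == i then [:: other1 i; i; other2 i] else [:: x; x]) ++ zeta i s by [].
rewrite big_cat IH big_cons {IH}; congr addn.
case: (digitP x) => ->; case: (digitP i) => ->;
  rewrite /vstep /= !big_cons big_nil /other1 /other2 /=; lia.
Qed.

Lemma sum_flip_word V j w : (\sum_(x <- flip_word j w) V x = 2 * vseq V w j (nonspecial (w j)))%N.
Proof.
elim: j V w => [|j IH] V w /=; first by rewrite !big_cons big_nil; lia.
by rewrite sum_zeta IH.
Qed.

Definition unit_weights : 'I_3 -> nat := fun=> 1%N.

Lemma size_flip_word j w : size (flip_word j w) = (2 * vseq unit_weights w j (nonspecial (w j)))%N.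
Proof. by rewrite -sum_flip_word sum1_size. Qed.

Definition word_of w n (g : treeAut) :=
  exists s : seq treeAut, [/\ (size s <= n)%N, forall x, x \in s -> G_gens w x
    & g = \prod_(x <- s) x].

Lemma word_of1 w n : word_of w n 1.
Proof. by exists [::]; split=> //; rewrite big_nil. Qed.

Lemma word_ofM w m n g h : word_of w m g -> word_of w n h ->
  word_of w (m + n) (g * h).
Proof.
move=> [s [ss sG ->]] [t [st tG ->]]; exists (s ++ t); split.
- by rewrite size_cat leq_add.
- by move=> x; rewrite mem_cat => /orP[/sG|/tG].
- by rewrite big_cat.
Qed.

Lemma word_of_leq w m n g : (m <= n)%N -> word_of w m g -> word_of w n g.
Proof. by move=> mn [s [sm ? ?]]; exists s; split=> //; exact: leq_trans mn. Qed.

Lemma word_of_gen w g : G_gens w g -> word_of w 1 g.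
Proof.
move=> gG; exists [:: g]; split=> //; last by rewrite big_seq1.
by move=> x; rewrite inE => /eqP ->.
Qed.

Lemma G_gens_a w : G_gens w aut_a. Proof. by do 3!left. Qed.

Lemma G_gens_gen w i : G_gens w (gen i w).
Proof.
by case: (digitP i) => ->; [right | left; right | left; left; right].
Qed.

Lemma word_of_eval w s : word_of w (2 * size s) (eval_word w s).
Proof.
elim: s => [|x s IH]; first by rewrite eval_nil; exact: word_of1.
rewrite eval_cons /= mulnS; apply: word_ofM IH.
by apply: (@word_ofM _ 1 1); apply: word_of_gen; [exact: G_gens_gen | exact: G_gens_a].
Qed.

Lemma word_of_flip_elt j w : word_of w (4 * vseq unit_weights w j (nonspecial (w j))) (flip_elt j w).
Proof. by have := word_of_eval w (flip_word j w); rewrite size_flip_word mulnA. Qed.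

(** * Expected number of errors in a random product *)

Section Mean.
Variable opt : nat -> seq treeAut.
Hypothesis opt_gt0 : forall k, (0 < size (opt k))%N.
Local Open Scope ring_scope.

Fixpoint mean (ks : seq nat) (f : seq treeAut -> rat) : rat :=
  if ks is k :: ks' then
    (\sum_(g <- opt k) mean ks' (fun gs => f (g :: gs))) / (size (opt k))%:R
  else f [::].

Definition outcome (ks : seq nat) (gs : seq treeAut) :=
  all2 (fun k g => g \in opt k) ks gs.

Let opt_neq0 k : (size (opt k))%:R != 0 :> rat.
Proof. by rewrite pnatr_eq0 -lt0n. Qed.

Lemma mean_le ks f f' : (forall gs, outcome ks gs -> f gs <= f' gs) ->
  mean ks f <= mean ks f'.
Proof.
elim: ks f f' => [|k ks IH] f f' le /=; first exact: le.
rewrite ler_pM2r ?invr_gt0 ?ltr0n //; rewrite big_seq [leRHS]big_seq.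
apply: ler_sum => g gk; apply: IH => gs gsP; apply: le => /=; exact/andP.
Qed.

Lemma eq_mean ks f f' : f =1 f' -> mean ks f = mean ks f'.
Proof. by move=> e; apply/le_anti/andP; split; apply: mean_le => gs _; rewrite e. Qed.

Lemma mean_const ks c : mean ks (fun=> c) = c.
Proof.
elim: ks => //= k ks IH; rewrite big_const_seq count_predT iter_addr_0 IH.
by rewrite -[c *+ _]mulr_natr mulfK.
Qed.

Lemma mean_sum ks I (r : seq I) (F : I -> seq treeAut -> rat) :
  mean ks (fun gs => \sum_(i <- r) F i gs) = \sum_(i <- r) mean ks (F i).
Proof.
elim: ks F => //= k ks IH F.
under eq_bigr => g _ do rewrite IH.
by rewrite exchange_big mulr_suml.
Qed.

Lemma meanD ks f f' : mean ks (fun gs => f gs + f' gs) = mean ks f + mean ks f'.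
Proof.
pose F (b : bool) := if b then f else f'.
have := mean_sum ks [:: true; false] F; rewrite big_cons big_seq1 /= => <-.
by apply: eq_mean => gs; rewrite big_cons big_seq1.
Qed.

Lemma meanZ ks f c : mean ks (fun gs => f gs * c) = mean ks f * c.
Proof.
elim: ks f => //= k ks IH f; under eq_bigr => g _ do rewrite IH.
by rewrite -mulr_suml mulrAC.
Qed.

Lemma mean_cat k1 k2 f :
  mean (k1 ++ k2) f = mean k1 (fun g1 => mean k2 (fun g2 => f (g1 ++ g2))).
Proof. by elim: k1 f => //= k k1 IH f; under eq_bigr => g _ do rewrite IH. Qed.

(** Moves the average over the first choice inside, to be bounded with the later choices held
    fixed. *)
Lemma mean_exchange k ks (f : treeAut -> seq treeAut -> rat) :
  mean (k :: ks) (fun gs => f (head aut_one gs) (behead gs)) =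
  mean ks (fun gs => (\sum_(g <- opt k) f g gs) / (size (opt k))%:R).
Proof. by rewrite /= meanZ mean_sum. Qed.

Lemma outcome_size ks gs : outcome ks gs -> size gs = size ks.
Proof. by rewrite /outcome all2E => /andP[/eqP]. Qed.

(* Positions are vertices of level [l.+1], and [rho] is the vertex [1^(l+1)]. *)
Section Hits.
Variables (w : omega_seq) (l : nat).
Let rho := nseq l.+1 true.

Definition bad_at (g : treeAut) v := ~~ `[< c_section l w g v >].

Fixpoint hit v (gs : seq treeAut) : bool :=
  if gs is g :: gs' then bad_at g v || hit (g v) gs' else false.

Definition prodg (gs : seq treeAut) : treeAut := (\prod_(g <- gs) g)%g.

Lemma prodg_cons g gs : prodg (g :: gs) = (g * prodg gs)%g.
Proof. by rewrite /prodg big_cons. Qed.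

Lemma hit_cat v gs hs : hit v (gs ++ hs) = hit v gs || hit (prodg gs v) hs.
Proof.
elim: gs v => [|g gs IH] v /=; first by rewrite /prodg big_nil.
by rewrite IH orbA prodg_cons.
Qed.

Lemma hitN v gs : ~~ hit v gs -> c_section l w (prodg gs) v.
Proof.
elim: gs v => [|g gs IH] v /=; first by rewrite /prodg big_nil => _; exact: c_section1.
rewrite negb_or negbK => /andP[/asboolP bg ngs]; rewrite prodg_cons.
by apply: c_sectionM => //; exact: IH.
Qed.

(* Kind 0 marks the positions of the lamps to be decoded. *)
Fixpoint nbad (ks : seq nat) (gs : seq treeAut) : nat :=
  match ks, gs with
  | k :: ks', _ :: gs' => ((k == 0%N) && hit rho gs' + nbad ks' gs')%N
  | _, _ => 0%N
  end.

(** The crossing errors: lamps of a first block spoilt in a later one, after the separator at the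
    head of [hs] has randomized their trajectory. *)
Fixpoint ncross (ks : seq nat) (gs hs : seq treeAut) : nat :=
  match ks, gs with
  | k :: ks', _ :: gs' =>
    ((k == 0%N) && hit ((head aut_one hs) (prodg gs' rho)) (behead hs) + ncross ks' gs' hs)%N
  | _, _ => 0%N
  end.

(** A trajectory starting in the first block hits either up to the separator [g] or after it, and
    the latter is what [ncross] counts. *)
Lemma nbad_split ks k ks2 gs g gs2 : size gs = size ks -> k != 0%N ->
  (nbad (ks ++ k :: ks2) (gs ++ g :: gs2) <=
   nbad (ks ++ [:: k]) (gs ++ [:: g]) + nbad ks2 gs2 + ncross ks gs (g :: gs2))%N.
Proof.
move=> + k0; elim: ks gs => [|k' ks IH] [|g' gs] //= => [_|[sz]].
  by rewrite (negbTE k0); lia.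
have := IH _ sz; case: (k' == 0%N) => //=; rewrite ?add0n //.
rewrite !hit_cat /= orbF; case: (hit rho gs); case: (bad_at g _) => //=; lia.
Qed.

Section Kinds.
(** A kind [k > 0] is a separator. It sends a vertex of level [m k] to pairwise different images, so
    a prescribed image has probability at most [1 / size (opt k)]; [B k'] bounds the exceptional
    prefixes of an element of kind [k']. *)
Variables (m B : nat -> nat) (K : nat).
Hypothesis m_le : forall k, (k <= K)%N -> (m k <= l.+1)%N.
Hypothesis opt_count : forall k y u, (0 < k)%N -> size y = m k ->
  (count (fun g : treeAut => g y == u) (opt k) <= 1)%N.
Hypothesis opt_cover : forall k k' g, (0 < k <= K)%N -> (k' <= k.+1)%N ->
  g \in opt k' -> exists2 bl, bad_cover l w (m k) g bl & (size bl <= B k')%N.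

(** Union bound: each exceptional prefix met along [gs] is reached for at most one choice of [g].
    For the induction, [h] accumulates the part of the product already applied. *)
Lemma count_hit k ks gs (h : treeAut) v : (0 < k <= K)%N -> size v = l.+1 ->
  all (leq^~ k.+1) ks -> outcome ks gs ->
  (\sum_(g <- opt k) (hit (h (g v)) gs : nat) <= \sum_(k' <- ks) B k')%N.
Proof.
move=> k0K sv; have /andP[k0 kK] := k0K; elim: ks gs h => [|k' ks IH] [|s gs] h //=.
  by move=> _ _; rewrite big1.
move=> /andP[lek ks_le] /andP[sk gsP]; rewrite big_cons.
have {}IH := IH gs (h * s)%g ks_le gsP.
apply: (@leq_trans (\sum_(g <- opt k) (bad_at s (h (g v)) : nat) +
   \sum_(g <- opt k) (hit ((h * s)%g (g v)) gs : nat))%N).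
  by rewrite -big_split /=; apply: leq_sum => g _; case: (bad_at s _); case: (hit _ gs).
apply: leq_add => //.
have [bl blP sbl] := opt_cover k0K lek sk; apply: leq_trans sbl.
have smk : size (take (m k) v) = m k by rewrite size_takel // sv m_le.
apply: (@leq_trans (\sum_(u <- bl) \sum_(g <- opt k) (g (take (m k) v) == aut_inv h u : nat))%N).
  rewrite exchange_big /=; apply: leq_sum => g _.
  case: (boolP (bad_at s (h (g v)))) => // bs.
  have : take (m k) (h (g v)) \in bl.
    apply: contraNT bs => nb; apply/asboolP; apply: blP => //.
    by rewrite !aut_size.
  rewrite !aut_take => ubl; rewrite (big_rem _ ubl) /= aut_funK eqxx; lia.
rewrite -[size bl]sum1_size; apply: leq_sum => u _.
have := opt_count (aut_inv h u) k0 smk; rewrite -sum1_count; apply: leq_trans.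
by rewrite [in leqRHS]big_mkcond.
Qed.

Lemma mean_hit_after k ks v : (0 < k <= K)%N -> size v = l.+1 -> all (leq^~ k.+1) ks ->
  mean (k :: ks) (fun gs => (hit (head aut_one gs v) (behead gs) : nat)%:R) <=
  (\sum_(k' <- ks) B k')%:R / (size (opt k))%:R.
Proof.
move=> k0 sv ks_le.
rewrite (mean_exchange k ks (fun g gs => (hit (g v) gs : nat)%:R)).
rewrite -[leRHS](mean_const ks); apply: mean_le => gs gsP.
rewrite ler_pM2r ?invr_gt0 ?ltr0n // -natr_sum ler_nat.
exact: (@count_hit k ks gs 1%g v k0 sv ks_le gsP).
Qed.

Lemma mean_ncross k ks ks1 gs : (0 < k <= K)%N -> all (leq^~ k.+1) ks ->
  mean (k :: ks) (fun hs => (ncross ks1 gs hs)%:R) <=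
  (count_mem 0%N ks1)%:R * ((\sum_(k' <- ks) B k')%:R / (size (opt k))%:R).
Proof.
move=> k0 ks_le; have p0 : 0 <= (\sum_(k' <- ks) B k')%:R / (size (opt k))%:R :> rat.
  by rewrite divr_ge0 ?ler0n.
elim: ks1 gs => [|k1 ks1 IH] gs.
  by rewrite (@eq_mean _ _ (fun=> 0)) ?mean_const ?mul0r.
case: gs => [|g gs].
  by rewrite (@eq_mean _ _ (fun=> 0)) // mean_const mulr_ge0 // ?ler0n.
rewrite [ncross _ _]/= (_ : mean _ _ = mean (k :: ks) (fun hs =>
  ((k1 == 0%N) && hit (head aut_one hs (prodg gs rho)) (behead hs) : nat)%:R +
  (ncross ks1 gs hs)%:R)); last by apply: eq_mean => hs; rewrite natrD.
rewrite meanD [count_mem _ _]/= natrD mulrDl; apply: lerD; last exact: IH.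
case: (k1 == 0%N); last by rewrite mul0r (@eq_mean _ _ (fun=> 0)) ?mean_const.
rewrite [X in _ <= X]mul1r; apply: mean_hit_after => //.
by rewrite aut_size size_nseq.
Qed.

Lemma mean_nbad_split ks1 k ks2 : (0 < k <= K)%N -> all (leq^~ k.+1) ks2 ->
  mean (ks1 ++ k :: ks2) (fun gs => (nbad (ks1 ++ k :: ks2) gs)%:R) <=
  mean (ks1 ++ [:: k]) (fun gs => (nbad (ks1 ++ [:: k]) gs)%:R) +
  mean ks2 (fun gs => (nbad ks2 gs)%:R) +
  (count_mem 0%N ks1)%:R * ((\sum_(k' <- ks2) B k')%:R / (size (opt k))%:R).
Proof.
move=> k0 ks_le.
pose f1 gs := (nbad (ks1 ++ [:: k]) (take (size ks1).+1 gs))%:R : rat.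
pose f2 gs := (nbad ks2 (drop (size ks1).+1 gs))%:R : rat.
pose f3 gs := (ncross ks1 (take (size ks1) gs) (drop (size ks1) gs))%:R : rat.
apply: (@le_trans _ _ (mean (ks1 ++ k :: ks2) (fun gs => f1 gs + f2 gs + f3 gs))).
  apply: mean_le => gs /outcome_size; rewrite size_cat /= => sz.
  rewrite /f1 /f2 /f3 -!natrD ler_nat.
  have sg1 : size (take (size ks1) gs) = size ks1 by rewrite size_takel // sz; lia.
  have: size (drop (size ks1) gs) = (size ks2).+1 by rewrite size_drop sz; lia.
  case dE: (drop (size ks1) gs) => [|g gs2] // _.
  have tE : take (size ks1).+1 gs = take (size ks1) gs ++ [:: g].
    rewrite -{1}(cat_take_drop (size ks1) gs) dE take_cat sg1 ltnNge leqnSn /=.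
    by rewrite subSnn /= take0.
  have d2E : drop (size ks1).+1 gs = gs2.
    by rewrite -addn1 addnC -drop_drop dE /= drop0.
  rewrite -{1}(cat_take_drop (size ks1) gs) dE tE d2E.
  exact: (nbad_split ks2 g gs2 sg1 (lt0n_neq0 (proj1 (andP k0)))).
rewrite (meanD _ (fun gs => f1 gs + f2 gs)) (meanD _ f1); apply: lerD; first apply: lerD.
- have -> : ks1 ++ k :: ks2 = (ks1 ++ [:: k]) ++ ks2 by rewrite -catA.
  rewrite mean_cat; apply: mean_le => g1 /outcome_size sz.
  rewrite -[leRHS](mean_const ks2); apply: mean_le => g2 _.
  by rewrite /f1 take_size_cat // sz size_cat addn1.
- have -> : ks1 ++ k :: ks2 = (ks1 ++ [:: k]) ++ ks2 by rewrite -catA.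
  rewrite mean_cat -[leRHS](mean_const (ks1 ++ [:: k])); apply: mean_le => g1 /outcome_size sz.
  apply: mean_le => g2 _.
  by rewrite /f2 drop_size_cat // sz size_cat addn1.
rewrite mean_cat -[leRHS](mean_const ks1); apply: mean_le => g1 /outcome_size sz.
apply: le_trans (@mean_ncross k ks2 ks1 g1 k0 ks_le); apply: mean_le => g2 _.
by rewrite /f3 take_size_cat ?drop_size_cat.
Qed.

(** * The hierarchical schedule of lamps and separators *)

Section Schedule.
Variable N : nat.
Hypothesis N_gt0 : (0 < N)%N.

(** A separator of kind [j] closes each of the [N] copies of the schedule of depth [j - 1]: the
    stronger and longer separators are the rarer ones, which keeps the total length under
    control. *)
Fixpoint sched (j : nat) : seq nat :=
  if j is j'.+1 then flatten (nseq N (rcons (sched j') j)) else [:: 0%N].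

Lemma sched_le j : all (leq^~ j) (sched j).
Proof.
elim: j => //= j IH; apply/allP => k /flattenP[s /nseqP[-> _]].
rewrite mem_rcons inE => /orP[/eqP -> //|ks]; exact: leq_trans (allP IH _ ks) _.
Qed.

Lemma sum_flatten_nseq (F : nat -> nat) n s :
  (\sum_(k <- flatten (nseq n s)) F k = n * \sum_(k <- s) F k)%N.
Proof.
elim: n => [|n IH]; first by rewrite big_nil.
by rewrite /= big_cat /= IH mulSn.
Qed.

Lemma sum_sched F j : (\sum_(k <- sched j.+1) F k =
  N * (\sum_(k <- sched j) F k + F j.+1))%N.
Proof. by rewrite /= sum_flatten_nseq -cats1 big_cat big_seq1. Qed.

Lemma count0_sched j : count_mem 0%N (sched j) = (N ^ j)%N.
Proof.
rewrite -sum1_count big_mkcond; elim: j => [|j IH]; first by rewrite big_seq1.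
by rewrite sum_sched IH addn0 expnS.
Qed.

Lemma sched_last j : (0 < j)%N -> exists ks, sched j = rcons ks j.
Proof.
case: j => // j _; rewrite /= -(prednK N_gt0).
exists (flatten (nseq N.-1 (rcons (sched j) j.+1)) ++ sched j).
elim: N.-1 => [|n IH]; first by rewrite /= cats0.
change (rcons (sched j) j.+1 ++ flatten (nseq n.+1 (rcons (sched j) j.+1)) = rcons ((rcons (sched j) j.+1 ++ flatten (nseq n (rcons (sched j) j.+1))) ++ sched j) j.+1).
by rewrite IH -rcons_cat catA.
Qed.

Hypothesis B0 : B 0 = 1%N.
Hypothesis B1 : B 1 = 0%N.
Hypothesis BS : forall j, B j.+2 = (4 * N ^ j.+1)%N.
Hypothesis opt_large : forall j, (0 < j)%N -> (N ^ (j + 3) <= size (opt j))%N.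

Lemma sumB_sched j : (\sum_(k <- sched j.+1) B k <= 4 * j.+1 * N ^ j.+1)%N.
Proof.
elim: j => [|j IH].
  by rewrite sum_sched big_seq1 B0 B1; lia.
rewrite sum_sched BS (leq_trans (leq_mul (leqnn N) (leq_add IH (leqnn _)))) //.
by apply: eq_leq; rewrite [(N ^ j.+2)%N]expnS; set X := (N ^ _)%N; lia.
Qed.

Let E (ks : seq nat) : rat := mean ks (fun gs => (nbad ks gs)%:R).

(** The copies are peeled off one by one; the separator [j] that ends a copy randomizes the entry
    into the at most [n] copies after it. *)
Lemma mean_nbad_nseq n ks j : (0 < j <= K)%N -> all (leq^~ j.+1) ks ->
  E (flatten (nseq n (rcons ks j))) <= n%:R * (E (rcons ks j) + (count_mem 0%N ks)%:R *
   ((n * \sum_(k <- rcons ks j) B k)%:R / (size (opt j))%:R)).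
Proof.
move=> j0 ks_le; set U := rcons ks j; set c := (count_mem _ _)%:R.
have Ule : all (leq^~ j.+1) U by rewrite all_rcons ks_le leqnSn.
elim: n => [|n IH]; first by rewrite /E /= mul0r.
have -> : flatten (nseq n.+1 U) = ks ++ j :: flatten (nseq n U) by rewrite /U -cat_rcons.
apply: le_trans (mean_nbad_split _ j0 _) _.
  by elim: (n) => //= n' IH'; rewrite all_cat Ule.
rewrite cats1 -/U -/(E U) -/(E (flatten _)) -natr1 mulrDl mul1r.
rewrite addrAC addrC; apply: lerD; last first.
  rewrite lerD2l ler_wpM2l ?ler0n // ler_pM2r ?invr_gt0 ?ltr0n // sum_flatten_nseq.
  by rewrite ler_nat leq_mul2r leqnSn orbT.
apply: le_trans IH _; rewrite ler_wpM2l ?ler0n // lerD2l ler_wpM2l ?ler0n //.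
by rewrite ler_pM2r ?invr_gt0 ?ltr0n // ler_nat leq_mul2r leqnSn orbT.
Qed.

(** [sched j] ends with a separator of kind [j], which randomizes all its [N ^ j] lamps. The
    appended separator has at most [B j.+1 = 4 N^j] exceptional prefixes, against at least
    [N ^ (j + 3)] choices. *)
Lemma mean_nbad_step j : (0 < j <= K)%N ->
  E (rcons (sched j) j.+1) <= E (sched j) + (N ^ j)%:R * (4%:R / (N ^ 3)%:R).
Proof.
move=> j0K; have /andP[j0 jK] := j0K; have [ks ksE] := sched_last j0.
have cE : count_mem 0%N ks = (N ^ j)%N.
  by rewrite -count0_sched ksE -cats1 count_cat /= (gtn_eqF j0) addn0 addn0.
rewrite ksE -cats1 cat_rcons; apply: le_trans (mean_nbad_split _ j0K _) _.
  by rewrite /= leqnn.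
rewrite cats1 -/(E (rcons ks j)) -addrA lerD2l.
have -> : mean [:: j.+1] (fun gs => (nbad [:: j.+1] gs)%:R) = 0.
  by rewrite (@eq_mean _ _ (fun=> 0)) ?mean_const // => -[|? []].
rewrite add0r cE ler_wpM2l ?ler0n // big_seq1.
case: j j0 {ks ksE cE j0K jK} => // j _; rewrite BS.
rewrite ler_pdivrMr ?ltr0n // mulrAC ler_pdivlMr ?ltr0n ?expn_gt0 ?N_gt0 //.
rewrite -!natrM ler_nat -mulnA leq_mul2l -expnD /=.
exact: opt_large.
Qed.

(** Per lamp and in units of [1 / N ^ 3], one more depth adds 4 for the new separator and
    [4 (j + 1)] for crossings between the copies; [4 j (j + 1)] dominates the accumulated sum. *)
Lemma mean_nbad_sched j : (j <= K)%N ->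
  E (sched j) <= (N ^ j)%:R * ((4 * j * j.+1)%:R / (N ^ 3)%:R).
Proof.
have N3 : 0 < (N ^ 3)%:R :> rat by rewrite ltr0n expn_gt0 N_gt0.
elim: j => [_|j IH jK].
  rewrite muln0 mul0n mul0r mulr0 /E -(mean_const (sched 0) 0); apply: mean_le.
  by move=> -[|g [|h gs]] //=; rewrite andbF.
have {}IH := IH (ltnW jK).
have EU : E (rcons (sched j) j.+1) <=
    (N ^ j)%:R * ((4 * j * j.+1 + 4)%:R / (N ^ 3)%:R).
  case: j IH jK => [|j] IH jK; last first.
    apply: le_trans (@mean_nbad_step j.+1 (ltnW jK)) _.
    by rewrite natrD [X in _ <= _ * X]mulrDl mulrDr lerD2r.
  (* For [j = 0] the block is one lamp and one separator of kind 1, which has no exceptional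
     vertices as [B 1 = 0]. *)
  apply: (@le_trans _ _ 0); last by rewrite mulr_ge0 ?divr_ge0 ?ler0n.
  rewrite /E -(mean_const [:: 0%N; 1%N] 0); apply: mean_le => -[|g [|h [|]]] //=.
    move=> /and3P[_ h1 _]; rewrite orbF.
    have [bl blP] := @opt_cover 1 1 h jK (leqnSn 1) h1; rewrite B1 leqn0 => /nilP blE.
    suff -> : bad_at h rho = false by [].
    apply/negbTE/negPn/asboolP; apply: blP; rewrite ?size_nseq //.
    by rewrite blE.
  by move=> ? ?; rewrite !andbF.
apply: le_trans (@mean_nbad_nseq N (sched j) j.+1 jK _) _.
  by apply: sub_all (sched_le j) => k /= /leq_trans; apply; rewrite ltnW.
rewrite count0_sched -sum_flatten_nseq -/(sched j.+1).
have le2 : (\sum_(k <- sched j.+1) B k)%:R / (size (opt j.+1))%:R <=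
    (4 * j.+1)%:R / (N ^ 3)%:R :> rat.
  rewrite ler_pdivrMr ?ltr0n // mulrAC ler_pdivlMr //.
  rewrite -!natrM ler_nat; apply: leq_trans (leq_mul (sumB_sched j) (leqnn _)) _.
  by rewrite -mulnA -expnD leq_mul2l opt_large ?orbT.
rewrite expnS natrM -mulrA ler_wpM2l ?ler0n //.
apply: le_trans (lerD EU (ler_wpM2l (ler0n _ _) le2)) _.
rewrite -mulrDr -mulrDl ler_wpM2l ?ler0n // ler_pM2r ?invr_gt0 //.
by rewrite -natrD ler_nat; lia.
Qed.

End Schedule.

End Kinds.

(** * Recovering the lamps from the product *)

Section Decode.
Variable b : treeAut.
Hypothesis b_neq1 : b != 1%g.
Hypothesis opt0 : opt 0 = [:: 1%g; b].
Hypothesis b_visible : forall P, c_section l w P rho -> ~ c_section l w (b * P)%g rho.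

(** The choice at a position is guessed from the tail product alone, by testing whether its section
    at [rho] lies outside {1, c}; wrong guesses are counted. *)
Fixpoint err (ks : seq nat) (gs : seq treeAut) : nat :=
  match ks, gs with
  | k :: ks', g :: gs' =>
    ((k == 0%N) && (bad_at (g * prodg gs')%g rho != (g == b)) + err ks' gs')%N
  | _, _ => 0%N
  end.

Lemma err_le_nbad ks gs : outcome ks gs -> (err ks gs <= nbad ks gs)%N.
Proof.
elim: ks gs => [|k ks IH] [|g gs] //= /andP[gk gsP]; apply: leq_add; last exact: IH.
case: eqP gk => //= -> ; rewrite opt0 !inE => gE.
case: (boolP (hit rho gs)) => [|/hitN cs]; first by case: (_ != _).
suff -> : bad_at (g * prodg gs)%g rho = (g == b) by rewrite eqxx.
case/orP: gE => /eqP ->.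
  by rewrite mul1g eq_sym (negbTE b_neq1); apply/negbTE/negPn/asboolP.
by rewrite eqxx; apply/asboolP; exact: b_visible.
Qed.

Lemma average_le k (F : treeAut -> rat) c : (forall g, g \in opt k -> F g <= c) ->
  (\sum_(g <- opt k) F g) / (size (opt k))%:R <= c.
Proof.
move=> le; rewrite -[leRHS](mean_const [:: k] c).
apply: (@mean_le [:: k] (fun gs => F (head aut_one gs))) => -[|g gs] //=.
by move=> /andP[/le].
Qed.

(** Once the product [g] is fixed, so is the guess for the first lamp: one of its two values is
    right and the other uses up an error. [(T + 1) ^ s] dominates the number of sets of at most [s]
    errors among [T] lamps. *)
Lemma mean_err ks g s :
  mean ks (fun gs => ((prodg gs == g) && (err ks gs <= s)%N : nat)%:R) <=
  ((count_mem 0%N ks).+1 ^ s)%:R / (2 ^ count_mem 0%N ks)%:R.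
Proof.
have eq_prodg h gs g' : (prodg (h :: gs) == g') = (prodg gs == h^-1 * g')%g.
  by rewrite prodg_cons; apply/eqP/eqP => [<-|->]; rewrite ?mulKg ?mulVKg.
elim: ks g s => [|k ks IH] g s.
  by rewrite /= exp1n expn0 divr1; case: (_ && _).
set T := count_mem 0%N ks in IH *.
case: (eqVneq k 0%N) => [->|k0]; last first.
  rewrite [count_mem _ _]/= (negbTE k0) add0n -/T; apply: average_le => h _.
  apply: le_trans (IH (h^-1 * g)%g s); apply: mean_le => gs _.
  by rewrite eq_prodg /= (negbTE k0).
have half h : mean ks (fun gs =>
      ((prodg (h :: gs) == g) && (err (0%N :: ks) (h :: gs) <= s)%N : nat)%:R) <=
    (if bad_at g rho != (h == b) then (if s is s'.+1 then T.+1 ^ s' else 0)%N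
     else (T.+1 ^ s)%N)%:R / (2 ^ T)%:R.
  case eE: (_ != _).
    case: s => [|s].
      rewrite mul0r -(mean_const ks 0); apply: mean_le => gs _ /=.
      by rewrite prodg_cons; case: eqP => // ->; rewrite eE.
    apply: le_trans (IH (h^-1 * g)%g s); apply: mean_le => gs _.
    rewrite -eq_prodg prodg_cons /=; case: eqP => // ->.
    by rewrite eE.
  apply: le_trans (IH (h^-1 * g)%g s); apply: mean_le => gs _.
  by rewrite -eq_prodg prodg_cons /=; case: eqP => // ->; rewrite eE.
rewrite [mean _ _]/= opt0 !big_cons big_nil addr0.
rewrite [count_mem _ _]/= -/T add1n expnS natrM invfM [X in _ <= X]mulrA [X in _ <= X]mulrAC.
rewrite ler_pM2r ?invr_gt0 ?ltr0n //; apply: le_trans (lerD (half 1%g) (half b)) _.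
rewrite eqxx (eq_sym 1%g) (negbTE b_neq1) -mulrDl ler_pM2r ?invr_gt0 ?ltr0n ?expn_gt0 // -natrD ler_nat.
have bound : (T.+1 ^ s + (if s is s'.+1 then T.+1 ^ s' else 0) <= T.+2 ^ s)%N.
  case: s {IH half} => [|s] //; rewrite expnS -mulSnr expnS leq_mul2l /=.
  by case: s => // s; rewrite leq_exp2r.
case: (bad_at g rho) => /=; last exact: bound.
by rewrite addnC.
Qed.

(* Markov's inequality leaves half of the outcomes with at most [s] errors, and
   these are determined by their product and their errors. *)
Lemma decode_card ks s (D : seq treeAut) :
  (forall gs, outcome ks gs -> prodg gs \in D) ->
  mean ks (fun gs => (nbad ks gs)%:R) * 2%:R <= (s.+1)%:R ->
  (2 ^ count_mem 0%N ks <= 2 * size D * (count_mem 0%N ks).+1 ^ s)%N.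
Proof.
move=> DP mk; set T := count_mem 0%N ks.
have T0 : 0 < (2 ^ T)%:R :> rat by rewrite ltr0n expn_gt0.
have s0 : 0 < s.+1%:R :> rat by rewrite ltr0n.
(* Every outcome either has more than [s] errors, hence contributes at least 1 to the Markov term,
   or is counted at its product in [D]. *)
have: 1 <= mean ks (fun gs => (nbad ks gs)%:R / s.+1%:R) +
    \sum_(g <- D) mean ks (fun gs => ((prodg gs == g) && (err ks gs <= s)%N : nat)%:R).
  rewrite -mean_sum -meanD -[leLHS](mean_const ks 1); apply: mean_le => gs gsP.
  case: (leqP (err ks gs) s) => [es|se].
    rewrite -[leLHS]add0r; apply: lerD; first by rewrite divr_ge0 ?ler0n.
    rewrite (big_rem _ (DP _ gsP)) /= eqxx -[leLHS]addr0; apply: lerD => //.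
    by apply: sumr_ge0 => g _; rewrite ler0n.
  rewrite -[leLHS]addr0; apply: lerD; last by apply: sumr_ge0 => g _; rewrite ler0n.
  rewrite ler_pdivlMr // mul1r ler_nat; exact: leq_trans se (err_le_nbad gsP).
rewrite meanZ => le1.
have le2 : \sum_(g <- D) mean ks (fun gs =>
    ((prodg gs == g) && (err ks gs <= s)%N : nat)%:R) <=
    (size D)%:R * ((T.+1 ^ s)%:R / (2 ^ T)%:R).
  rewrite mulr_natl -[X in _ *+ X]count_predT -[leRHS]addr0 -iter_addr -big_const_seq.
  by apply: ler_sum => g _; exact: mean_err.
have le3 : mean ks (fun gs => (nbad ks gs)%:R) * s.+1%:R^-1 <= 2%:R^-1.
  by rewrite ler_pdivrMr // mulrC ler_pdivlMr ?ltr0n.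
have : 2%:R^-1 <= (size D)%:R * ((T.+1 ^ s)%:R / (2 ^ T)%:R) :> rat.
  by move: (le_trans le1 (lerD le3 le2)); set X := _ * (_ / _); lra.
rewrite mulrA ler_pdivlMr // mulrC ler_pdivrMr ?ltr0n // -!natrM ler_nat.
by rewrite mulnC mulnA.
Qed.

End Decode.
End Hits.
End Mean.

(** * Lower bound for the growth of the group *)

Definition triangle (V : 'I_3 -> nat) := forall i, (V i <= V (other1 i) + V (other2 i))%N.
Definition vsum (V : 'I_3 -> nat) := (V digit0 + V digit1 + V digit2)%N.

Lemma triangleP V : triangle V <-> [/\ (V digit0 <= V digit1 + V digit2)%N,
  (V digit1 <= V digit2 + V digit0)%N & (V digit2 <= V digit0 + V digit1)%N].
Proof.
split=> [t|[t0 t1 t2] i]; first by have := t digit0; have := t digit1; have := t digit2.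
by case: (digitP i) => ->.
Qed.

Lemma triangle_step i V : triangle V -> triangle (vstep i V).
Proof.
move=> /triangleP[t0 t1 t2]; apply/triangleP.
by case: (digitP i) => ->; rewrite /vstep /=; split; lia.
Qed.

Lemma triangle_vseq V w k : triangle V -> triangle (vseq V w k).
Proof. by elim: k V w => //= k IH V w /triangle_step t; exact: IH. Qed.

Lemma vstep_ge2 i V x : triangle V -> (2 * V x <= vstep i V x)%N.
Proof.
move=> /triangleP[t0 t1 t2]; rewrite /vstep; case: eqP => // _.
by case: (digitP x) => ->; lia.
Qed.

Lemma vsum_step i V : triangle V -> (2 * vsum V <= vsum (vstep i V) <= 3 * vsum V)%N.
Proof.
move=> /triangleP[t0 t1 t2].
by case: (digitP i) => ->; rewrite /vsum /vstep /=; lia.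
Qed.

Lemma triangle_unit : triangle unit_weights. Proof. by []. Qed.

Lemma vseq_le_sum (V : 'I_3 -> nat) i : (V i <= vsum V)%N.
Proof.
rewrite /vsum; case: (digitP i) => ->; first by rewrite -addnA leq_addr.
  by rewrite -addnA addnCA leq_addr.
exact: leq_addl.
Qed.

Lemma gen_section i w n :
  section_of (gen i w) (nseq n true) (gen i (iter n Defs.shift w)).
Proof.
elim: n w => [|n IH] w // y.
by rewrite !gen_true cat_cons IH -iterSr.
Qed.

Lemma iter_shift n w k : iter n Defs.shift w k = w (n + k)%N.
Proof. by elim: n k => // n IH k; rewrite iterS /Defs.shift IH addnS. Qed.

Lemma gen_visible w n : w n = digit1 -> gen digit2 w <> 1 /\ gen digit2 w <> gen digit1 w.
Proof.
move=> wn; have sb := gen_section digit2 w n.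
have w0 : iter n Defs.shift w 0 = digit1.
  by rewrite iter_shift addn0.
have bE : gen digit2 (iter n Defs.shift w) [:: false; false] = [:: false; true].
  by rewrite gen_false w0 letter_uE a_flip.
split=> e; move: bE; rewrite e in sb.
  by rewrite (section_of_inj sb (section_of1 _)).
by rewrite (section_of_inj sb (gen_section digit1 w n)) gen_false w0 letter_uE.
Qed.

Section Lift.
Variables (F : finGroupType) (w : omega_seq).

Lemma lift_gen x : G_gens w x -> exists2 y : Gamma F w, Gamma_gens y & val (wr_grp y) = x.
Proof.
move=> [[[->|->]|->]|->].
- by exists (lamp 1 (G_a w)); first by left.
- by exists (lamp 1 (G_b w)) => //; right; exists 1 => //; exists (G_b w) => //; do 2!left; right.
- by exists (lamp 1 (G_c w)) => //; right; exists 1 => //; exists (G_c w) => //; left; right.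
- by exists (lamp 1 (G_d w)) => //; right; exists 1 => //; exists (G_d w) => //; right.
Qed.

Lemma lift_word n g : word_of w n g ->
  exists2 y : Gamma F w, word_ball (@Gamma_gens F w) n y & val (wr_grp y) = g.
Proof.
move=> [s [sn sG ->]]; suff [t [st tG tE]] : exists t : seq (Gamma F w),
    [/\ size t = size s, forall x, x \in t -> Gamma_gens x &
      val (wr_grp (\prod_(x <- t) x)) = \prod_(x <- s) x].
  exists (\prod_(x <- t) x) => //; exists t; split=> //; first by rewrite st.
  by move=> x /tG; left.
elim: s {sn} sG => [|x s IH] sG; first by exists [::]; split=> //; rewrite !big_nil.
have [|t [st tG tE]] := IH; first by move=> y ys; apply: sG; rewrite inE ys orbT.
have [y yG yE] := lift_gen (sG x (mem_head _ _)).
exists (y :: t); split; first by rewrite /= st.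
  by move=> z; rewrite inE => /orP[/eqP ->//|]; exact: tG.
by rewrite !big_cons -tE -yE.
Qed.

(** The quotient [G_omega] alone is counted: its words lift to the wreath product with trivial lamps
    and unchanged length. *)
Lemma growth_ge (D : seq treeAut) n : uniq D -> (forall g, g \in D -> word_of w n g) ->
  (size D <= Gamma_growth F w n)%N.
Proof.
move=> uD DP; rewrite /Gamma_growth /growth.
rewrite -(size_map (fun y : Gamma F w => val (wr_grp y))); apply: uniq_leq_size => // g gD.
have [y yB <-] := lift_word (DP g gD); apply: (map_f (fun y : Gamma F w => val (wr_grp y))).
rewrite in_fset_set ?inE //; exact: finite_word_ball (finite_Gamma_gens F w).
Qed.
End Lift.

Section Lower.
Variable w : omega_seq.
Let vs k := vsum (vseq unit_weights w k).

Lemma vsum_vseq2 k : (2 * vs k <= vs k.+1)%N.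
Proof. by rewrite /vs vseqS; case/andP: (vsum_step (w k) (triangle_vseq w k triangle_unit)). Qed.

Lemma vsum_vseqX k n : (2 ^ n * vs k <= vs (k + n))%N.
Proof.
elim: n => [|n IH]; first by rewrite mul1n addn0.
rewrite expnS -mulnA addnS; apply: leq_trans (vsum_vseq2 _); exact: leq_mul.
Qed.

Lemma sum_vsum k : (\sum_(j < k) vs j <= vs k)%N.
Proof.
elim: k => [|k IH]; first by rewrite big_ord0.
rewrite big_ord_recr /=; apply: leq_trans (vsum_vseq2 k).
by rewrite mul2n -addnn leq_add2r.
Qed.

Definition flipper (d : nat) : treeAut := if d is j.+1 then flip_elt j w else aut_a.

Lemma flipperP d y : (d < size y)%N ->
  take d (flipper d y) = take d y /\ nth false (flipper d y) d = ~~ nth false y d.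
Proof.
case: d => [|j] sy; first by case: y sy => // t y _; rewrite !take0 [flipper 0]/= a_flip.
exact: flip_shapeP (flip_elt_shape j w) sy.
Qed.

(** The digits whose flipper is built from b, as [nonspecial digit1] is b, and so may have
    exceptional vertices. *)
Definition visible d := (0 < d)%N && (w d.-1 == digit1).

Lemma flipper_cover d l p : w l = digit1 -> (d.-1 <= l)%N -> (p <= l)%N ->
  (visible d -> d.-1 <= p)%N ->
  exists2 bl, bad_cover l w p (flipper d) bl &
    (size bl <= if visible d then 2 ^ d else 0)%N.
Proof.
case: d => [|j] wl jl pl vp; first by exists [::]; [exact: bad_cover_a|].
case: (boolP (visible j.+1)) vp => [v /(_ isT) /= jp|nv _].
  have [|bl bP] := flip_shape_bad (p := p) (flip_elt_shape j w) wl; first by rewrite jp pl.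
  by case/andP: v => _ /= ->; exists bl.
have [|bl bP] := flip_shape_bad (p := l) (flip_elt_shape j w) wl; first by rewrite jl leqnn.
have /negbTE -> : w j != digit1 by move: nv; rewrite /visible.
by rewrite leqn0 => /nilP blE; exists [::] => //; apply: (@bad_cover0 _ _ l); rewrite -blE.
Qed.

Definition flipper_len d : nat := if d is j.+1 then (4 * vs j)%N else 1.

Lemma word_of_flipper d : word_of w (flipper_len d) (flipper d).
Proof.
case: d => [|j]; first exact: word_of_gen (G_gens_a w).
apply: word_of_leq (word_of_flip_elt j w); rewrite leq_mul2l /=; exact: vseq_le_sum.
Qed.

Fixpoint subprods (js : seq nat) : seq treeAut :=
  if js is d :: js' then subprods js' ++ [seq flipper d * g | g <- subprods js']
  else [:: 1].

Lemma size_subprods js : size (subprods js) = (2 ^ size js)%N.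
Proof. by elim: js => //= d js IH; rewrite size_cat size_map IH expnS; lia. Qed.

Lemma subprods_take d js g y : all (leq d) js -> all (fun i => i < size y)%N js ->
  g \in subprods js -> take d (g y) = take d y.
Proof.
elim: js g y => [|i js IH] g y /=; first by rewrite inE => _ _ /eqP ->.
move=> /andP[di djs] /andP[iy jsy]; rewrite mem_cat => /orP[|/mapP[h hjs ->]].
  exact: IH.
rewrite aut_mulE IH ?aut_size //.
have [tE _] := flipperP iy.
by rewrite -[in LHS](take_takel _ di) tE take_takel.
Qed.

(** The flippers of larger digits do not touch digit [d], so this digit of the image tells whether
    the flipper of [d] was used. *)
Lemma subprods_count js y v : sorted ltn js -> all (fun i => i < size y)%N js ->
  (count (fun g : treeAut => g y == v) (subprods js) <= 1)%N.
Proof.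
elim: js y => [|d js IH] y js_sorted /= js_le; first by case: eqP.
have /andP[dy jsy] := js_le.
have djs : all (leq d.+1) js by apply: order_path_min js_sorted; exact: ltn_trans.
have sjs : sorted ltn js by exact: path_sorted js_sorted.
have nthE g z : size z = size y -> g \in subprods js -> nth false (g z) d = nth false z d.
  move=> sz gjs; have := subprods_take (y := z) djs; rewrite sz => /(_ g jsy gjs) tE.
  by rewrite -(nth_take _ (ltnSn d)) tE nth_take.
rewrite count_cat count_map.
have [_ fE] := flipperP dy.
case: (eqVneq (nth false v d) (nth false y d)) => vd.
  rewrite [X in (_ + X)%N](_ : _ = 0%N) ?addn0; first exact: IH.
  apply/eqP; rewrite -leqn0 leqNgt -has_count; apply/hasPn => g gjs /=.
  apply: contra_eqN vd => /eqP <-; rewrite nthE ?aut_size // fE.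
  by case: (nth _ _ _).
rewrite [X in (X + _)%N](_ : _ = 0%N) ?add0n.
  by apply: IH => //; rewrite aut_size.
apply/eqP; rewrite -leqn0 leqNgt -has_count; apply/hasPn => g gjs /=.
by apply: contra_neqN vd => /eqP <-; rewrite nthE.
Qed.

Lemma subprods_cover js l p g : w l = digit1 -> (p <= l)%N ->
  all (fun d => (d.-1 <= l) && (visible d ==> (d.-1 <= p)))%N js ->
  g \in subprods js -> exists2 bl, bad_cover l w p g bl &
    (size bl <= \sum_(d <- js | visible d) 2 ^ d)%N.
Proof.
move=> wl pl; elim: js g => [|d js IH] g /=.
  rewrite inE big_nil => _ /eqP ->; exists [::] => //.
  by move=> v _ _; exact: c_section1.
move=> /andP[/andP[dl /implyP dp] djs]; rewrite mem_cat => /orP[gjs|/mapP[h hjs ->]].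
  have [bl bP sbl] := IH _ djs gjs; exists bl => //; apply: leq_trans sbl _.
  by rewrite [leqRHS]big_cons; case: ifP => // _; rewrite leq_addl.
have [bl bP sbl] := IH _ djs hjs.
have [bl' bP' sbl'] := flipper_cover wl dl pl dp.
eexists; first exact: bad_coverM bP' bP.
rewrite size_cat size_map big_cons; case: ifP sbl' => _ sbl'.
  exact: leq_add.
by move: sbl'; rewrite leqn0 => /eqP ->.
Qed.

Lemma word_of_subprods js g : g \in subprods js ->
  word_of w (\sum_(d <- js) flipper_len d) g.
Proof.
elim: js g => [|d js IH] g /=; first by rewrite inE => /eqP ->; exact: word_of1.
rewrite big_cons mem_cat => /orP[/IH|/mapP[h /IH flip_word ->]].
  by apply: word_of_leq; rewrite leq_addl.
exact: word_ofM (word_of_flipper d) flip_word.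
Qed.

Hypothesis no_adjacent : forall j, w j = digit1 -> w j.+1 != digit1.

Variables (r K : nat).
Let N := (2 ^ r)%N.
(** For [k > 0], visible digits are excluded from the last [8 r] of the [m k] digits. At most half
    of these are visible, so [(k + 3) r] positions remain, enough for [N ^ (k + 3)] products; and
    exceptional prefixes come only from [d < (k - 1) r], so they number less than [N ^ (k - 1)]. *)
Let m k := ((k + 7) * r)%N.
Let allowed k d := ~~ visible d || (d.+1 + 8 * r <= m k)%N.
Let positions k := [seq d <- iota 0 (m k) | allowed k d].
Let opt k := if k is 0 then [:: 1; gen digit2 w] else subprods (positions k).

Lemma visibleS d : visible d -> ~~ visible d.+1.
Proof.
by case: d => // d /andP[_ /eqP wd]; rewrite /visible /= no_adjacent.
Qed.

Lemma count_visible s n : (count visible (iota s (2 * n)) <= n)%N.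
Proof.
elim: n s => [|n IH] s; first by rewrite muln0.
rewrite mulnS /=; move: (IH s.+2); move: (count _ _) => c cn.
case: (boolP (visible s)) => [/visibleS/negbTE ->|_] /=; first by rewrite add1n.
by rewrite add0n -[n.+1]add1n; apply: leq_add => //; exact: leq_b1.
Qed.

Lemma size_opt k : (0 < k)%N -> (N ^ (k + 3) <= size (opt k))%N.
Proof.
case: k => // k _; rewrite /opt size_subprods /N -expnM leq_exp2l // size_filter.
set c := count _ _.
have : (c + count (predC (allowed k.+1)) (iota 0 (m k.+1)) = m k.+1)%N.
  by rewrite count_predC size_iota.
suff : (count (predC (allowed k.+1)) (iota 0 (m k.+1)) <= 4 * r)%N by rewrite /m; lia.
have mE : m k.+1 = (k * r + 8 * r)%N by rewrite /m; lia.
rewrite mE iotaD count_cat [X in (X + _)%N](_ : _ = 0%N).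
  rewrite add0n; apply: leq_trans (count_visible (k * r) (4 * r)).
  rewrite mulnA; apply: sub_count => d; rewrite /= /allowed negb_or negbK.
  by case/andP.
apply/eqP; rewrite -leqn0 leqNgt -has_count; apply/hasPn => d.
rewrite mem_iota /= add0n => dk; rewrite negbK /allowed mE; apply/orP; right; lia.
Qed.

Lemma size_opt_gt0 k : (0 < size (opt k))%N.
Proof. by case: k => // k; apply: leq_trans (size_opt (ltn0Sn k)); rewrite expn_gt0 expn_gt0. Qed.

Let B k := if k is k'.+1 then if k' is k''.+1 then (4 * N ^ k')%N else 0%N else 1%N.

Lemma positions_lt k : all (fun d => d < m k)%N (positions k).
Proof. by apply/allP => d; rewrite mem_filter mem_iota add0n => /andP[_ /andP[]]. Qed.

Lemma opt_count k y u : (0 < k)%N -> size y = m k ->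
  (count (fun g : treeAut => g y == u) (opt k) <= 1)%N.
Proof.
case: k => // k _ sy; apply: subprods_count.
  by apply: sorted_filter; [exact: ltn_trans | exact: iota_ltn_sorted].
by rewrite sy; exact: positions_lt.
Qed.

Lemma sum_pow2_lt M e : (\sum_(0 <= d < M) (if d < e then 2 ^ d else 0) < 2 ^ e)%N.
Proof.
suff : (\sum_(0 <= d < M) (if d < e then 2 ^ d else 0) < 2 ^ minn M e)%N.
  by move/leq_trans; apply; rewrite leq_exp2l // geq_minr.
elim: M => [|M IH]; first by rewrite big_geq // min0n.
rewrite big_nat_recr //=; case: (ltnP M e) => Me.
  rewrite (minn_idPl Me) expnS mul2n -addnn; move: IH; rewrite (minn_idPl (ltnW Me)) => IH.
  by rewrite -addSn leq_add2r.
by rewrite addn0; move: IH; rewrite (minn_idPr Me) (minn_idPr (leq_trans Me (leqnSn _))).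
Qed.

Lemma opt_cover l k k' g : w l = digit1 -> (m K.+1 <= l)%N -> (0 < k <= K)%N ->
  (k' <= k.+1)%N -> g \in opt k' ->
  exists2 bl, bad_cover l w (m k) g bl & (size bl <= B k')%N.
Proof.
move=> wl ml /andP[k0 kK] kk.
have mkl : (m k <= l)%N by apply: leq_trans ml; rewrite leq_mul2r leq_add2r leqW ?orbT.
case: k' kk => [_|k' kk].
  rewrite /opt !inE => /orP[] /eqP ->; last by exists [:: nseq (m k) true]; [exact: bad_cover_gen|].
  by exists [::] => // v _ _; exact: c_section1.
move=> gk; have [|bl bP sbl] := subprods_cover (l := l) (p := m k) wl mkl _ gk.
  apply/allP => d; rewrite mem_filter mem_iota add0n => /andP[ad /andP[_ dm]].
  apply/andP; split.
    apply: leq_trans (leq_pred _) (leq_trans (ltnW dm) (leq_trans _ ml)).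
    by rewrite leq_mul2r leq_add2r (leq_trans kk) ?orbT.
  apply/implyP => vd; move: ad; rewrite /allowed vd /= => dr.
  apply: leq_trans (leq_pred _) _.
  (* Kind [k + 1] reaches only [r] digits further than kind [k], less than the margin [8 r] kept by
     visible digits. *)
  have : (m k'.+1 <= m k + r)%N by rewrite /m -mulSnr leq_mul2r -addSn leq_add2r kk orbT.
  by move: dr; move: (m k) (m k'.+1); lia.
exists bl => //; apply: leq_trans sbl _.
have le : (\sum_(d <- positions k'.+1 | visible d) 2 ^ d <=
    \sum_(0 <= d < m k'.+1) if d < k' * r then 2 ^ d else 0)%N.
  rewrite big_filter_cond /index_iota subn0 big_mkcond; apply: leq_sum => d _.
  case: ifP => // /andP[]; rewrite /allowed => + vd; rewrite vd /= => dk.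
  suff -> : (d < k' * r)%N by [].
  by move: dk; rewrite /m; lia.
apply: leq_trans le _; case: k' {kk gk} => [|k'].
  by rewrite big1 // => d _; rewrite mul0n ltn0.
apply: ltnW; apply: leq_trans (sum_pow2_lt _ _) _.
by rewrite /B /N -expnM mulnC leq_pmull.
Qed.

Fixpoint outcomes (ks : seq nat) : seq (seq treeAut) :=
  if ks is k :: ks' then [seq g :: gs | g <- opt k, gs <- outcomes ks'] else [:: [::]].

Lemma outcomesP ks gs : reflect (gs \in outcomes ks) (outcome opt ks gs).
Proof.
apply: (iffP idP); elim: ks gs => [|k ks IH] [|g gs] //=.
- by move=> /andP[gk /IH gsP]; apply/allpairsP; exists (g, gs).
- by move=> /allpairsP[[? ?] []].
- by move=> /allpairsP[[g' gs'] /= [gk /IH gsP [-> ->]]]; apply/andP.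
Qed.

Let opt_len k := if k is 0 then 1%N else (\sum_(d <- positions k) flipper_len d)%N.

Lemma word_of_opt k g : g \in opt k -> word_of w (opt_len k) g.
Proof.
case: k => [|k]; last exact: word_of_subprods.
rewrite !inE => /orP[] /eqP ->; first exact: word_of1.
exact: word_of_gen (G_gens_gen w digit2).
Qed.

Lemma word_of_outcome ks gs : outcome opt ks gs ->
  word_of w (\sum_(k <- ks) opt_len k) (prodg gs).
Proof.
elim: ks gs => [|k ks IH] [|g gs] //=; first by move=> _; rewrite /prodg !big_nil; exact: word_of1.
move=> /andP[gk gsP]; rewrite prodg_cons big_cons.
by apply: word_ofM (IH _ gsP); exact: word_of_opt.
Qed.

Hypothesis r_gt0 : (0 < r)%N.

Lemma vs_gt0 k : (0 < vs k)%N.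
Proof. by have := vsum_vseqX 0 k; rewrite add0n; apply: leq_trans; rewrite muln_gt0 expn_gt0. Qed.

Lemma opt_len_le k : (0 < k)%N -> (opt_len k <= 4 * vs (m k))%N.
Proof.
case: k => // k _; rewrite /opt_len.
have [n mE] : exists n, m k.+1 = n.+1.
  by exists (m k.+1).-1; rewrite prednK // muln_gt0 addn_gt0.
rewrite mE; have le : (\sum_(d <- positions k.+1) flipper_len d <=
    \sum_(0 <= d < n.+1) flipper_len d)%N.
  rewrite /positions big_filter big_mkcond mE /index_iota subn0.
  by apply: leq_sum => d _; case: ifP.
apply: leq_trans le _; rewrite big_nat_recl //= big_mkord -big_distrr /=.
apply: leq_trans (leq_add (leqnn _) (leq_mul (leqnn _) (sum_vsum n))) _.
apply: leq_trans (leq_mul (leqnn _) (vsum_vseq2 n)).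
by have := vs_gt0 n; move: (vs n); lia.
Qed.

(** The weights at least double per level and [m] grows by [r], so [N] times the weight at one depth
    fits into that of the next ([le2]); every depth then contributes comparably, whence the linear
    factor [j.+1]. *)
Lemma sched_len j : (\sum_(k <- sched N j.+1) opt_len k <= 5 * j.+1 * N * vs (m j.+1))%N.
Proof.
elim: j => [|j IH]; rewrite sum_sched.
  rewrite big_seq1; have := opt_len_le (ltn0Sn 0); have := vs_gt0 (m 1).
  move: (vs _) (opt_len 1) => a b a0 ba; rewrite muln1 mulnAC mulnC leq_mul2r.
  by apply/orP; right; rewrite /=; lia.
have le2 : (N * vs (m j.+1) <= vs (m j.+2))%N.
  have -> : m j.+2 = (m j.+1 + r)%N by rewrite /m; lia.
  exact: vsum_vseqX.
have le1 := opt_len_le (ltn0Sn j.+1).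
rewrite [X in (_ <= X)%N]mulnAC [X in (_ <= X)%N]mulnC leq_mul2l; apply/orP; right.
apply: leq_trans (leq_add IH le1) _; move: le2.
rewrite -[(5 * _ * _ * _)%N]mulnA; move: (N * _)%N (vs (m j.+2)) => a b; nia.
Qed.

Theorem growth_lower (F : finGroupType) :
  (forall n, exists2 l, (n <= l)%N & w l = digit1) -> (0 < K)%N ->
  (8 * K * K.+1 <= N ^ 2)%N -> (r * K + 2 <= 2 ^ r.-1)%N ->
  (2 ^ 2 ^ (r * K).-1 <= Gamma_growth F w (5 * K * 2 ^ r * vs ((K + 7) * r)))%N.
Proof.
move=> inf K0 K_N r_K.
(* A c at level [l] frees c from exceptional vertices; a further one at [l2] makes b different from
   1 and c below level [l]. *)
have [l ml wl] := inf (m K.+1).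
have [l2 ll2 wl2] := inf l.+1.
have N0 : (0 < N)%N by rewrite expn_gt0.
have mK k : (k <= K)%N -> (m k <= l.+1)%N.
  by move=> kK; apply: leqW; apply: leq_trans ml; rewrite leq_mul2r leq_add2r leqW ?orbT.
have wE : iter l.+1 Defs.shift w (l2 - l.+1)%N = digit1.
  by rewrite iter_shift subnKC.
have [b1 bc] := gen_visible wE.
have b_neq1 : gen digit2 w != 1.
  by have [+ _] := gen_visible wl => /eqP.
have b_vis P : c_section l w P (nseq l.+1 true) ->
    ~ c_section l w (gen digit2 w * P) (nseq l.+1 true).
  move=> [h hP sh] [h' h'P sh'].
  have sb := gen_section digit2 w l.+1.
  have fixr : gen digit2 w (nseq l.+1 true) = nseq l.+1 true.
    by elim: (l.+1) (w) => // n IH v; rewrite -[nseq n.+1 true]/(true :: nseq n true) gen_true IH.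
  have sbP : section_of (gen digit2 w * P) (nseq l.+1 true) (gen digit2 (iter l.+1 Defs.shift w) * h).
    by apply: section_ofM => //; rewrite fixr.
  have e := section_of_inj sbP sh'.
  have cK := genK digit1 (iter l.+1 Defs.shift w).
  have e2 : gen digit2 (iter l.+1 Defs.shift w) = h' * h.
    by rewrite -e -mulgA; case: hP => ->; rewrite ?cK ?mulg1.
  case: hP h'P e2 => -> [->|->]; rewrite ?mulg1 ?mul1g ?cK => e2;
    [exact: b1 | exact: bc | exact: bc | exact: b1].
pose ks := sched N K.
pose D := undup [seq prodg gs | gs <- outcomes ks].
have sD : (size D <= Gamma_growth F w (5 * K * 2 ^ r * vs ((K + 7) * r)))%N.
  apply: growth_ge; first exact: undup_uniq.
  move=> g; rewrite mem_undup => /mapP[gs /outcomesP /word_of_outcome gw ->].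
  apply: word_of_leq gw; rewrite /ks; case: (K) K0 => // K' _; exact: sched_len.
apply: leq_trans sD.
have count0E : count_mem 0%N ks = (2 ^ (r * K))%N by rewrite count0_sched -expnM.
have Bm := @mean_nbad_sched opt size_opt_gt0 w l m B K mK opt_count
  (fun k k' g => @opt_cover l k k' g wl ml) N N0 erefl erefl (fun=> erefl) size_opt K (leqnn K).
(* The error budget is [N ^ K.-1]: twice the mean is at most [N ^ K * 8 K (K + 1) / N ^ 3], and
   [8 K (K + 1) <= N ^ 2]. *)
have := @decode_card opt size_opt_gt0 w l (gen digit2 w) b_neq1 erefl b_vis ks (N ^ K.-1)%N D.
rewrite count0E => /(_ _ _) dc.
have {}dc : (2 ^ 2 ^ (r * K) <= 2 * size D * (2 ^ (r * K)).+1 ^ N ^ K.-1)%N.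
  apply: dc.
    by move=> gs /outcomesP gsP; rewrite mem_undup map_f.
  apply: le_trans (ler_wpM2r (ler0n _ 2) Bm) _.
  rewrite mulrA mulrAC ler_pdivrMr ?ltr0n ?expn_gt0 ?N0 // -!natrM ler_nat.
  apply: (@leq_trans (N ^ K.-1 * N ^ 3)); last by rewrite leq_mul2r leqnSn orbT.
  have -> : (N ^ K = N ^ K.-1 * N)%N by rewrite mulnC -expnS prednK.
  rewrite -!mulnA leq_mul2l; apply/orP; right.
  rewrite [(N ^ 3)%N]expnS leq_mul2l; apply/orP; right.
  by apply: leq_trans K_N; apply: eq_leq; lia.
have rK0 : (0 < r * K)%N by rewrite muln_gt0 r_gt0.
have TE : (2 ^ (r * K) = 2 ^ (r * K).-1 + 2 ^ (r * K).-1)%N.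
  by rewrite addnn -mul2n -expnS prednK.
(* Recording the errors costs at most half of the [2 ^ (r * K)] bits. *)
have bnd : (2 * (2 ^ (r * K)).+1 ^ N ^ K.-1 <= 2 ^ 2 ^ (r * K).-1)%N.
  apply: (@leq_trans (2 * (2 ^ (r * K).+1) ^ N ^ K.-1)).
    rewrite leq_mul2l /= leq_exp2r ?expn_gt0 ?N0 // expnS mul2n -addnn -addn1.
    by rewrite leq_add2l expn_gt0.
  rewrite -expnM -expnS leq_exp2l //.
  have -> : (2 ^ (r * K).-1 = 2 ^ r.-1 * N ^ K.-1)%N.
    rewrite /N -expnM -expnD; congr (2 ^ _)%N.
    by case: (r) (K) r_gt0 K0 => // r' [|K'] // _ _; rewrite mulnS.
  apply: leq_trans (leq_mul r_K (leqnn _)).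
  by rewrite addn2 [X in (_ <= X)%N]mulSn -add1n leq_add2r expn_gt0 N0.
have pos : (0 < 2 ^ 2 ^ (r * K).-1)%N by rewrite expn_gt0.
rewrite -(leq_pmul2r pos) -expnD -TE.
apply: leq_trans dc _; rewrite -mulnA mulnCA leq_mul2l bnd orbT //.
Qed.
End Lower.

(** * Upper bound for the growth of the wreath product *)

Definition btail (x : boundary) : boundary := fun n => x n.+1.

Lemma boundary_act_node k g0 g1 x : boundary_act x (node k g0 g1) 0 = k (+) x 0 /\
  btail (boundary_act x (node k g0 g1)) = boundary_act (btail x) (if x 0 then g1 else g0).
Proof.
have mkE n : mkseq x n.+1 = x 0 :: mkseq (btail x) n.
  by rewrite /mkseq /= (iotaDl 1 0) -map_comp.
split; first by rewrite /boundary_act mkE node_cons.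
by apply: funext => n; rewrite /btail /boundary_act mkE node_cons.
Qed.

Section Upper.
Variable F : finGroupType.

(* The lamp functions are extended to the whole boundary, and no longer
   required to be finitely supported. *)
Definition tree_elt : Type := treeAut * (boundary -> F).

Definition emul (e d : tree_elt) : tree_elt :=
  (e.1 * d.1, fun x => e.2 x * d.2 (boundary_act x e.1)).
Definition eone : tree_elt := (1, fun=> 1).

Lemma elt_eq (e d : tree_elt) : e.1 = d.1 -> e.2 =1 d.2 -> e = d.
Proof. by case: e d => [g f] [h k] /= -> /funext ->. Qed.

Lemma emulA e d c : emul e (emul d c) = emul (emul e d) c.
Proof.
by apply: elt_eq => [|x] /=; rewrite ?mulgA // boundary_actM.
Qed.

Lemma emul1 e : emul eone e = e.
Proof. by apply: elt_eq => [|x] /=; rewrite ?mul1g // boundary_act1. Qed.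

Lemma emule1 e : emul e eone = e.
Proof. by apply: elt_eq => [|x] /=; rewrite ?mulg1. Qed.

Definition lampE (f : F) : tree_elt := (1, fun x => if `[< x = rho >] then f else 1).

Lemma lampE1 : lampE 1 = eone.
Proof. by apply: elt_eq => //= x; case: ifP. Qed.

Lemma lampEM f f' : emul (lampE f) (lampE f') = lampE (f * f').
Proof.
apply: elt_eq => [|x] /=; first by rewrite mulg1.
by rewrite boundary_act1; case: ifP; rewrite ?mulg1.
Qed.

Definition enode (k : bool) (e0 e1 : tree_elt) : tree_elt :=
  (node k e0.1 e1.1, fun x => (if x 0 then e1.2 else e0.2) (btail x)).

Lemma enodeM k e0 e1 k' d0 d1 : emul (enode k e0 e1) (enode k' d0 d1) =
  enode (k (+) k') (emul e0 (if k then d1 else d0)) (emul e1 (if k then d0 else d1)).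
Proof.
apply: elt_eq => [|x] /=; first by rewrite node_mul; case: k.
have [-> ->] := boundary_act_node k e0.1 e1.1 x.
by case: (x 0); case: k.
Qed.

Lemma enode1 : enode false eone eone = eone.
Proof. by apply: elt_eq => [|x] /=; rewrite ?node1 //; case: (x 0). Qed.

Inductive letter := LetterA | LetterLamp of F | LetterGen of 'I_3.

Definition letter_elt w (l : letter) : tree_elt :=
  match l with LetterA => (aut_a, fun=> 1) | LetterLamp f => lampE f | LetterGen i => (gen i w, fun=> 1) end.

Definition eval_elt w (s : seq letter) : tree_elt := foldr (fun l => emul (letter_elt w l)) eone s.

Lemma eval_elt_cons w l s : eval_elt w (l :: s) = emul (letter_elt w l) (eval_elt w s). Proof. by []. Qed.

Lemma eval_elt_cat w s t : eval_elt w (s ++ t) = emul (eval_elt w s) (eval_elt w t).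
Proof. by elim: s => [|l s IH]; rewrite ?emul1 // cat_cons !eval_elt_cons IH emulA. Qed.

Lemma LetterA_node w : letter_elt w LetterA = enode true eone eone.
Proof. by apply: elt_eq => [|x] //=; case: (x 0). Qed.

Lemma rho_eq (x : boundary) : x 0 -> btail x = rho -> x = rho.
Proof. by move=> x0 tx; apply: funext => -[|n] //; exact: (congr1 (fun f => f n) tx). Qed.

Lemma lampE_node f : lampE f = enode false eone (lampE f).
Proof.
apply: elt_eq => [|x] /=; first by rewrite node1.
case: (boolP (x 0)) => x0 /=.
  have -> // : `[< x = rho >] = `[< btail x = rho >].
  by apply/asboolP/asboolP => [->|/(rho_eq x0)].
by case: asboolP => // xr; rewrite xr in x0.
Qed.

Lemma LetterGen_node w i : letter_elt w (LetterGen i) =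
  enode false (letter_u i (w 0), fun=> 1) (letter_elt (Defs.shift w) (LetterGen i)).
Proof. by apply: elt_eq => [|x] /=; [exact: genE | case: (x 0)]. Qed.

(** A lamp goes to the section at 1 because [rho] starts with 1; a generator persists in that
    section only and leaves [a] or nothing in the other. *)
Fixpoint descend (i : 'I_3) (s : seq letter) : bool * (seq letter * seq letter) :=
  if s is l :: s' then
    let: (k, (s0, s1)) := descend i s' in
    match l with
    | LetterA => (~~ k, (s1, s0))
    | LetterLamp f => (k, (s0, LetterLamp f :: s1))
    | LetterGen j => (k, (if j == i then s0 else LetterA :: s0, LetterGen j :: s1))
    end
  else (false, ([::], [::])).

Lemma eval_elt_descend w s : let: (k, (s0, s1)) := descend (w 0) s in
  eval_elt w s = enode k (eval_elt (Defs.shift w) s0) (eval_elt (Defs.shift w) s1).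
Proof.
elim: s => [|l s IH]; first by rewrite /= enode1.
rewrite [descend _ _]/=; case: (descend _ s) IH => k [s0 s1] IH.
case: l => [|f|j]; rewrite eval_elt_cons IH.
- by rewrite LetterA_node enodeM !emul1.
- by rewrite [letter_elt _ _]lampE_node enodeM /= emul1.
rewrite LetterGen_node enodeM /=; congr (enode _ _ _).
by rewrite letter_uE; case: (eqVneq j (w 0)) => // _; rewrite emul1.
Qed.

Definition weight (V : 'I_3 -> nat) (s : seq letter) : nat :=
  sumn [seq if l is LetterGen i then V i else 0%N | l <- s].

Definition num_a (s : seq letter) : nat := count (fun l => if l is LetterA then true else false) s.

Arguments weight : simpl never.
Arguments num_a : simpl never.

Lemma weight_cons V l s :
  weight V (l :: s) = ((if l is LetterGen i then V i else 0) + weight V s)%N.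
Proof. by []. Qed.

Lemma num_a_cons l s : num_a (l :: s) = ((if l is LetterA then 1 else 0) + num_a s)%N.
Proof. by case: l. Qed.

Lemma weight_descend V i s : let: (k, (s0, s1)) := descend i s in
  (weight V s0 + weight V s1 = weight V s)%N.
Proof.
elim: s => [|l s IH] //=; case: (descend i s) IH => k [s0 s1] IH.
by case: l => [|f|j]; last case: ifP => _; rewrite !weight_cons -IH; lia.
Qed.

Lemma num_a_descend i s : let: (k, (s0, s1)) := descend i s in
  (num_a s0 + num_a s1 = weight (fun j => j != i) s)%N.
Proof.
elim: s => [|l s IH] //=; case: (descend i s) IH => k [s0 s1].
move=> IH; rewrite weight_cons -IH.
by case: l => [|f|j]; last case: ifP => _; rewrite ?num_a_cons; lia.
Qed.

Lemma boundary_act_gen i w x : (boundary_act x (gen i w) = rho) <-> (x = rho).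
Proof.
have fix_rho : boundary_act rho (gen i w) = rho.
  apply: funext => n; rewrite /boundary_act.
  have -> : gen i w (mkseq rho n.+1) = mkseq rho n.+1; last by rewrite nth_mkseq.
  have -> : forall n, mkseq rho n = nseq n true.
    by move=> k; apply: (@eq_from_nth _ true) => [|j]; rewrite size_mkseq ?size_nseq // => jk; rewrite nth_mkseq ?nth_nseq ?jk.
  by elim: n.+1 (w) => // k IH v; rewrite -[nseq k.+1 true]/(true :: nseq k true) gen_true IH.
split=> [e|->//].
by rewrite -(boundary_act1 x) -(genK i w) boundary_actM e fix_rho.
Qed.

Lemma lampE_comm f i w :
  emul (lampE f) (letter_elt w (LetterGen i)) = emul (letter_elt w (LetterGen i)) (lampE f).
Proof.
apply: elt_eq => [|x] /=; first by rewrite mul1g mulg1.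
rewrite mul1g mulg1; congr (if _ then _ else _).
by apply/asboolP/asboolP => /boundary_act_gen.
Qed.

Lemma LetterGen_mul w i j : i != j -> exists2 k, emul (letter_elt w (LetterGen i)) (letter_elt w (LetterGen j)) =
  letter_elt w (LetterGen k) & k != i /\ k != j.
Proof.
move=> ij; have [k ki kj] : exists2 k, k != i & k != j.
  case: (digitP i) ij => ->; case: (digitP j) => -> // _;
    first [by exists digit0 | by exists digit1 | by exists digit2].
exists k => //; apply: elt_eq => [|x] /=; last by rewrite mulg1.
by apply: gen_mul => //; rewrite eq_sym.
Qed.

Lemma LetterGen_sq w i : emul (letter_elt w (LetterGen i)) (letter_elt w (LetterGen i)) = eone.
Proof. by apply: elt_eq => [|x] /=; rewrite ?genK ?mulg1. Qed.

Definition opt_letter (o : option 'I_3) : seq letter := if o is Some i then [:: LetterGen i] else [::].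

(* Letters that are not separated by [a] merge; [o] is the pending block, whose
   share [A] of the weight is only charged once an [a] closes it. *)
Lemma merge w (A : nat) (X : 'I_3 -> nat) s : triangle X ->
  exists o s', eval_elt w s = eval_elt w (opt_letter o ++ s') /\
   (weight X (opt_letter o) + weight (fun i => A + X i) s' <= A * num_a s + weight X s)%N.
Proof.
move=> /triangleP tX; elim: s => [|l s [o [s' [IHe IHw]]]].
  by exists None, [::]; rewrite /weight /= muln0.
case: l => [|f|i]; rewrite eval_elt_cons IHe.
- exists None, (LetterA :: opt_letter o ++ s'); split=> //.
  move: IHw; rewrite weight_cons num_a_cons; case: (o) => [i|] /=;
    rewrite ?weight_cons; move: (weight _ s') (weight _ s) (num_a s) => a b c; lia.
- exists o, (LetterLamp f :: s'); split; last by [].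
  by case: (o) => [i|] //=; rewrite emulA lampE_comm -emulA.
case: o IHe IHw => [j|] _ IHw; last first.
  by exists (Some i), s'; split=> //; move: IHw; rewrite /weight /num_a /=; lia.
case: (eqVneq i j) => [<-|ij].
  exists None, s'; split; first by rewrite /= emulA LetterGen_sq emul1.
  by move: IHw; rewrite /= !weight_cons num_a_cons; lia.
have [k kE [ki kj]] := LetterGen_mul w ij.
exists (Some k), s'; split; first by rewrite /= emulA kE.
move: IHw; rewrite /= !weight_cons num_a_cons.
suff : (X k <= X i + X j)%N by lia.
move: tX => [t0 t1 t2]; case: (digitP i) ij ki kj => ->; case: (digitP j) => -> //; case: (digitP k) => -> //; lia.
Qed.

(** The share of each new weight that will be charged to a letter [a]; the subtraction is exact
    under [triangle]. *)
Definition gap i (V : 'I_3 -> nat) := (V (other1 i) + V (other2 i) - V i)%N.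

(** The new weights are [A + X j] with [A] the gap, and [X j] plus the share [A] of the [a] left by
    [j] (none for [j = i]) is exactly [2 * V j]. After merging, each [a] pays the share of one
    generator; only the unclosed block of either section is unpaid, hence the error [2 * gap]. *)
Lemma descend_step w V s : triangle V -> exists k s0 s1,
  eval_elt w s = enode k (eval_elt (Defs.shift w) s0) (eval_elt (Defs.shift w) s1) /\
  (weight (vstep (w 0) V) s0 + weight (vstep (w 0) V) s1 <= 2 * weight V s + 2 * gap (w 0) V)%N.
Proof.
move=> tV; set i := w 0; pose A := gap i V; pose X := fun j => (vstep i V j - A)%N.
have [t0 t1 t2] := proj1 (triangleP V) tV.
have VE j : vstep i V j = (A + X j)%N.
  rewrite /X subnKC // /A /gap /vstep /other1 /other2.
  by case: (digitP i) => ->; case: (digitP j) => -> /=; lia.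
have tX : triangle X.
  apply/triangleP; rewrite /X /A /gap /vstep /other1 /other2.
  by case: (digitP i) => -> /=; split; lia.
have := eval_elt_descend w s; have := num_a_descend i s; have := weight_descend X i s.
rewrite -/i; case: (descend i s) => k [s0 s1] wX nA evE.
have [o0 [s0' [e0 w0]]] := merge (Defs.shift w) A s0 tX.
have [o1 [s1' [e1 w1]]] := merge (Defs.shift w) A s1 tX.
exists k, (opt_letter o0 ++ s0'), (opt_letter o1 ++ s1'); rewrite -e0 -e1; split=> //.
have wV o s' : (weight (vstep i V) (opt_letter o ++ s') <= A + (weight X (opt_letter o) + weight (fun j => A + X j) s'))%N.
  have -> t : weight (fun j => A + X j)%N t = weight (vstep i V) t.
    by elim: t => // l t IH; rewrite !weight_cons IH; case: l => // j; rewrite VE.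
  by case: o => [j|] /=; rewrite ?weight_cons ?VE; lia.
have total : (A * weight (fun j => j != i) s + weight X s = 2 * weight V s)%N.
  elim: (s) => [|l s2 IH]; first by rewrite muln0.
  rewrite !weight_cons; case: l => [|f|j]; rewrite ?add0n //.
  have : (A * (j != i) + X j = 2 * V j)%N.
    rewrite /X /A /gap /vstep /other1 /other2.
    by case: (digitP i) => ->; case: (digitP j) => -> /=; lia.
  by rewrite !mulnDr; lia.
have := wV o0 s0'; have := wV o1 s1'; move: nA wX w0 w1 total => nA wX.
rewrite -nA -wX -/A => w0 w1.
by rewrite mulnDr; lia.
Qed.

(** Between two generators, the letters [a] and the lamps produce one of [2 #|F|^2] elements: a
    permutation and lamps at [rho] and at its image under [a]. A token holds this element and the
    next generator, or [None] at the end of a leaf. *)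
Let token : finType := ((F * F * bool) * option 'I_3)%type.

Definition head_elt (p : F * F * bool) : tree_elt := enode p.2 (lampE p.1.1) (lampE p.1.2).

Fixpoint decode_leaf w (t : seq token) : tree_elt * seq token :=
  match t with
  | [::] => (eone, [::])
  | (p, None) :: t' => (head_elt p, t')
  | (p, Some i) :: t' =>
    let: (e, r) := decode_leaf w t' in (emul (head_elt p) (emul (letter_elt w (LetterGen i)) e), r)
  end.

Lemma head_LetterA w p : exists q, head_elt q = emul (letter_elt w LetterA) (head_elt p).
Proof.
case: p => [[f0 f1] k]; exists (f1, f0, ~~ k).
by rewrite LetterA_node /head_elt enodeM !emul1.
Qed.

Lemma head_LetterLamp w f p : exists q, head_elt q = emul (letter_elt w (LetterLamp f)) (head_elt p).
Proof.
case: p => [[f0 f1] k]; exists (f0, f * f1, k).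
by rewrite /head_elt [letter_elt _ _]lampE_node enodeM /= emul1 lampEM.
Qed.

(** The first token is split off because an [a] or a lamp put in front is absorbed into its head;
    only generators cost new tokens. *)
Lemma decode_leaf_code w s : exists p t, size t = weight (fun=> 1%N) s /\
  exists o, forall r, decode_leaf w (((p, o) : token) :: t ++ r) = (eval_elt w s, r).
Proof.
elim: s => [|l s [p [t [st [o H]]]]].
  exists (1, 1, false), [::]; split=> //; exists None => r.
  by rewrite /= /head_elt /= lampE1 enode1.
have ins l' q : head_elt q = emul (letter_elt w l') (head_elt p) ->
    forall r, decode_leaf w (((q, o) : token) :: t ++ r) = (eval_elt w (l' :: s), r).
  move=> qE r; have := H r; rewrite eval_elt_cons /=; case: (o) => [i|].
    by case: decode_leaf => e r' [<- ->]; rewrite qE !emulA.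
  by move=> [<- ->]; rewrite qE.
case: l => [|f|i].
- by have [q qE] := head_LetterA w p; exists q, t; split=> //; exists o; exact: ins.
- by have [q qE] := head_LetterLamp w f p; exists q, t; split=> //; exists o; exact: ins.
exists (1, 1, false), (((p, o) : token) :: t); split; first by rewrite weight_cons /= st.
exists (Some i) => r; have := H r; rewrite cat_cons eval_elt_cons.
move: ((_, o) :: _) => t'; rewrite /= => ->.
by rewrite /head_elt /= lampE1 enode1 emul1.
Qed.

(* An element is encoded by its letters at level [k] and its permutations at
   the vertices above that level. *)
Fixpoint decode (k : nat) w (t : seq token) : tree_elt * seq token :=
  if k is k'.+1 then
    if t is (p, _) :: t' then
      let: (e0, r0) := decode k' (Defs.shift w) t' in
      let: (e1, r1) := decode k' (Defs.shift w) r0 in (enode p.2 e0 e1, r1)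
    else (eone, [::])
  else decode_leaf w t.

(** One token per vertex of level at most [k] comes on top of the [n] generators. The gaps of
    successive levels telescope, since [vsum V + gap] is at most the next [vsum]. *)
Lemma decode_code k w V s mu : triangle V -> (forall i, mu <= vseq V w k i)%N ->
  exists n t, [/\ size t = (n + (2 ^ k.+1).-1)%N,
    forall r, decode k w (t ++ r) = (eval_elt w s, r) &
    (n * mu + 2 ^ k * vsum V <= 2 ^ k * (weight V s + vsum (vseq V w k)))%N].
Proof.
elim: k w V s => [|k IH] w V s tV muP.
  have [p [t [st [o H]]]] := decode_leaf_code w s.
  exists (size t), ((p, o) :: t); split; [by rewrite addn1|exact: H|].
  rewrite !mul1n leq_add2r st; elim: (s) => // l s' IH; rewrite !weight_cons mulnDl.
  by case: l => [|f|i]; rewrite leq_add // ?mul1n.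
have [d [s0 [s1 [evE wt]]]] := descend_step w s tV.
have tV' := triangle_step (w 0) tV.
have [n0 [t0 [st0 H0 b0]]] := IH _ _ s0 tV' muP.
have [n1' [t1 [st1 H1 b1]]] := IH _ _ s1 tV' muP.
exists (n0 + n1')%N, (((1, 1, d), None) :: t0 ++ t1); split.
- have p0 : (0 < 2 ^ k.+1)%N by rewrite expn_gt0.
  by rewrite /= size_cat st0 st1 [(2 ^ k.+2)%N]expnS; lia.
- by move=> r; rewrite /= -catA H0 H1 evE.
have gapP : (vsum V + gap (w 0) V <= vsum (vstep (w 0) V))%N.
  have [c0 c1 c2] := proj1 (triangleP V) tV.
  by rewrite /vsum /gap /vstep /other1 /other2; case: (digitP (w 0)) => -> /=; lia.
rewrite /= in b0 b1 *; rewrite expnS; move: wt gapP b0 b1.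
move: (weight _ s0) (weight _ s1) (weight _ s) (vsum (vseq _ _ _)) (vsum V) (vsum _) (gap _ _) (2 ^ k)%N.
move=> x0 x1 x S v v' g P wt gP b0 b1.
have := leq_mul (leqnn P) wt; have := leq_mul (leqnn P) gP.
clear -b0 b1; nia.
Qed.

Section Embedding.
Variable w : omega_seq.

Definition embed (y : Gamma F w) : tree_elt := (val (wr_grp y),
  fun x => if pselect (x \in X_omega w) is left p then wr_fun y (SigSub p) else 1).

Lemma embed_inj : injective embed.
Proof.
move=> y z [e1 e2]; apply: wreath_eq; last exact: val_inj.
move=> [x xX]; have := congr1 (fun f => f x) e2.
by rewrite /=; case: pselect => // p; rewrite (Prop_irrelevance p xX).
Qed.

Lemma embed1 : embed 1 = eone.
Proof. by apply: elt_eq => //= x; case: pselect. Qed.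

Lemma embedM y z : embed (y * z) = emul (embed y) (embed z).
Proof.
apply: elt_eq => //= x; case: pselect => p; case: pselect => q /=.
- by congr (_ * wr_fun z _); exact: val_inj.
- by case: q; exact: (orbit_act_subproof (SigSub p) (wr_grp y)).
- case: p; have := orbit_act_subproof (SigSub q) (wr_grp y)^-1.
  by rewrite /= -boundary_actM mulgV boundary_act1.
- by rewrite mulg1.
Qed.

Lemma embed_lamp f v : embed (lamp f v) = emul (lampE f) (val v, fun=> 1).
Proof.
apply: elt_eq => [|x] /=; first by rewrite mul1g.
rewrite mulg1; case: pselect => p /=.
  rewrite /lamp_fun; have -> // : (SigSub p == rhoX w) = `[< x = rho >].
  by apply/eqP/asboolP => [/(congr1 val)|] // xr; exact: val_inj.
by case: asboolP => // xr; case: p; rewrite xr; exact: rho_in_orbit.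
Qed.

(** The word [s'] for the inverse also has weight at most 1, so inverses in [word_ball] cost no more
    than generators. *)
Lemma embed_gen y : Gamma_gens y ->
  exists s s', [/\ embed y = eval_elt w s, emul (eval_elt w s) (eval_elt w s') = eone,
    (weight unit_weights s <= 1)%N & (weight unit_weights s' <= 1)%N].
Proof.
have aa : emul (letter_elt w LetterA) (letter_elt w LetterA) = eone.
  by rewrite LetterA_node enodeM !emul1 enode1.
case=> [->|[f _] [v] vP <-].
  exists [:: LetterA], [:: LetterA]; split=> //=; last by rewrite !emule1.
  by rewrite embed_lamp lampE1 emul1 emule1.
have lfV : emul (lampE f) (lampE f^-1) = eone by rewrite lampEM mulgV lampE1.
have [o vE] : exists o, (val v, fun=> 1) = eval_elt w (opt_letter o).
  case: vP => [[[->|->]|->]|->]; [by exists None|exists (Some digit2)|exists (Some digit1)|exists (Some digit0)];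
  by rewrite /= emule1.
exists (LetterLamp f :: opt_letter o), (opt_letter o ++ [:: LetterLamp f^-1]); split.
- by rewrite embed_lamp vE.
- rewrite eval_elt_cons eval_elt_cat /= emule1 -!emulA (emulA (eval_elt w (opt_letter o))).
  by case: (o) => [i|] /=; rewrite ?emule1 ?LetterGen_sq ?emul1 lfV.
- by case: (o).
- by case: (o).
Qed.

Lemma embed_ball n y : word_ball (@Gamma_gens F w) n y ->
  exists2 s, embed y = eval_elt w s & (weight unit_weights s <= n)%N.
Proof.
move=> [us [usn usG ->]].
suff [s sE sw] : exists2 s, embed (\prod_(x <- us) x) = eval_elt w s & (weight unit_weights s <= size us)%N.
  by exists s => //; exact: leq_trans usn.
elim: us {usn} usG => [|u us IH] usG; first by exists [::]; rewrite ?big_nil ?embed1.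
have [|s sE sw] := IH; first by move=> x xs; apply: usG; rewrite inE xs orbT.
have [t tE tw] : exists2 t, embed u = eval_elt w t & (weight unit_weights t <= 1)%N.
  case: (usG u (mem_head _ _)) => /embed_gen [t [t' [tE tt' tw tw']]]; first by exists t.
  exists t' => //; have := congr1 embed (mulgV u); rewrite embedM embed1 tE => e.
  by rewrite -(emule1 (embed u)) -tt' emulA e emul1.
exists (t ++ s); first by rewrite big_cons embedM tE sE eval_elt_cat.
by rewrite /weight map_cat sumn_cat -/(weight unit_weights t) -/(weight unit_weights s) -[size _]add1n leq_add.
Qed.

Theorem growth_upper k n mu : (0 < mu)%N -> (forall i, mu <= vseq unit_weights w k i)%N ->
  (Gamma_growth F w n <=
   (8 * #|F| ^ 2) ^ ((2 ^ k * (n + vsum (vseq unit_weights w k))) %/ mu + (2 ^ k.+1).-1))%N.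
Proof.
move=> mu0 muP; set M := (_ + _)%N.
have ball_code (y : Gamma F w) : word_ball (@Gamma_gens F w) n y ->
    exists t : M.-tuple token, (decode k w t).1 = embed y.
  move=> /embed_ball[s sE sw].
  have [n' [t [st tE tb]]] := decode_code s triangle_unit muP.
  have sM : (size t <= M)%N.
    rewrite st leq_add2r leq_divRL //; apply: leq_trans (leq_addr _ _) (leq_trans tb _).
    by rewrite leq_mul2l leq_add2r sw orbT.
  (* Padding to the common length [M] is harmless, as decoding returns the surplus tokens
     untouched. *)
  have sz : size (t ++ nseq (M - size t) ((1, 1, false), None)) == M.
    by rewrite size_cat size_nseq subnKC.
  by exists (Tuple sz); rewrite /= tE sE.
have card_token : #|{: M.-tuple token}| = ((8 * #|F| ^ 2) ^ M)%N.
  rewrite card_tuple !card_prod card_bool card_option card_ord; congr (_ ^ _)%N.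
  by move: #|F| => c; lia.
rewrite -card_token /Gamma_growth /growth.
set BB := fset_set _.
have inB y : y \in BB -> word_ball (@Gamma_gens F w) n y.
  rewrite in_fset_set ?inE //; exact: finite_word_ball (finite_Gamma_gens F w).
have [code codeP] : exists code : Gamma F w -> M.-tuple token,
    forall y, y \in BB -> (decode k w (code y)).1 = embed y.
  have H y : exists t : M.-tuple token, y \in BB -> (decode k w t).1 = embed y.
    case: (boolP (y \in BB)) => [/inB /ball_code [t tE]|_]; first by exists t.
    by exists [tuple of nseq M ((1, 1, false), None)].
  by exists (fun y => projT1 (cid (H y))) => y; exact: (projT2 (cid (H y))).
have uni : uniq (map code BB).
  rewrite map_inj_in_uniq ?fset_uniq // => y z yB zB e.
  by apply: embed_inj; rewrite -codeP // e codeP.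
rewrite -(size_map code) cardE; apply: uniq_leq_size => // t _.
by rewrite mem_enum.
Qed.

End Embedding.
End Upper.

(** * A sequence whose weights track a given function *)

Local Open Scope ring_scope.

Section Thermostat.
Variables (R : realFieldType) (eta : R) (g : nat -> R).
Hypothesis eta_gt0 : 0 < eta.
Hypothesis eta_lt1 : eta < 1.
Hypothesis eta_root : eta ^+ 3 + eta ^+ 2 + eta = 2%:R.
Hypothesis g0 : g 0%N = 1.
Hypothesis g_lower : forall k, 2%:R * g k <= g k.+1.
Hypothesis g_upper : forall k, eta * g k.+1 <= 2%:R * g k.

(* The sequence is a concatenation of blocks 012 and of letters 2; the second
   component of the state is the position in the current block, and a block 012
   is started exactly when the weight is below its target [g k]. *)
Definition thermo_state := (('I_3 -> nat) * nat)%type.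

Definition thermo_out k (s : thermo_state) : 'I_3 :=
  match s.2 with
  | 0%N => if g k <= (vsum s.1)%:R then digit2 else digit0
  | 1%N => digit1
  | _ => digit2
  end.

Definition thermo_phase k (s : thermo_state) : nat :=
  match s.2 with
  | 0%N => if g k <= (vsum s.1)%:R then 0%N else 1%N
  | 1%N => 2%N
  | _ => 0%N
  end.

Fixpoint thermo_run k : thermo_state :=
  if k is k'.+1 then (vstep (thermo_out k' (thermo_run k')) (thermo_run k').1, thermo_phase k' (thermo_run k'))
  else (unit_weights, 0%N).

Definition thermo_omega : omega_seq := fun k => thermo_out k (thermo_run k).

Lemma vseq_thermo_omega k : vseq unit_weights thermo_omega k = (thermo_run k).1.
Proof. by elim: k => // k IH; rewrite vseqS IH. Qed.

(** These inequalities are preserved by a letter 2 and by a whole block 012, and make all weights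
    comparable with [V digit0 + V digit1]. *)
Definition balanced (V : 'I_3 -> nat) :=
  [/\ triangle V, (V digit0 <= V digit1 <= 2 * V digit0)%N & (V digit0 <= V digit2)%N].

(* The linear form [potential] is multiplied by [(2 / eta) ^ 3] along a block
   012, and [V digit0 + V digit1] is doubled along a letter 2. *)
Definition potential (V : 'I_3 -> nat) : R :=
  eta * (V digit0)%:R + (eta ^+ 2 + eta) * (V digit1)%:R + 2%:R * (V digit2)%:R.

Definition tracking (x : R) (V : 'I_3 -> nat) :=
  [/\ balanced V, (V digit0 + V digit1)%:R <= 27%:R * x & eta ^+ 2 * x <= potential V].

Definition thermo_inv k (s : thermo_state) : Prop :=
  match s.2 with
  | 0%N => tracking (g k) s.1
  | 1%N => exists k' V, [/\ k = k'.+1, s.1 = vstep digit0 V, tracking (g k') V & (vsum V)%:R < g k']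
  | 2%N => exists k' V, [/\ k = k'.+2, s.1 = vstep digit1 (vstep digit0 V), tracking (g k') V & (vsum V)%:R < g k']
  | _ => False
  end.

Lemma g_gt0 k : 0 < g k.
Proof.
by elim: k => [|k IH]; [rewrite g0 | apply: lt_le_trans (g_lower k); rewrite mulr_gt0].
Qed.

Lemma balanced_two V : balanced V -> balanced (vstep digit2 V).
Proof.
move=> [tV /andP[le1 le2] le3]; split; first exact: triangle_step.
  by rewrite /vstep /=; lia.
by have [t0 t1 t2] := proj1 (triangleP V) tV; rewrite /vstep /=; lia.
Qed.

Lemma balanced_block V : balanced V -> balanced (vstep digit2 (vstep digit1 (vstep digit0 V))).
Proof.
move=> [tV /andP[le1 le2] le3]; split; first by do 3!apply: triangle_step.
  by have [t0 t1 t2] := proj1 (triangleP V) tV; rewrite /vstep /=; lia.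
by have [t0 t1 t2] := proj1 (triangleP V) tV; rewrite /vstep /=; lia.
Qed.

Lemma potential_block V :
  eta ^+ 3 * potential (vstep digit2 (vstep digit1 (vstep digit0 V))) = 8%:R * potential V.
Proof.
rewrite /potential /vstep /= !(natrD, natrM).
move: (V digit0)%:R (V digit1)%:R (V digit2)%:R => d c b.
apply/eqP; rewrite -subr_eq0; apply/eqP.
(* The difference is a multiple of the cubic that vanishes at [eta]. *)
transitivity ((eta ^+ 3 + eta ^+ 2 + eta - 2%:R) * (d * (2%:R * eta ^+ 2 + 4%:R * eta) +
  c * (6%:R * eta ^+ 2 + 4%:R * eta) + b * (6%:R * eta ^+ 2 + 4%:R * eta + 8%:R))).
  by ring.
by rewrite eta_root subrr mul0r.
Qed.

Lemma vsum_potential V : eta * (vsum V)%:R <= potential V <= 2%:R * (vsum V)%:R.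
Proof.
rewrite /potential /vsum !natrD.
have := ler0n R (V digit0); have := ler0n R (V digit1); have := ler0n R (V digit2).
move: (V digit0)%:R (V digit1)%:R (V digit2)%:R => d c b b0 c0 d0.
have e2 : 0 < eta ^+ 2 by rewrite exprn_gt0.
have e21 : eta ^+ 2 < 1 by rewrite expr_lt1 // ltW.
have h1 := mulr_ge0 (ltW e2) c0.
have h2 : eta * b <= 1 * b by rewrite ler_wpM2r // ltW.
have h3 : eta * d <= 1 * d by rewrite ler_wpM2r // ltW.
have h4 : eta * c <= 1 * c by rewrite ler_wpM2r // ltW.
have h5 : eta ^+ 2 * c <= 1 * c by rewrite ler_wpM2r // ltW.
by apply/andP; split; lra.
Qed.

Lemma g_le k : g k <= g k.+1.
Proof. by have := g_lower k; have := g_gt0 k; lra. Qed.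

(** Upper bound: a letter 2 doubles [V digit0 + V digit1] while the target at least doubles; a block
    starts below the target and multiplies [vsum] by at most [3 ^ 3 = 27]. Lower bound: a letter 2
    occurs only above the target, and over a block [potential] gains [(2 / eta) ^ 3], at least as
    much as the target. *)
Lemma thermo_inv_step k s : thermo_inv k s -> thermo_inv k.+1 (vstep (thermo_out k s) s.1, thermo_phase k s).
Proof.
case: s => V [|[|[|//]]]; rewrite /thermo_inv /thermo_out /thermo_phase /=.
- move=> tr; have [bV QV JV] := tr; case: (lerP (g k) (vsum V)%:R) => gV; last first.
    by exists k, V.
  split; first exact: balanced_two.
    rewrite /vstep /= -mulnDr natrM; have := g_lower k; lra.
  have /andP[pl _] := vsum_potential (vstep digit2 V).
  have /andP[sl _] := vsum_step digit2 (let: And3 t _ _ := bV in t).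
  have : (2 * vsum V)%:R <= (vsum (vstep digit2 V))%:R :> R by rewrite ler_nat.
  rewrite natrM => sl'; have := g_upper k.
  move: pl sl' gV; move: (vsum _)%:R (vsum _)%:R (potential _) (g k) (g k.+1) => a b p x y pl sl' gV xy.
  apply: le_trans pl; rewrite expr2 -mulrA ler_wpM2l ?(ltW eta_gt0) //; lra.
- by move=> [k' [V' [-> -> tr lt]]]; exists k', V'.
move=> [k' [V' [-> -> [bV QV JV] lt]]]; split; first exact: balanced_block.
  have [tV _ _] := bV.
  have s3 : (vsum (vstep digit2 (vstep digit1 (vstep digit0 V'))) <= 27 * vsum V')%N.
    have /andP[_ s1] := vsum_step digit0 tV.
    have /andP[_ s2] := vsum_step digit1 (triangle_step digit0 tV).
    have /andP[_ s3] := vsum_step digit2 (triangle_step digit1 (triangle_step digit0 tV)).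
    lia.
  apply: (@le_trans _ _ (27 * vsum V')%:R).
    by rewrite ler_nat; apply: leq_trans s3; rewrite /vsum leq_addr.
  rewrite natrM; have := g_le k'; have := g_le k'.+1; have := g_le k'.+2; lra.
have e3 : 0 < eta ^+ 3 by rewrite exprn_gt0.
rewrite -(ler_pM2l e3) potential_block.
have g3 : eta ^+ 3 * g k'.+3 <= 8%:R * g k'.
  have u1 := g_upper k'.
  have u2 := ler_wpM2l (ltW eta_gt0) (g_upper k'.+1).
  have u3 := ler_wpM2l (ltW eta_gt0) (ler_wpM2l (ltW eta_gt0) (g_upper k'.+2)).
  rewrite (_ : eta ^+ 3 * _ = eta * (eta * (eta * g k'.+3))); last by ring.
  by lra.
have e2 : 0 < eta ^+ 2 by rewrite exprn_gt0.
rewrite mulrCA; apply: le_trans (ler_wpM2l (ltW e2) g3) _.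
by rewrite mulrCA ler_wpM2l.
Qed.

Lemma thermo_inv_run k : thermo_inv k (thermo_run k).
Proof.
elim: k => [|k IH]; last exact: thermo_inv_step.
rewrite /thermo_inv /=; split=> //.
  by rewrite g0 /unit_weights /=; lra.
rewrite g0 /potential /unit_weights /= !mulr1; move: (exprn_gt0 2 eta_gt0) eta_gt0.
by set x := eta ^+ 2; set y := eta; move: x y => x y x0 y0; lra.
Qed.

Lemma tracking_bounds x V : 0 < x -> tracking x V ->
  eta ^+ 2 / 2%:R * x <= (vsum V)%:R <= 54%:R * x /\ forall i, (vsum V <= 6 * V i)%N.
Proof.
move=> x0 [[tV /andP[le1 le2] le3] QV JV]; have [t0 t1 t2] := proj1 (triangleP V) tV.
split; last by move=> i; rewrite /vsum; case: (digitP i) => ->; lia.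
have /andP[_ pu] := vsum_potential V.
apply/andP; split; first by lra.
apply: (@le_trans _ _ (2 * (V digit0 + V digit1))%:R); first by rewrite ler_nat /vsum; lia.
by rewrite natrM; lra.
Qed.

(** At most two steps have passed since the block began; each multiplies [vsum] by 2 to 3 and the
    target by at most [2 / eta]. This turns [eta ^ 2] into [eta ^ 4]; 54 is [2 * 27] for the upper
    bound and [6 * 9] for the weights. *)
Lemma thermo_inv_bounds k s : thermo_inv k s ->
  eta ^+ 4 / 2%:R * g k <= (vsum s.1)%:R <= 54%:R * g k /\ forall i, (vsum s.1 <= 54 * s.1 i)%N.
Proof.
have e0 := ltW eta_gt0; have e1 := ltW eta_lt1.
case: s => V [|[|[|//]]]; rewrite /thermo_inv /=.
- move=> tr; have gk := g_gt0 k; have [/andP[l u] m] := tracking_bounds gk tr.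
  split; last by move=> i; have := m i; lia.
  apply/andP; split=> //; apply: le_trans l; rewrite ler_pM2r // ler_pM2r ?invr_gt0 //.
  by rewrite ler_wiXn2l.
- move=> [k' [V' [-> -> tr lt]]].
  have gk := g_gt0 k'; have [/andP[l u] m] := tracking_bounds gk tr; have [[tV _ _] _ _] := tr.
  have /andP[s1 s2] := vsum_step digit0 tV.
  split; last by move=> i; have := m i; have := vstep_ge2 digit0 i tV; lia.
  have s1' : (2 * vsum V')%:R <= (vsum (vstep digit0 V'))%:R :> R by rewrite ler_nat.
  have s2' : (vsum (vstep digit0 V'))%:R <= (3 * vsum V')%:R :> R by rewrite ler_nat.
  rewrite !natrM in s1' s2'.
  have gu := ler_wpM2l (exprn_ge0 3 e0) (g_upper k').
  have gl := g_le k'.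
  have e32 : eta ^+ 3 * g k' <= eta ^+ 2 * g k' by rewrite ler_pM2r // ler_wiXn2l.
  apply/andP; split; last by lra.
  rewrite (_ : eta ^+ 4 = eta ^+ 3 * eta) ?exprSr // -mulrA; by lra.
move=> [k' [V' [-> -> tr lt]]].
have gk := g_gt0 k'; have [/andP[l u] m] := tracking_bounds gk tr; have [[tV _ _] _ _] := tr.
have tV1 := triangle_step digit0 tV.
have /andP[s1 s2] := vsum_step digit0 tV; have /andP[s3 s4] := vsum_step digit1 tV1.
split.
  have s1' : (4 * vsum V')%:R <= (vsum (vstep digit1 (vstep digit0 V')))%:R :> R by rewrite ler_nat; lia.
  have s2' : (vsum (vstep digit1 (vstep digit0 V')))%:R <= (9 * vsum V')%:R :> R by rewrite ler_nat; lia.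
  rewrite !natrM in s1' s2'.
  have gu1 := ler_wpM2l (exprn_ge0 2 e0) (g_upper k').
  have gu2 := ler_wpM2l (exprn_ge0 3 e0) (g_upper k'.+1).
  have gl1 := g_le k'; have gl2 := g_le k'.+1.
  have e32 : eta ^+ 3 * g k'.+1 <= eta ^+ 2 * (eta * g k'.+1) by rewrite exprSr mulrA.
  apply/andP; split; last by lra.
  rewrite (_ : eta ^+ 4 = eta ^+ 3 * eta) ?exprSr //; by lra.
move=> i; have := m i; have := vstep_ge2 digit0 i tV; have := vstep_ge2 digit1 i tV1; lia.
Qed.

Theorem thermo_omega_tracks k :
  eta ^+ 4 / 2%:R * g k <= (vsum (vseq unit_weights thermo_omega k))%:R <= 54%:R * g k /\
  forall i, (vsum (vseq unit_weights thermo_omega k) <= 54 * vseq unit_weights thermo_omega k i)%N.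
Proof. by rewrite vseq_thermo_omega; exact: thermo_inv_bounds (thermo_inv_run k). Qed.

Lemma thermo_omega_no_adjacent k : thermo_omega k = digit1 -> thermo_omega k.+1 != digit1.
Proof.
rewrite /thermo_omega /= /thermo_out /thermo_phase; case: (thermo_run k) => V [|[|[|n]]] //=; case: ifP => //.
Qed.

(** Without further letters 1 no block starts, and under letters 2 alone [vsum] stays of order
    [2 ^ k]. A target that outgrows every multiple of [2 ^ k] then exceeds it and forces a block. *)
Lemma thermo_omega_digit1 n : (forall M m, exists2 k, (m <= k)%N & M * 2%:R ^+ k < g k) ->
  exists2 l, (n <= l)%N & thermo_omega l = digit1.
Proof.
move=> unb; apply: contrapT => no.
have ph1 k : (n <= k)%N -> (thermo_run k).2 <> 1%N.
  by move=> nk p1; apply: no; exists k => //; rewrite /thermo_omega /thermo_out p1.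
have ph k : (thermo_run k).2 = 0%N \/ (thermo_run k).2 = 1%N \/ (thermo_run k).2 = 2%N.
  by have := thermo_inv_run k; rewrite /thermo_inv; case: (thermo_run k) => V [|[|[|//]]]; auto.
have [m nm pm] : exists2 m, (n <= m)%N & (thermo_run m).2 = 0%N.
  case: (ph n) => [p0|[p1|p2]]; [by exists n|by case: (ph1 n (leqnn n))|].
  by exists n.+1 => //; rewrite /= /thermo_phase p2.
have run j : (thermo_run (m + j)).2 = 0%N /\
    ((thermo_run (m + j)).1 digit0 + (thermo_run (m + j)).1 digit1 = 2 ^ j * ((thermo_run m).1 digit0 + (thermo_run m).1 digit1))%N.
  elim: j => [|j [p0 QE]]; first by rewrite addn0 mul1n.
  have := ph1 (m + j).+1 (leq_trans nm (leqW (leq_addr _ _))).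
  rewrite addnS /= /thermo_phase /thermo_out p0; case: ifP => // _ _; split=> //.
  by rewrite /vstep /= -mulnDr QE expnS mulnA.
have [k mk] := unb (2 * ((thermo_run m).1 digit0 + (thermo_run m).1 digit1))%:R m.
have := thermo_inv_run k.+1; have := ph1 k.+1 (leq_trans nm (leqW mk)).
have [p0 QE] := run (k - m)%N; rewrite subnKC // in p0 QE.
rewrite /= /thermo_phase p0; case: (lerP (g k) (vsum (thermo_run k).1)%:R) => // gS _ _ lt.
have := thermo_inv_run k; rewrite /thermo_inv p0 => -[[tV _ _] _ _].
have [t0 t1 t2] := proj1 (triangleP _) tV.
have : (vsum (thermo_run k).1 <= 2 * ((thermo_run m).1 digit0 + (thermo_run m).1 digit1) * 2 ^ k)%N.
  apply: (@leq_trans (2 * ((thermo_run k).1 digit0 + (thermo_run k).1 digit1))); first by rewrite /vsum; lia.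
  rewrite QE mulnCA mulnC leq_mul2l leq_exp2l // leq_subr orbT //.
rewrite -(ler_nat R) natrM natrX => le.
by have := lt_le_trans lt (le_trans gS le); rewrite ltxx.
Qed.

End Thermostat.

(** * Oscillating targets *)

Local Open Scope classical_set_scope.
Section LimSup.
Variable R : realType.
Implicit Types (u : nat -> R) (l : R).

Lemma limn_esup_eq u l :
  (forall e, 0 < e -> exists N, forall n, (N <= n)%N -> u n <= l + e) ->
  (forall e, 0 < e -> forall N, exists2 n, (N <= n)%N & l - e <= u n) ->
  limn_esup (fun n => (u n)%:E) = l%:E.
Proof.
move=> up low; rewrite limn_esup_lim.
rewrite (cvg_lim _ (@cvg_esups_inf R (fun n => (u n)%:E))) //.
apply/le_anti/andP; split.
  apply/lee_addgt0Pr => e e0; have [N uN] := up e e0.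
  apply: (@le_trans _ _ (esups (fun n => (u n)%:E) N)).
    by apply: ereal_inf_lbound; exists N.
  by apply: ge_ereal_sup => _ [n /= Nn <-]; rewrite -EFinD lee_fin uN.
apply: le_ereal_inf_tmp => _ [N _ <-]; apply/lee_subgt0Pr => e e0.
have [n Nn un] := low e e0 N.
apply: (@le_trans _ _ (u n)%:E); first by rewrite -EFinB lee_fin.
by apply: ereal_sup_ubound; exists n.
Qed.

Lemma limn_einf_eq u l :
  (forall e, 0 < e -> exists N, forall n, (N <= n)%N -> l - e <= u n) ->
  (forall e, 0 < e -> forall N, exists2 n, (N <= n)%N & u n <= l + e) ->
  limn_einf (fun n => (u n)%:E) = l%:E.
Proof.
move=> low up; rewrite /limn_einf.
have -> : (\- (fun n => (u n)%:E))%E = (fun n => (- u n)%:E) by apply: funext => n.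
rewrite (@limn_esup_eq _ (- l)) ?oppeK ?EFinN ?oppeK // => e e0.
  have [N H] := low e e0; exists N => n Nn; have := H n Nn; lra.
by move=> N; have [n Nn H] := up e e0 N; exists n => //; lra.
Qed.
End LimSup.

(** Each window ends at the square of its start, so all that precedes it is negligible at its end;
    [quad_large] makes this quantitative. *)
Definition tower (i : nat) : nat := (2 ^ 2 ^ i)%N.

Lemma towerS i : tower i.+1 = (tower i * tower i)%N.
Proof. by rewrite /tower -expnD addnn -mul2n -expnS. Qed.

Lemma tower_gt i : (i < tower i)%N.
Proof. by apply: ltn_trans (ltn_expl _ _) (ltn_expl _ _). Qed.

Definition tower_index k := trunc_log 2 (trunc_log 2 k).

Lemma tower_indexE i k : (tower i <= k < tower i.+1)%N -> tower_index k = i.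
Proof.
move=> /andP[ik ki]; have k0 : (0 < k)%N by apply: leq_trans ik; rewrite expn_gt0.
have /andP[b1 b2] := trunc_log_bounds (ltnSn 1) k0.
apply: trunc_log_eq => //; apply/andP; split.
  by rewrite -ltnS -(ltn_exp2l _ _ (ltnSn 1)); exact: leq_ltn_trans ik b2.
by rewrite -(ltn_exp2l _ _ (ltnSn 1)); exact: leq_ltn_trans b1 ki.
Qed.

Section Target.
Variables (R : realType) (alpha beta : R) (A : pred nat).
Hypothesis alpha_gt0 : 0 < alpha.
Hypothesis alpha_lt : alpha < beta.

Let beta_gt0 : 0 < beta. Proof. exact: lt_trans alpha_lt. Qed.

Definition slope k : R := if A (tower_index k) then alpha^-1 else beta^-1.
Definition target k : R := \sum_(j < k) slope j.

Lemma targetS k : target k.+1 = target k + slope k.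
Proof. by rewrite /target big_ord_recr. Qed.

Lemma slope_bounds k : beta^-1 <= slope k <= alpha^-1.
Proof.
have le : beta^-1 <= alpha^-1 by rewrite lef_pV2 // ?posrE // ltW.
by rewrite /slope; case: ifP => _; rewrite ?lexx ?le.
Qed.

Lemma target_bounds k : k%:R / beta <= target k <= k%:R / alpha.
Proof.
elim: k => [|k /andP[l u]]; first by rewrite /target big_ord0 !mul0r lexx.
have /andP[sl su] := slope_bounds k.
by rewrite targetS -natr1 !mulrDl !mul1r !lerD.
Qed.

Lemma target_high i k : A i -> (k <= tower i.+1)%N ->
  (k%:R - (tower i)%:R) / alpha <= target k.
Proof.
have ai : 0 < alpha^-1 by rewrite invr_gt0.
move=> iA; elim: k => [|k IH] ki.
  rewrite /target big_ord0 sub0r mulNr oppr_le0; apply: mulr_ge0; first exact: ler0n.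
  exact: ltW.
case: (ltnP k (tower i)) => ik.
  apply: (@le_trans _ _ 0).
    by rewrite pmulr_lle0 // subr_le0 ler_nat.
  have /andP[+ _] := target_bounds k.+1; apply: le_trans.
  by rewrite divr_ge0 ?ler0n ?ltW.
rewrite targetS /slope (@tower_indexE i) ?ik // iA.
by rewrite -natr1 addrAC mulrDl mul1r lerD2r IH // ltnW.
Qed.

Lemma target_low i k : ~~ A i -> (k <= tower i.+1)%N ->
  target k <= (tower i)%:R / alpha + k%:R / beta.
Proof.
have ai : 0 < alpha^-1 by rewrite invr_gt0.
have bi : 0 < beta^-1 by rewrite invr_gt0.
move=> iA; elim: k => [|k IH] ki.
  by rewrite /target big_ord0 mul0r addr0 mulr_ge0 ?ler0n ?ltW.
case: (ltnP k (tower i)) => ik.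
  have /andP[_ +] := target_bounds k.+1; move/le_trans; apply.
  rewrite -[leLHS]addr0 lerD //; first by rewrite ler_pM2r // ler_nat.
  by rewrite mulr_ge0 ?ler0n ?ltW.
rewrite targetS /slope (@tower_indexE i) ?ik // (negbTE iA).
by rewrite -natr1 mulrDl mul1r addrA lerD2r IH // ltnW.
Qed.
End Target.

(** * Iterated logarithm of the growth *)

Section Growth.
Variables (R : realType) (F : finGroupType) (eta : R).
Hypothesis eta_gt0 : 0 < eta.
Hypothesis eta_lt1 : eta < 1.
Hypothesis eta_eq : eta ^+ 3 + eta ^+ 2 + eta = 2%:R.

Let lg2 : R := ln 2%:R.

Lemma lg2_gt0 : 0 < lg2. Proof. by rewrite ln_gt0 // ltr1n. Qed.

Lemma nat_large (x : R) : exists N, forall n, (N <= n)%N -> x <= n%:R.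
Proof.
exists (Num.bound `|x|) => n Nn; apply: le_trans (ler_norm x) _.
apply: le_trans (ltW (archi_boundP (normr_ge0 x))) _; by rewrite ler_nat.
Qed.

Lemma ln_natX a n : (0 < a)%N -> ln ((a ^ n)%:R : R) = n%:R * ln a%:R.
Proof. by move=> a0; rewrite natrX lnXn ?ltr0n // mulr_natl. Qed.

Lemma quad_large (a b c : R) : 0 < a ->
  exists N, forall q, (N <= q)%N -> b * q%:R + c <= a * (q%:R * q%:R).
Proof.
move=> a0; have [N NP] := nat_large ((`|b| + `|c|) / a); exists N.+1 => q Nq.
have := NP q (ltnW Nq); rewrite ler_pdivrMr // => h.
have q1 : 1 <= q%:R :> R by rewrite ler1n; apply: leq_trans Nq.
have h1 : b * q%:R <= `|b| * q%:R by rewrite ler_wpM2r ?ler0n // ler_norm.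
have h2 : c <= `|c| * q%:R.
  by apply: le_trans (ler_norm c) _; rewrite ler_peMr.
apply: (@le_trans _ _ ((`|b| + `|c|) * q%:R)); first by rewrite mulrDl lerD.
by apply: le_trans (ler_wpM2r (ler0n _ q) h) _; rewrite mulrAC [leRHS]mulrC.
Qed.

Lemma growth_mono w : {homo Gamma_growth F w : n k / (n <= k)%N}.
Proof.
move=> n k nk; apply: fsubset_leq_card; apply/fsubsetP => y.
rewrite !in_fset_set ?inE; try exact: finite_word_ball (finite_Gamma_gens F w).
move=> [s [sn sG ->]]; exists s; split=> //; exact: leq_trans nk.
Qed.

Lemma sqr_le_exp2 n : (4 <= n)%N -> (n * n <= 2 ^ n)%N.
Proof.
elim: n => // n IH; rewrite leq_eqVlt => /orP[/eqP [<-]//|n4].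
by have := IH n4; rewrite expnS; move: (2 ^ n)%N => p; nia.
Qed.

Definition track_cst : R := ln 54%:R - ln (eta ^+ 4 / 2%:R).

Lemma track_cst_ge : ln 54%:R <= track_cst /\ - track_cst <= ln (eta ^+ 4 / 2%:R).
Proof.
have h1 : 0 <= ln 54%:R :> R by rewrite ln_ge0 // ler1n.
have h2 : ln (eta ^+ 4 / 2%:R) <= 0.
  apply: ln_le0; have : eta ^+ 4 <= 1 by rewrite exprn_ile1 // ltW.
  by rewrite ler_pdivrMr //; lra.
by rewrite /track_cst; split; lra.
Qed.

(** There are [8 * #|F| ^ 2] tokens. At radius [S k] a code has at most [110 * 2 ^ k] of them:
    [108 = 2 * 54] for the generators and 2 for the vertices. *)
Definition base : nat := ((8 * #|F| ^ 2) ^ 110)%N.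
Definition base_cst : R := `|ln (ln base%:R)|.

Lemma base_gt1 : (1 < base)%N.
Proof.
have F0 : (0 < #|F|)%N by apply/card_gt0P; exists 1%g.
by rewrite /base -(exp1n 110) ltn_exp2r // (@leq_trans (8 * 1)) // leq_mul2l expn_gt0 F0.
Qed.

Lemma baseX_gt0 m : (0 < base ^ m)%N.
Proof. by rewrite expn_gt0 (ltnW base_gt1). Qed.

Section Omega.
Variables (alpha beta : R) (A : pred nat).
Hypothesis alpha_gt0 : 0 < alpha.
Hypothesis alpha_lt : alpha < beta.
Hypothesis beta_le1 : beta <= 1.
Hypothesis alpha_ge : lg2 / (lg2 - ln eta) <= alpha.

Let beta_gt0 : 0 < beta. Proof. exact: lt_trans alpha_lt. Qed.

Let phi := target alpha beta A.
Let g k := expR (lg2 * phi k).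
Definition omega_of : omega_seq := thermo_omega g.
Let S k := vsum (vseq unit_weights omega_of k).
Let b := Gamma_growth F omega_of.
Definition loglog (c : nat -> nat) n : R := ln (ln (c n)%:R).

Let g0 : g 0%N = 1.
Proof. by rewrite /g /phi /target big_ord0 mulr0 expR0. Qed.

Let g_lower k : 2%:R * g k <= g k.+1.
Proof.
rewrite /g /phi targetS mulrDr expRD mulrC ler_pM2l ?expR_gt0 //.
have /andP[sl _] := slope_bounds A alpha_gt0 alpha_lt k.
rewrite -[leLHS](@lnK R) ?posrE // ler_expR -/lg2 ler_peMr ?(ltW lg2_gt0) //.
by apply: le_trans sl; rewrite invf_ge1.
Qed.

(** Slopes are at most [1 / alpha], which [alpha_ge] bounds by log(2 / eta) / log 2, the growth rate
    along blocks 012. *)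
Let g_upper k : eta * g k.+1 <= 2%:R * g k.
Proof.
rewrite /g /phi targetS mulrDr expRD mulrCA [leRHS]mulrC ler_pM2l ?expR_gt0 //.
have /andP[_ su] := slope_bounds A alpha_gt0 alpha_lt k.
rewrite -ler_pdivlMl // -[X in _ <= X](@lnK R); last by rewrite posrE mulr_gt0 ?invr_gt0.
rewrite ler_expR lnM ?posrE ?invr_gt0 // lnV ?posrE // -/lg2 addrC.
have d0 : 0 < lg2 - ln eta.
  have := lg2_gt0; have : ln eta < 0 by apply: ln_lt0; rewrite eta_gt0.
  lra.
apply: (@le_trans _ _ (lg2 * alpha^-1)); first by rewrite ler_pM2l ?lg2_gt0.
rewrite ler_pdivrMr // mulrC -ler_pdivrMr //.
Qed.

Lemma S_tracks k : lg2 * phi k - track_cst <= ln (S k)%:R <= lg2 * phi k + track_cst.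
Proof.
have [/andP[l u] _] := thermo_omega_tracks eta_gt0 eta_lt1 eta_eq g0 g_lower g_upper k.
have [c1 c2] := track_cst_ge.
have gk : 0 < g k by exact: expR_gt0.
have e4 : 0 < eta ^+ 4 / 2%:R by rewrite divr_gt0 ?exprn_gt0.
have S0 : 0 < (S k)%:R :> R by apply: lt_le_trans l; rewrite mulr_gt0.
have l' : ln (eta ^+ 4 / 2%:R * g k) <= ln (S k)%:R by rewrite ler_ln ?posrE ?mulr_gt0.
have u' : ln (S k)%:R <= ln (54%:R * g k) by rewrite ler_ln ?posrE ?mulr_gt0.
rewrite [ln (_ * g k)]lnM ?posrE // /g expRK in l'; rewrite lnM ?posrE // /g expRK in u'.
by apply/andP; split; lra.
Qed.

Lemma growth_at_level k n : (n <= S k)%N -> (b n <= base ^ (2 ^ k))%N.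
Proof.
move=> nS; have [_ mu_le] := thermo_omega_tracks eta_gt0 eta_lt1 eta_eq g0 g_lower g_upper k.
(* [S k / 54] rounded up, a lower bound for each integer weight by [thermo_omega_tracks]. *)
pose mu := ((S k + 53) %/ 54)%N.
have S54 : (S k <= 54 * mu)%N by rewrite /mu; move: (S k) => s; lia.
have S3 : (3 <= S k)%N.
  have := vsum_vseqX omega_of 0 k; rewrite add0n; apply: leq_trans.
  by rewrite -[X in (X <= _)%N]mul1n leq_mul ?expn_gt0.
have mu0 : (0 < mu)%N by move: S54 S3; move: (S k) (mu) => s [|]; lia.
have muV i : (mu <= vseq unit_weights omega_of k i)%N.
  by have := mu_le i; rewrite -/(S k) /mu; move: (vseq _ _ _ _) (S k) => v s; lia.
apply: leq_trans (growth_upper F n mu0 muV) _; rewrite -/(S k) /base -expnM leq_exp2l; last first.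
  have F0 : (0 < #|F|)%N by apply/card_gt0P; exists 1%g.
  by rewrite (@leq_trans (8 * 1)) // leq_mul2l expn_gt0 F0.
have le1 : ((2 ^ k * (n + S k)) %/ mu <= 2 ^ k * 108)%N.
  rewrite -ltnS ltn_divLR // mulSn; apply: (@leq_ltn_trans (2 ^ k * (2 * (54 * mu)))).
    by rewrite leq_mul2l mul2n -addnn leq_add ?orbT // (leq_trans nS).
  have p0 : (0 < 2 ^ k)%N by rewrite expn_gt0.
  by move: p0 mu0; move: (2 ^ k)%N (mu) => p m; nia.
apply: leq_trans (leq_add le1 (leq_pred _)) _; rewrite expnS.
by move: (2 ^ k)%N => p; lia.
Qed.

Lemma b_gt0 n : (0 < b n)%N.
Proof.
rewrite /b; apply: (@leq_trans (size [:: 1 : treeAut]%g)) => //.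
by apply: growth_ge => // x; rewrite inE => /eqP ->; exact: word_of1.
Qed.

Lemma ln_base_gt0 : 0 < ln base%:R :> R.
Proof. by rewrite ln_gt0 // ltr1n base_gt1. Qed.

Lemma loglog_upper k n : (n <= S k)%N -> loglog b n <= k%:R * lg2 + base_cst.
Proof.
move=> nS; rewrite /loglog.
have lnb : ln (b n)%:R <= (2 ^ k)%:R * ln base%:R :> R.
  rewrite -ln_natX ?(ltnW base_gt1) // ler_ln ?posrE ?ltr0n ?b_gt0 ?baseX_gt0 //.
  by rewrite ler_nat growth_at_level.
have h0 : 0 <= k%:R * lg2 by rewrite mulr_ge0 ?ler0n ?ltW ?lg2_gt0.
case: (lerP (ln (b n)%:R : R) 0) => b0.
  apply: (@le_trans _ _ 0); last by rewrite addr_ge0 // normr_ge0.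
  by apply: ln_le0; lra.
apply: (@le_trans _ _ (ln ((2 ^ k)%:R * ln base%:R))).
  by rewrite ler_ln ?posrE // mulr_gt0 ?ln_base_gt0 ?ltr0n ?expn_gt0.
rewrite lnM ?posrE ?ln_base_gt0 ?ltr0n ?expn_gt0 // ln_natX // lerD2l.
exact: ler_norm.
Qed.

Let targetP k := target_bounds A alpha_gt0 alpha_lt k.

Lemma S_gt0 k : (0 < S k)%N.
Proof.
have := vsum_vseqX omega_of 0 k; rewrite add0n; apply: leq_trans.
by rewrite muln_gt0 expn_gt0.
Qed.

Lemma S_unbounded n : exists k, (n <= S k)%N.
Proof.
exists n; have := vsum_vseqX omega_of 0 n; rewrite add0n; apply: leq_trans.
apply: leq_trans (ltnW (ltn_expl n (ltnSn 1))) _.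
by rewrite -[X in (X <= _)%N]muln1 leq_mul.
Qed.

(** At the first level [k.+1] whose weight reaches [n], [S k < n], and [phi k >= k / beta] converts
    [k] into [beta * ln n]. Level 0 is excluded since [S 0 = 3]. *)
Lemma loglog_le n : (4 <= n)%N ->
  loglog b n <= beta * ln n%:R + (track_cst + lg2 + base_cst).
Proof.
move=> n4; case: (ex_minnP (S_unbounded n)) => -[|k] nS kmin.
  by have := leq_trans n4 nS.
have Sn : (S k < n)%N by rewrite ltnNge; apply/negP => /kmin; rewrite ltnn.
apply: le_trans (loglog_upper nS) _.
have /andP[Sl _] := S_tracks k; have /andP[pl _] := targetP k.
have lnS : ln (S k)%:R <= ln n%:R :> R.
  by rewrite ler_ln ?posrE ?ltr0n ?S_gt0 ?(ltn_trans _ n4) // ler_nat ltnW.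
have [_ c2] := track_cst_ge; have [c1 _] := track_cst_ge.
have c0 : 0 <= track_cst by apply: le_trans c1; rewrite ln_ge0 // ler1n.
have p1 : k%:R <= beta * phi k by rewrite mulrC -ler_pdivrMr.
have p2 := ler_wpM2l (ltW lg2_gt0) p1.
have p3 : beta * (lg2 * phi k - track_cst) <= beta * ln n%:R.
  by rewrite ler_pM2l //; exact: le_trans Sl lnS.
have p4 : beta * track_cst <= track_cst by rewrite ler_piMl.
by rewrite -natr1; move: p2 p3 p4; rewrite -/phi; lra.
Qed.

Hypothesis A_unbounded : forall N, exists2 i, (N <= i)%N & A i.

Let alpha_lt1 : alpha < 1. Proof. exact: lt_le_trans beta_le1. Qed.

Lemma phi_ge k : k%:R <= phi k.
Proof.
have /andP[+ _] := targetP k; apply: le_trans.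
by rewrite ler_peMr ?ler0n // invf_ge1.
Qed.

(** At the end [q ^ 2] of a window in [A], [phi] exceeds its argument by about
    [(1 / alpha - 1) q ^ 2], so [g k / 2 ^ k] is unbounded. *)
Lemma omega_of_digit1 n : exists2 l, (n <= l)%N & omega_of l = digit1.
Proof.
apply: (@thermo_omega_digit1 R eta g) => // M m.
have a1 : 0 < alpha^-1 - 1 by rewrite subr_gt0 invf_gt1.
have [N1 NP1] := quad_large (alpha^-1 + 1) 0 a1.
have [N2 NP2] := nat_large (M / lg2).
have [i] := A_unbounded (N1 + N2 + m)%N => Ni iA.
have ti := tower_gt i.
exists (tower i.+1); first by clear -Ni ti; rewrite towerS; move: (tower i) ti => q ti; nia.
have h := target_high alpha_gt0 alpha_lt iA (leqnn _).
have {NP1} := NP1 (tower i); have {NP2} := NP2 (tower i); rewrite addr0.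
have -> : (N2 <= tower i)%N by clear -Ni ti; lia.
have -> : (N1 <= tower i)%N by clear -Ni ti; lia.
move=> /(_ isT) + /(_ isT); rewrite ler_pdivrMr ?lg2_gt0 // => MP q2.
have lb : (tower i)%:R <= phi (tower i.+1) - (tower i.+1)%:R.
  rewrite /phi; move: h; rewrite towerS natrM; move: (target _ _ _ _) q2 => p q2 h.
  move: h; rewrite mulrBl; move: q2; rewrite !mulrDl mulNr !mul1r !(mulrC alpha^-1).
  lra.
have -> : 2%:R ^+ tower i.+1 = expR ((tower i.+1)%:R * lg2).
  by rewrite expRM_natl lnK ?posrE.
rewrite -ltr_pdivlMr ?expR_gt0 // /g -expRN -expRD.
apply: lt_le_trans (expR_ge1Dx _); apply: le_lt_trans MP _.
rewrite [_ * lg2]mulrC -mulrN -mulrDr mulrC -[ltLHS]add0r ltr_leD ?ltr01 //.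
by rewrite ler_pM2l ?lg2_gt0.
Qed.

Section Scale.
Variable L : nat.
Hypothesis L_gt0 : (0 < L)%N.

Definition test_radius r := (5 * L * 2 ^ r * S ((L + 7) * r))%N.
Definition low_cst : R := lg2 - ln lg2.

Lemma growth_at_radius r : (2 * L + 8 <= r)%N -> (2 ^ 2 ^ (r * L).-1 <= b (test_radius r))%N.
Proof.
move=> Lr; have r0 : (0 < r)%N by lia.
apply: growth_lower => //.
- exact: (@thermo_omega_no_adjacent R g).
- exact: omega_of_digit1.
- have := @sqr_le_exp2 (r * 2); rewrite -expnM => /(_ ltac:(lia)).
  by apply: leq_trans; nia.
have := @sqr_le_exp2 r.-1 ltac:(lia); apply: leq_trans.
by case: (r) Lr => // r'; nia.
Qed.

Lemma loglog_lower r n : (2 * L + 8 <= r)%N -> (test_radius r <= n)%N ->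
  (r * L)%:R * lg2 - low_cst <= loglog b n.
Proof.
move=> Lr rn; have rL : (0 < r * L)%N by rewrite muln_gt0 L_gt0 andbT; lia.
have bn := leq_trans (growth_at_radius Lr) (growth_mono omega_of rn).
have lnb : (2 ^ (r * L).-1)%:R * lg2 <= ln (b n)%:R :> R.
  by rewrite -ln_natX // ler_ln ?posrE ?ltr0n ?b_gt0 ?expn_gt0 // ler_nat.
have p0 : 0 < (2 ^ (r * L).-1)%:R * lg2 by rewrite mulr_gt0 ?lg2_gt0 // ltr0n expn_gt0.
apply: le_trans (_ : ln ((2 ^ (r * L).-1)%:R * lg2) <= _); last first.
  by rewrite /loglog ler_ln ?posrE // (lt_le_trans p0).
rewrite lnM ?posrE ?lg2_gt0 ?ltr0n ?expn_gt0 // ln_natX // /low_cst.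
rewrite -{1}(prednK rL) -natr1 mulrDl mul1r -/lg2; lra.
Qed.

Lemma ln_radius r : ln (test_radius r)%:R = ln (5 * L)%:R + r%:R * lg2 + ln (S ((L + 7) * r))%:R :> R.
Proof.
have p1 : 0 < (5 * L)%:R :> R by rewrite ltr0n muln_gt0.
have p2 : 0 < (2 ^ r)%:R :> R by rewrite ltr0n expn_gt0.
have p3 : 0 < (S ((L + 7) * r))%:R :> R by rewrite ltr0n S_gt0.
by rewrite /test_radius natrM (natrM _ (5 * L)) lnM ?posrE ?mulr_gt0 // (lnM (x := (5 * L)%:R)) ?posrE // ln_natX.
Qed.

Let c0 : 0 <= track_cst.
Proof. by have [c1 _] := track_cst_ge; apply: le_trans c1; rewrite ln_ge0 // ler1n. Qed.

Let l5 : 0 <= ln (5 * L)%:R :> R.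
Proof. by rewrite ln_ge0 // ler1n muln_gt0. Qed.

Lemma ln_radius_ge r : ((L + 7) * r)%:R * lg2 - track_cst <= ln (test_radius r)%:R.
Proof.
rewrite ln_radius; have /andP[Sl _] := S_tracks ((L + 7) * r).
have := ler_wpM2l (ltW lg2_gt0) (phi_ge ((L + 7) * r)); rewrite mulrC.
have : 0 <= r%:R * lg2 by rewrite mulr_ge0 ?ler0n ?ltW ?lg2_gt0.
move: l5 Sl; move: (ln (5 * L)%:R) (ln (S _)%:R) (lg2 * _) (_ * lg2) => x y z u; lra.
Qed.

Lemma radius_gt r : (r < test_radius r)%N.
Proof.
apply: leq_trans (ltn_expl r (ltnSn 1)) _; rewrite /test_radius mulnAC leq_pmull //.
by rewrite !muln_gt0 L_gt0 S_gt0.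
Qed.

(** Take the largest test radius below [n]. Its level exceeds [r L] by [7 r], and the factor [2 ^ r]
    counts as [r] more levels; this loss of [8 r] is a fraction [8 / L] of [ln n], up to
    constants. *)
Lemma loglog_ge : exists C N, forall n, (N <= n)%N ->
  alpha * ln n%:R - 8%:R / L%:R * ln n%:R - C <= loglog b n.
Proof.
pose C := low_cst + ln (5 * L)%:R + track_cst + lg2 * (L%:R + 8%:R) + 8%:R / L%:R * track_cst.
exists C, (test_radius (2 * L + 8)) => n nr.
have L0 : 0 < L%:R :> R by rewrite ltr0n.
have ex : exists r, (test_radius r <= n)%N by exists (2 * L + 8)%N.
have bounded r : (test_radius r <= n)%N -> (r <= n)%N.
  by move=> rn; exact: leq_trans (ltnW (radius_gt r)) rn.
case: (ex_maxnP ex bounded) => r rn rmax.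
have Lr : (2 * L + 8 <= r)%N by exact: rmax.
apply: le_trans (loglog_lower Lr rn).
have nr1 : (n < test_radius r.+1)%N by rewrite ltnNge; apply/negP => /rmax; rewrite ltnn.
have n0 : (0 < n)%N by apply: leq_trans rn; apply: leq_trans (radius_gt r).
have up : ln n%:R <= ln (5 * L)%:R + r.+1%:R * lg2 +
    (lg2 * (((L + 7) * r.+1)%:R / alpha) + track_cst).
  apply: (@le_trans _ _ (ln (test_radius r.+1)%:R)).
    by rewrite ler_ln ?posrE ?ltr0n // ?ler_nat ?(ltn_trans n0) // ltnW.
  rewrite ln_radius lerD2l; have /andP[_ Su] := S_tracks ((L + 7) * r.+1).
  apply: le_trans Su _; rewrite lerD2r ler_wpM2l ?(ltW lg2_gt0) //.
  by have /andP[_] := targetP ((L + 7) * r.+1).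
have low : L%:R * (r%:R * lg2) <= ln n%:R + track_cst.
  rewrite -lerBlDr; apply: (@le_trans _ _ (ln (test_radius r)%:R)); last first.
    by rewrite ler_ln ?posrE ?ltr0n // ?ler_nat // (leq_trans _ (radius_gt r)).
  apply: le_trans (ln_radius_ge r); rewrite lerD2r mulrA ler_wpM2r ?(ltW lg2_gt0) //.
  by rewrite -natrM ler_nat leq_mul2r leq_addr orbT.
have low' : 8%:R * (r%:R * lg2) <= 8%:R / L%:R * (ln n%:R + track_cst).
  have -> : 8%:R * (r%:R * lg2) = 8%:R / L%:R * (L%:R * (r%:R * lg2)).
    by field; rewrite gt_eqF.
  by rewrite ler_wpM2l // divr_ge0 ?ler0n.
have up' : alpha * ln n%:R <= ln (5 * L)%:R + r.+1%:R * lg2 +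
    (lg2 * ((L + 7) * r.+1)%:R + track_cst).
  apply: le_trans (ler_wpM2l (ltW alpha_gt0) up) _.
  have e : alpha * (lg2 * (((L + 7) * r.+1)%:R / alpha)) = lg2 * ((L + 7) * r.+1)%:R.
    by field; rewrite gt_eqF.
  have h1 : alpha * ln (5 * L)%:R <= ln (5 * L)%:R by exact: ler_piMl l5 (ltW alpha_lt1).
  have h2 : alpha * (r.+1%:R * lg2) <= r.+1%:R * lg2.
    by apply: ler_piMl (ltW alpha_lt1); rewrite mulr_ge0 ?ler0n // ltW // lg2_gt0.
  have h3 : alpha * track_cst <= track_cst by exact: ler_piMl c0 (ltW alpha_lt1).
  rewrite (mulrDr alpha (_ + _)) (mulrDr alpha (ln _)) (mulrDr alpha (lg2 * _)) e.
  by rewrite !lerD.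
have e1 : ((L + 7) * r.+1)%:R = (L%:R + 7%:R) * (r%:R + 1) :> R.
  by rewrite natrM natrD natr1.
rewrite e1 -natr1 in up'; rewrite natrM /C.
move: (ln (5 * L)%:R) (8%:R / L%:R) (ln n%:R) up' low' => x y v.
move: lg2 low_cst track_cst (alpha) L%:R r%:R => s z t a p q h1 h2.
by lra.
Qed.

(* At the end of a window on which the target is low, the radius reaches its
   maximal exponent. *)
Lemma ln_radius_low i r : ~~ A i -> ((L + 7) * r <= tower i.+1)%N ->
  ln (test_radius r)%:R <= ln (5 * L)%:R + r%:R * lg2 +
    (lg2 * ((tower i)%:R / alpha + ((L + 7) * r)%:R / beta) + track_cst).
Proof.
move=> iA ri; rewrite ln_radius lerD2l; have /andP[_ Su] := S_tracks ((L + 7) * r).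
apply: le_trans Su _; rewrite lerD2r ler_wpM2l ?(ltW lg2_gt0) //.
exact: (target_low alpha_gt0 alpha_lt iA ri).
Qed.

End Scale.

Lemma ln_S_high i k : A i -> (k <= tower i.+1)%N ->
  lg2 * ((k%:R - (tower i)%:R) / alpha) - track_cst <= ln (S k)%:R.
Proof.
move=> iA ki; have /andP[Sl _] := S_tracks k; apply: le_trans Sl.
rewrite lerD2r ler_wpM2l ?(ltW lg2_gt0) //; exact: (target_high alpha_gt0 alpha_lt iA ki).
Qed.

Lemma ln_S_ge k : k%:R * lg2 - track_cst <= ln (S k)%:R.
Proof.
have /andP[Sl _] := S_tracks k; apply: le_trans Sl.
by rewrite lerD2r mulrC ler_wpM2l ?(ltW lg2_gt0) // phi_ge.
Qed.

Lemma loglog_ratio_le e : 0 < e ->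
  exists N, forall n, (N <= n)%N -> loglog b n / ln n%:R <= beta + e.
Proof.
move=> e0; have [N NP] := nat_large (expR ((track_cst + lg2 + base_cst) / e)).
exists (N + 4)%N => n Nn; have n4 : (4 <= n)%N by apply: leq_trans Nn; rewrite leq_addl.
have n0 : (0 < n)%N by apply: leq_trans n4.
have lnn : 0 < ln n%:R :> R by rewrite ln_gt0 // ltr1n (leq_trans _ n4).
rewrite ler_pdivrMr // mulrDl; apply: le_trans (loglog_le n4) _; rewrite lerD2l mulrC.
rewrite -ler_pdivrMr // -[leLHS]expRK ler_ln ?posrE ?expR_gt0 ?ltr0n // NP //.
by apply: leq_trans Nn; rewrite leq_addr.
Qed.

Lemma loglog_ratio_ge e : 0 < e ->
  exists N, forall n, (N <= n)%N -> alpha - e <= loglog b n / ln n%:R.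
Proof.
move=> e0; have [L0 L0P] := nat_large (16%:R / e).
pose L := L0.+1; have [C [N1 N1P]] := @loglog_ge L (ltn0Sn _).
have [N2 N2P] := nat_large (expR (2%:R * C / e)).
exists (N1 + N2 + 4)%N => n Nn; have n4 : (4 <= n)%N by apply: leq_trans Nn; rewrite leq_addl.
have n0 : (0 < n)%N by apply: leq_trans n4.
have lnn : 0 < ln n%:R :> R by rewrite ln_gt0 // ltr1n (leq_trans _ n4).
rewrite ler_pdivlMr //; apply: le_trans (N1P n _); last by clear -Nn; lia.
have h1 : 8%:R / L%:R <= e / 2%:R.
  have := L0P L (leqnSn _); rewrite ler_pdivrMr // => h.
  by rewrite ler_pdivrMr ?ltr0n //; move: h; move: (L%:R) => l; lra.
have h2 : C <= e / 2%:R * ln n%:R.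
  have : expR (2%:R * C / e) <= n%:R by apply: N2P; clear -Nn; lia.
  rewrite -ler_ln ?posrE ?expR_gt0 ?ltr0n // expRK ler_pdivrMr //.
  by move: (ln _) => x; lra.
have h3 := ler_wpM2r (ltW lnn) h1.
by rewrite mulrBl; move: h2 h3; move: (ln n%:R) (_ / L%:R) => x y; lra.
Qed.

(** The radius is [S k] at the end [k] of a window in [A], where [ln (S k)] is about
    [k * lg2 / alpha]. *)
Lemma loglog_ratio_often_le e : 0 < e -> forall N,
  exists2 n, (N <= n)%N & loglog b n / ln n%:R <= alpha + e.
Proof.
move=> e0 N; have el : 0 < e * lg2 by rewrite mulr_gt0 ?lg2_gt0.
pose C := e * track_cst + base_cst + track_cst.
have [N1 N1P] := quad_large lg2 C el.
have [i Ni iA] := A_unbounded (N1 + N + 4)%N.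
have ti := tower_gt i; set q := tower i in ti; set k := tower i.+1.
have kE : k = (q * q)%N by rewrite /k towerS.
have Sk : (k < S k)%N.
  have := vsum_vseqX omega_of 0 k; rewrite add0n; apply: leq_trans.
  by apply: leq_trans (ltn_expl k (ltnSn 1)) _; rewrite -[X in (X <= _)%N]muln1 leq_mul.
have Nq : (N + N1 + 4 <= q)%N by clear -Ni ti; lia.
have qk : (q <= k)%N by rewrite kE leq_pmulr //; clear -Nq; lia.
exists (S k); first by clear -Nq qk Sk; lia.
have S4 : (4 <= S k)%N by clear -Nq qk Sk; lia.
have lnn : 0 < ln (S k)%:R :> R by rewrite ln_gt0 // ltr1n (leq_trans _ S4).
rewrite ler_pdivrMr //; apply: le_trans (loglog_upper (leqnn _)) _.
have h1 := ln_S_high iA (leqnn _); have h2 := ln_S_ge k.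
have h3 : lg2 * q%:R + C <= e * lg2 * k%:R by rewrite kE natrM; apply: N1P; clear -Nq; lia.
have h4 : lg2 * (k%:R - q%:R) - alpha * track_cst <= alpha * ln (S k)%:R.
  apply: le_trans (ler_wpM2l (ltW alpha_gt0) h1); rewrite (mulrBr alpha (lg2 * _)) lerD2r.
  by rewrite -/q -/k le_eqVlt; apply/orP; left; apply/eqP; field; rewrite gt_eqF.
have c0 : 0 <= track_cst by have [c1 _] := track_cst_ge; apply: le_trans c1; rewrite ln_ge0 // ler1n.
have h5 : alpha * track_cst <= track_cst by exact: ler_piMl c0 (ltW alpha_lt1).
have h6 := ler_wpM2l (ltW e0) h2.
move: h3 h4 h5 h6; rewrite /C; move: lg2 track_cst (ln _) (k%:R) (q%:R) base_cst => s t x y z u.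
by move: (alpha) => al; lra.
Qed.

(** The radius is the last test radius within a window outside [A]. Half of [e] pays for the loss
    [8 / L], the other half for the start of the window and the constants. *)
Lemma loglog_ratio_often_ge e : (forall N, exists2 i, (N <= i)%N & ~~ A i) -> 0 < e ->
  forall N, exists2 n, (N <= n)%N & beta - e <= loglog b n / ln n%:R.
Proof.
move=> coA e0 N; have [L0 L0P] := nat_large (16%:R / e).
pose L := L0.+1; have L_gt0 : (0 < L)%N by [].
have el : 0 < e / 2%:R * lg2 by rewrite !mulr_gt0 ?lg2_gt0 ?invr_gt0.
pose C := low_cst + ln (5 * L)%:R + track_cst + 8%:R / L%:R * track_cst +
  e / 2%:R * (lg2 * (L%:R + 7%:R) + track_cst).
have [N1 N1P] := quad_large (lg2 / alpha) C el.
have [i Ni iA] := coA (N1 + N + (L + 7) * (2 * L + N + 10))%N.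
have ti := tower_gt i; set q := tower i in ti; set k := tower i.+1.
have kE : k = (q * q)%N by rewrite /k towerS.
pose r := (k %/ (L + 7))%N.
have rk : ((L + 7) * r <= k)%N by rewrite mulnC leq_divM.
have kr : (k <= (L + 7) * r + (L + 7))%N.
  by rewrite {1}(divn_eq k (L + 7)) mulnC leq_add2l ltnW // ltn_mod addn_gt0 orbT.
have qr : (2 * L + N + 9 <= r)%N.
  have : ((L + 7) * (2 * L + N + 10) <= q * q)%N by apply: leq_trans (leq_pmulr _ _); clear -Ni ti; lia.
  by rewrite -kE; move: kr; move: (k) (r) (L) => k' r' L' h1 h2; clear -h1 h2; nia.
have rad := radius_gt L_gt0 r.
exists (test_radius L r); first by clear -qr rad; lia.
have n4 : (4 <= test_radius L r)%N by clear -qr rad; lia.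
have lnn : 0 < ln (test_radius L r)%:R :> R by rewrite ln_gt0 // ltr1n (leq_trans _ n4).
rewrite ler_pdivlMr //; apply: le_trans (loglog_lower L_gt0 _ (leqnn _)); last by clear -qr; lia.
have h1 := ln_radius_low L_gt0 iA rk; have h2 := ln_radius_ge L_gt0 r.
have L_0 : 0 < L%:R :> R by rewrite ltr0n.
have c0 : 0 <= track_cst by have [c1 _] := track_cst_ge; apply: le_trans c1; rewrite ln_ge0 // ler1n.
have l5 : 0 <= ln (5 * L)%:R :> R by rewrite ln_ge0 // ler1n.
have rl0 : 0 <= r%:R * lg2 by rewrite mulr_ge0 ?ler0n // ltW ?lg2_gt0.
have ql0 : 0 <= lg2 * (q%:R / alpha) by rewrite mulr_ge0 ?divr_ge0 ?ler0n ?(ltW alpha_gt0) // ltW ?lg2_gt0.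
have g1 : 8%:R / L%:R <= e / 2%:R.
  have := L0P L (leqnSn _); rewrite ler_pdivrMr // => h.
  by rewrite ler_pdivrMr //; move: h; move: (L%:R) => l; lra.
have g2 := ler_wpM2r (ltW lnn) g1.
have g3 : 8%:R * (r%:R * lg2) <= 8%:R / L%:R * (ln (test_radius L r)%:R + track_cst).
  have -> : 8%:R * (r%:R * lg2) = 8%:R / L%:R * (L%:R * (r%:R * lg2)).
    by field; rewrite gt_eqF.
  apply: ler_wpM2l; first by rewrite divr_ge0 ?ler0n.
  rewrite -lerBlDr; apply: le_trans h2; rewrite lerD2r mulrA ler_wpM2r ?(ltW lg2_gt0) //.
  by rewrite -natrM ler_nat leq_mul2r leq_addr orbT.
have g4 : e / 2%:R * (lg2 * (k%:R - (L%:R + 7%:R)) - track_cst) <= e / 2%:R * ln (test_radius L r)%:R.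
  apply: ler_wpM2l; first by rewrite divr_ge0 ?ler0n // ltW.
  apply: le_trans h2; rewrite lerD2r mulrC ler_wpM2r ?(ltW lg2_gt0) //.
  by rewrite lerBlDr -natrD -natrD ler_nat.
have g5 : lg2 * (q%:R / alpha) + C <= e / 2%:R * lg2 * k%:R.
  have -> : lg2 * (q%:R / alpha) = lg2 / alpha * q%:R by field; rewrite gt_eqF.
  by rewrite kE natrM; apply: N1P; clear -Ni ti; lia.
have g6 : beta * ln (test_radius L r)%:R <= ln (5 * L)%:R + r%:R * lg2 +
    (lg2 * (q%:R / alpha) + lg2 * ((L + 7) * r)%:R + track_cst).
  apply: le_trans (ler_wpM2l (ltW beta_gt0) h1) _; rewrite -/q.
  have -> : beta * (ln (5 * L)%:R + r%:R * lg2 + (lg2 * (q%:R / alpha + ((L + 7) * r)%:R / beta) + track_cst))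
    = beta * ln (5 * L)%:R + beta * (r%:R * lg2) + (beta * (lg2 * (q%:R / alpha)) + lg2 * ((L + 7) * r)%:R + beta * track_cst).
    by field; rewrite !gt_eqF.
  by rewrite !lerD //; exact: ler_piMl.
rewrite mulrBl; move: g2 g3 g4 g5 g6; rewrite /C.
move: (ln (test_radius L r)%:R) (8%:R / L%:R) (lg2 * (q%:R / alpha)) low_cst (ln (5 * L)%:R) => x y z w l.
rewrite !natrM natrD.
move: (beta) (lg2) (track_cst) (L%:R) (r%:R) (k%:R) => bb s t a p kk.
by lra.
Qed.

End Omega.
End Growth.

(** * The antichain *)

Definition bits_code : seq bool -> nat := choice.pickle.
Definition bits_decode : nat -> option (seq bool) := choice.unpickle.

Lemma bits_codeK : pcancel bits_code bits_decode.
Proof. exact: choice.pickleK. Qed.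

(** Distinct sequences share only finitely many prefixes, so these infinite sets are almost
    disjoint. *)
Definition prefix_codes (xi : nat -> bool) : pred nat := fun i =>
  if bits_decode i is Some s then s == mkseq xi (size s) else false.

Lemma prefix_codesE xi zeta n : prefix_codes xi (bits_code (mkseq zeta n)) =
  (mkseq zeta n == mkseq xi n).
Proof. by rewrite /prefix_codes bits_codeK size_mkseq. Qed.

(** Pigeonhole: [N.+1] prefixes of different lengths have different codes, not all below [N]. *)
Lemma prefix_code_large xi n0 N :
  exists2 n, (n0 <= n)%N & (N <= bits_code (mkseq xi n))%N.
Proof.
apply: contrapT => no.
have small n : (n0 <= n)%N -> (bits_code (mkseq xi n) < N)%N.
  by move=> n0n; rewrite ltnNge; apply/negP => Nn; apply: no; exists n.
pose s := [seq bits_code (mkseq xi n) | n <- iota n0 N.+1].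
have us : uniq s.
  rewrite map_inj_uniq ?iota_uniq // => n m /(pcan_inj bits_codeK) e.
  by have := congr1 size e; rewrite !size_mkseq.
have : (size s <= size (iota 0 N))%N.
  apply: uniq_leq_size => // i /mapP[n]; rewrite mem_iota => /andP[n0n _] ->.
  by rewrite mem_iota add0n small.
by rewrite size_map !size_iota ltnn.
Qed.

Lemma prefix_codes_sep xi zeta : xi <> zeta -> forall N,
  exists2 i, (N <= i)%N & prefix_codes xi i && ~~ prefix_codes zeta i.
Proof.
move=> ne N; have [k kP] : exists k, xi k != zeta k.
  apply: contrapT => no; apply: ne; apply: funext => k.
  by apply/eqP/negPn/negP => kP; apply: no; exists k.
have [n kn Nn] := prefix_code_large xi k.+1 N.
exists (bits_code (mkseq xi n)) => //; rewrite !prefix_codesE eqxx /=.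
apply: contra kP => /eqP e; have := congr1 (fun s => nth false s k) e.
by rewrite !nth_mkseq // => ->.
Qed.

Lemma prefix_codes_unbounded xi N : exists2 i, (N <= i)%N & prefix_codes xi i.
Proof.
have [|i Ni /andP[iP _]] := @prefix_codes_sep xi (fun k => ~~ xi k) _ N.
  by move=> /(congr1 (fun f => f 0%N)); case: (xi 0).
by exists i.
Qed.

Lemma prefix_codes_counbounded xi N : exists2 i, (N <= i)%N & ~~ prefix_codes xi i.
Proof.
have [|i Ni /andP[_ iP]] := @prefix_codes_sep (fun k => ~~ xi k) xi _ N.
  by move=> /(congr1 (fun f => f 0%N)); case: (xi 0).
by exists i.
Qed.

Lemma uncountable_image (T : Type) (f : (nat -> bool) -> T) :
  injective f -> ~ countable (range f).
Proof.
move=> f_inj /countable_injP[h]; move=> h_inj.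
have hf_inj xi zeta : h (f xi) = h (f zeta) -> xi = zeta.
  by move=> e; apply: f_inj; apply: h_inj => //; rewrite inE; [exists xi|exists zeta].
(* Cantor's diagonal set for the injection that sends [xi] to [h (f xi)]. *)
pose D n := ~~ `[< exists2 zeta : nat -> bool, h (f zeta) = n & zeta n >].
case De : (D (h (f D))); move: (De).
  by rewrite {1}/D => /asboolPn; apply; exists D.
by rewrite {1}/D => /negbFE /asboolP[zeta /hf_inj -> ]; rewrite De.
Qed.

Lemma exp_tower_le (R : realType) (B m k : nat) : (1 < B)%N -> (2 ^ 2 ^ m <= B ^ 2 ^ k)%N ->
  m%:R * ln 2%:R + ln (ln 2%:R) <= k%:R * ln 2%:R + ln (ln B%:R) :> R.
Proof.
move=> B1 le; have lg2 := lg2_gt0 R; have B0 := ltnW B1.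
have lB : 0 < ln B%:R :> R by rewrite ln_gt0 // ltr1n.
have p2 n : 0 < (2 ^ n)%:R :> R by rewrite ltr0n expn_gt0.
have h : (2 ^ m)%:R * ln 2%:R <= (2 ^ k)%:R * ln B%:R :> R.
  by rewrite -!ln_natX // ler_ln ?posrE ?ltr0n ?expn_gt0 ?B0 // ler_nat.
rewrite -!(ln_natX R _ (ltn0Sn 1)) -!lnM ?posrE //.
by rewrite ler_ln ?posrE ?mulr_gt0.
Qed.

(** The exponential covers the radii where [beta * ln n + K] still exceeds [beta' * ln n], the last
    term those below 4. *)
Definition growth_cst (R : realType) (F : finGroupType) (eta beta beta' : R) : R :=
  let K := track_cst eta + ln 2%:R + base_cst R F in
  expR (K + K / (beta' - beta)) + 2%:R * ln (base F)%:R.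

Section Family.
Variables (R : realType) (F : finGroupType) (eta : R).
Hypothesis eta_gt0 : 0 < eta.
Hypothesis eta_lt1 : eta < 1.
Hypothesis eta_eq : eta ^+ 3 + eta ^+ 2 + eta = 2%:R.
Variables (alpha beta : R).
Hypothesis alpha_gt0 : 0 < alpha.
Hypothesis alpha_lt : alpha < beta.
Hypothesis beta_le1 : beta <= 1.
Hypothesis alpha_ge : ln 2%:R / (ln 2%:R - ln eta) <= alpha.

Let beta_gt0 : 0 < beta. Proof. exact: lt_trans alpha_lt. Qed.

Let om A := omega_of alpha beta A.
Let b A := Gamma_growth F (om A).

Lemma exponents_omega (A : pred nat) : (forall N, exists2 i, (N <= i)%N & A i) ->
  (forall N, exists2 i, (N <= i)%N & ~~ A i) ->
  lower_exponent R (b A) = alpha%:E /\ upper_exponent R (b A) = beta%:E.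
Proof.
move=> unb coA; split.
  apply: (@limn_einf_eq R (fun n => loglog R (b A) n / ln n%:R)).
    exact: (loglog_ratio_ge F eta_gt0 eta_lt1 eta_eq alpha_gt0 alpha_lt beta_le1 alpha_ge unb).
  exact: (loglog_ratio_often_le F eta_gt0 eta_lt1 eta_eq alpha_gt0 alpha_lt beta_le1 alpha_ge unb).
apply: (@limn_esup_eq R (fun n => loglog R (b A) n / ln n%:R)).
  exact: (loglog_ratio_le F eta_gt0 eta_lt1 eta_eq A alpha_gt0 alpha_lt beta_le1 alpha_ge).
move=> e e0; exact: (loglog_ratio_often_ge F eta_gt0 eta_lt1 eta_eq alpha_gt0 alpha_lt beta_le1 alpha_ge unb coA e0).
Qed.

(** At the end of a window in [A] but not in [A'], the weights for [A] are far larger. So if [n] is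
    a test radius for [A'], then [C * n] is still below the weight for [A] at level
    [r L0 = r (L - 1)]; thus [b A (C * n)] is about exp(2^(r (L - 1))) at most, against 2^(2^(r L -
    1)) for [b A' n]. *)
Lemma not_growth_le (A A' : pred nat) : (forall N, exists2 i, (N <= i)%N & A i && ~~ A' i) ->
  (forall N, exists2 i, (N <= i)%N & A' i) -> ~ growth_le (b A') (b A).
Proof.
move=> sep unb [C CP]; set lg2 : R := ln 2%:R.
have lg2_gt0 : 0 < lg2 := lg2_gt0 R.
have gap : 0 < alpha^-1 - beta^-1 by rewrite subr_gt0 ltf_pV2 ?posrE.
(* Here [7 / beta] pays for the seven extra levels, [1 / alpha] for passing from [L] to [L0], one
   unit for the factor [2 ^ r], and the other leaves [r * lg2] to absorb constants ([rlg]). *)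
have [L0 L0P] := nat_large ((2%:R + alpha^-1 + 7%:R / beta) / (alpha^-1 - beta^-1)).
pose L := L0.+1; have LP := L0P L (leqnSn _); rewrite ler_pdivrMr // in LP.
have LR0 : 0 < L%:R + 7%:R :> R by rewrite addr_gt0 ?ltr0n.
have a0 : 0 < lg2 / (L%:R + 7%:R) by rewrite divr_gt0.
set c := track_cst eta.
have c0 : 0 <= c by have [c1 _] := track_cst_ge eta_gt0 eta_lt1; apply: le_trans c1; rewrite ln_ge0 // ler1n.
pose D := ln C.+1%:R + ln (5 * L)%:R + 2%:R * c.
have D0 : 0 <= D by rewrite /D !addr_ge0 ?ln_ge0 ?ler1n ?muln_gt0 // mulr_ge0.
have [N1 N1P] := quad_large (2%:R * (lg2 / alpha))
  (D + `|low_cst R| + base_cst R F + 1 + lg2) a0.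
have [i Ni /andP[iA iA']] := sep (N1 + (L + 7) * (2 * L + 10))%N.
have ti := tower_gt i; set q := tower i in ti; set k := tower i.+1.
have kE : k = (q * q)%N by rewrite /k towerS.
pose r := (k %/ (L + 7))%N.
have rk : ((L + 7) * r <= k)%N by rewrite mulnC leq_divM.
have kr : (k <= (L + 7) * r + (L + 7))%N.
  by rewrite {1}(divn_eq k (L + 7)) mulnC leq_add2l ltnW // ltn_mod addn_gt0 orbT.
have qr : (2 * L + 8 <= r)%N.
  have : ((L + 7) * (2 * L + 10) <= q * q)%N by apply: leq_trans (leq_pmulr _ _); clear -Ni ti; lia.
  by rewrite -kE; move: kr; move: (k) (r) (L) => k' r' L' h1 h2; clear -h1 h2; nia.
have rlg : 2%:R * (lg2 / alpha) * q%:R + (D + `|low_cst R| + base_cst R F + 1) <= r%:R * lg2.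
  have := N1P q; rewrite (_ : (N1 <= q)%N); last by clear -Ni ti; lia.
  move=> /(_ isT) h; have : lg2 / (L%:R + 7%:R) * (q%:R * q%:R) <= r%:R * lg2 + lg2.
    rewrite -natrM -kE -mulrAC ler_pdivrMr // -[X in _ + X]mul1r -mulrDl mulrAC [leLHS]mulrC.
    rewrite ler_pM2r // -natrD natr1 -natrM ler_nat.
    by move: kr; rewrite mulSn mulnC addnC.
  by move: h; set x := lg2 / (_ + _) * _; move: x => x; lra.
set n := test_radius alpha beta A' L r.
have up : ln n%:R <= ln (5 * L)%:R + r%:R * lg2 +
    (lg2 * (q%:R / alpha + ((L + 7) * r)%:R / beta) + c).
  exact: (ln_radius_low eta_gt0 eta_lt1 eta_eq alpha_gt0 alpha_lt beta_le1 alpha_ge (ltn0Sn L0) iA' rk).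
pose k2 := (r * L0)%N.
have k2k : (k2 <= k)%N.
  apply: leq_trans rk; rewrite /k2 mulnC leq_mul2r; apply/orP; right.
  by rewrite /L addSn leqW // leq_addr.
have low : lg2 * ((k2%:R - q%:R) / alpha) - c <= ln (vsum (vseq unit_weights (om A) k2))%:R.
  exact: (ln_S_high eta_gt0 eta_lt1 eta_eq alpha_gt0 alpha_lt beta_le1 alpha_ge iA k2k).
have n0 : (0 < n)%N.
  apply: leq_trans (radius_gt alpha beta A' (ltn0Sn L0) r); exact: ltn0Sn.
(* [C.+1] instead of [C] allows logarithms when [C = 0]. *)
have Cn : (C.+1 * n <= vsum (vseq unit_weights (om A) k2))%N.
  have S0 : (0 < vsum (vseq unit_weights (om A) k2))%N by exact: S_gt0.
  have Cn0 : (0 < C.+1 * n)%N by rewrite muln_gt0 n0.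
  rewrite -(ler_nat R) -ler_ln ?posrE ?ltr0n //.
  rewrite (natrM R C.+1 n) lnM ?posrE ?ltr0n //; apply: le_trans low; apply: le_trans (lerD (lexx _) up) _.
  rewrite [(k2%:R - _) / _]mulrBl (natrM _ r L0) (natrM _ (L + 7) r) natrD.
  move: rlg LP; rewrite /D -[L]/(L0.+1) -(@natr1 R L0).
  set x := ln C.+1%:R; set y := ln (5 * L0.+1)%:R.
  have n1 := normr_ge0 (low_cst R); have n2 : 0 <= base_cst R F by exact: normr_ge0.
  rewrite -/c; move: n1 n2 (r%:R) (L0%:R) (q%:R) (ler0n R r).
  move: `|_| (base_cst R F) (alpha^-1) (beta^-1) x y => z u ai bi x y z0 u0 p l q' p0 h1 h2.
  have h3 : 0 <= (p * lg2) * ((l + 1) * (ai - bi) - (2%:R + ai + 7%:R * bi)).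
    by apply: mulr_ge0; [rewrite mulr_ge0 // ltW | rewrite subr_ge0].
  lra.
have growA : (2 ^ 2 ^ (r * L).-1 <= base F ^ 2 ^ k2)%N.
  apply: leq_trans (growth_at_level F eta_gt0 eta_lt1 eta_eq alpha_gt0 alpha_lt beta_le1 alpha_ge Cn).
  apply: leq_trans (_ : b A (C * n) <= _)%N; last by apply: growth_mono; rewrite leq_mul2r leqnSn orbT.
  apply: leq_trans (CP n).
  exact: (growth_at_radius F eta_gt0 eta_lt1 eta_eq alpha_gt0 alpha_lt beta_le1 alpha_ge unb (ltn0Sn L0) qr).
have := exp_tower_le R (base_gt1 F) growA; rewrite -/lg2.
have rL : (0 < r * L)%N by rewrite muln_gt0 andbT; clear -qr; lia.
have e1 : (r * L).-1%:R = k2%:R + r%:R - 1 :> R.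
  by apply/(canRL (addrK _)); rewrite natr1 (prednK rL) -natrD /L mulnS addnC.
have n1 := ler_norm (low_cst R); have n2 : ln (ln (base F)%:R) <= base_cst R F by exact: ler_norm.
have : `|low_cst R| + base_cst R F + 1 <= r%:R * lg2.
  apply: le_trans rlg.
  have h0 : 0 <= lg2 / alpha by rewrite divr_ge0 // ltW.
  have : 0 <= 2%:R * (lg2 / alpha) * q%:R by rewrite mulr_ge0 ?ler0n // mulr_ge0.
  by move: D0; move: (2%:R * _ * _) `|_| (base_cst _ _) (D) => x y z t; lra.
rewrite e1; move: n1 n2; have : low_cst R = lg2 - ln lg2 by [].
move: (low_cst R) => w; move: `|w| => x.
move: (base_cst R F) (ln (ln _)) (ln lg2) (k2%:R) (r%:R) (lg2) => y z t u v s -> h1 h2 h3.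
by rewrite !mulrDl mulNr mul1r; lra.
Qed.

Lemma growth_uniform (A : pred nat) beta' n : beta < beta' ->
  (b A n)%:R <= expR (growth_cst F eta beta beta') * expR (n%:R `^ beta').
Proof.
move=> bb'; rewrite -expRD; set K := track_cst eta + ln 2%:R + base_cst R F.
have b1 : 0 < (b A n)%:R :> R by rewrite ltr0n; exact: b_gt0.
have K0 : 0 <= K.
  have [c1 _] := track_cst_ge eta_gt0 eta_lt1.
  have tc : 0 <= track_cst eta by apply: le_trans c1; rewrite ln_ge0 // ler1n.
  by apply: addr_ge0 (normr_ge0 _); apply: addr_ge0 tc (ltW (lg2_gt0 R)).
have d0 : 0 < beta' - beta by rewrite subr_gt0.
have E0 : 0 <= expR (K + K / (beta' - beta)) := expR_ge0 _.
have B0 := ltW (ln_base_gt0 R F); have P0 := powR_ge0 n%:R beta'.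
rewrite -[leLHS]lnK ?posrE // ler_expR /growth_cst -/K.
case: (ltnP n 4) => n4.
  have nS : (n <= vsum (vseq unit_weights (om A) 1))%N.
    have := vsum_vseqX (om A) 0 1; rewrite add0n; apply: leq_trans.
    by apply: leq_trans (ltnW n4) _.
  have := growth_at_level F eta_gt0 eta_lt1 eta_eq alpha_gt0 alpha_lt beta_le1 alpha_ge nS.
  rewrite -(ler_nat R) => hb; have : ln (b A n)%:R <= ln (base F ^ 2 ^ 1)%:R :> R.
    by rewrite ler_ln // posrE // ltr0n baseX_gt0.
  rewrite (ln_natX R _ (ltnW (base_gt1 F))) expn1.
  move: (ln _) (expR _) (_ `^ _) (ln _) B0 E0 P0 => x y z t; lra.
case: (lerP (ln (b A n)%:R : R) 0) => lb0.
  apply: le_trans lb0 _; rewrite !addr_ge0 // mulr_ge0 //.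
have := loglog_le F eta_gt0 eta_lt1 eta_eq A alpha_gt0 alpha_lt beta_le1 alpha_ge n4.
rewrite -/K /loglog -ler_expR lnK ?posrE // => h.
have y0 : 0 <= ln n%:R :> R by rewrite ln_ge0 // ler1n (leq_trans _ n4).
have n0 : n%:R != 0 :> R by rewrite pnatr_eq0; case: (n) n4.
case: (lerP (K / (beta' - beta)) (ln n%:R)) => hy.
  have : ln (b A n)%:R <= n%:R `^ beta'.
    apply: le_trans h _; rewrite /powR (negPf n0) ler_expR.
    by move: hy; rewrite ler_pdivrMr //; lra.
  by move: B0 E0; move: (expR _) (ln _) (ln _) (_ `^ _) => x y z t; lra.
have : ln (b A n)%:R <= expR (K + K / (beta' - beta)).
  apply: le_trans h _; rewrite ler_expR addrC lerD2l; apply: le_trans (ltW hy).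
  by rewrite ler_piMl.
by move: B0 P0; move: (expR _) (ln _) (ln _) (_ `^ _) => x y z t; lra.
Qed.

Lemma family_antichain : antichain_with_exponents F alpha beta
  (range (fun xi : nat -> bool => om (prefix_codes xi))).
Proof.
have not_le xi zeta : xi <> zeta -> ~ growth_le (b (prefix_codes xi)) (b (prefix_codes zeta)).
  by move=> ne; apply: not_growth_le; [apply: prefix_codes_sep => e; exact: ne|exact: prefix_codes_unbounded].
split.
(* Equal sequences would have comparable growth, so incomparability also gives injectivity of the
   family. *)
- apply: uncountable_image => xi zeta e; apply: contrapT => ne.
  by apply: (not_le _ _ ne); rewrite /b e; exists 1%N => r; rewrite mul1n.
- move=> _ _ [xi _ <-] [zeta _ <-] ne.
  have ne' : xi <> zeta by move=> e; apply: ne; rewrite e.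
  by case; [exact: not_le | apply: not_le => e; exact: ne'].
move=> _ [xi _ <-]; apply: exponents_omega; first exact: prefix_codes_unbounded.
exact: prefix_codes_counbounded.
Qed.
End Family.

(** * The root of the cubic *)

Section Root.
Variables (R : realType) (eta : R).
Hypothesis eta_root : root ('X^3 + 'X^2 + 'X - 2%:P) eta.

Lemma eta_cubic : eta ^+ 3 + eta ^+ 2 + eta = 2%:R.
Proof.
by apply/eqP; rewrite -subr_eq0; move: eta_root; rewrite /root !hornerE.
Qed.

Lemma eta_bounds : 0 < eta /\ eta < 1.
Proof.
have e := eta_cubic; split; rewrite ltNge; apply/negP => h.
  have : eta * (eta ^+ 2 + eta + 1) <= 0.
    rewrite mulr_le0_ge0 //; have : 0 <= (eta + 1) ^+ 2 by rewrite sqr_ge0.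
    by have := sqr_ge0 eta; rewrite !expr2; lra.
  by move: e; rewrite !exprS expr0; lra.
have h2 : 1 <= eta ^+ 2 by rewrite exprn_ege1.
have h3 : 1 <= eta ^+ 3 by rewrite exprn_ege1.
by move: e h2 h3 h; lra.
Qed.

Lemma alpha0_gt0 : 0 < ln 2%:R / (ln 2%:R - ln eta).
Proof.
have [e0 e1] := eta_bounds; have lg2 := lg2_gt0 R.
have le : ln eta < 0 by apply: ln_lt0; rewrite e0.
by rewrite divr_gt0 // subr_gt0 (lt_trans le).
Qed.

End Root.

Theorem theorem7p2 (R : realType) (F : finGroupType) (eta : R)
    (eta_root : root ('X^3 + 'X^2 + 'X - 2%:P) eta) :
  let alpha0 := ln 2 / (ln 2 - ln eta) in
  (forall alpha beta : R, alpha0 <= alpha -> alpha < beta -> beta <= 1 ->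
    exists Omega : set omega_seq,
      antichain_with_exponents F alpha beta Omega) /\
  (forall beta beta' : R, beta < beta' -> beta' <= 1 ->
    exists C : R, forall alpha : R, alpha0 <= alpha -> alpha < beta ->
      exists Omega : set omega_seq,
        antichain_with_exponents F alpha beta Omega /\
        (forall w, Omega w -> forall r : nat,
          (Gamma_growth F w r)%:R <= C * expR (r%:R `^ beta'))).
Proof.
have [eta0 eta1] := eta_bounds eta_root; have eta_eq := eta_cubic eta_root.
move=> alpha0; have alpha0_gt0 : 0 < alpha0 := alpha0_gt0 eta_root; split.
  move=> alpha beta a0 ab b1; have alpha_gt0 : 0 < alpha := lt_le_trans alpha0_gt0 a0.
  eexists; exact: (family_antichain F eta0 eta1 eta_eq alpha_gt0 ab b1 a0).
(* [growth_cst] involves neither [alpha] nor the sequence, so the constant can be fixed before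
   both. *)
move=> beta beta' bb' b1; exists (expR (growth_cst F eta beta beta')) => alpha a0 ab.
have alpha_gt0 : 0 < alpha := lt_le_trans alpha0_gt0 a0.
have beta_le1 : beta <= 1 := ltW (lt_le_trans bb' b1).
eexists; split; first exact: (family_antichain F eta0 eta1 eta_eq alpha_gt0 ab beta_le1 a0).
move=> _ [xi _ <-] r.
exact: (growth_uniform F eta0 eta1 eta_eq alpha_gt0 ab beta_le1 a0).
Qed.
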